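(* Consider a sequential fragmentation of $(0,1)$ in which at each step the current largest subinterval is split into $b\ge2$ pieces by $b-1$ random division points whose positions, rescaled to the unit interval, have a fixed law (the same at every step, independently of the past). Let $F(x)$ be the expected number of pieces of length $<x$ when $(0,1)$ is split according to this law, and assume $F$ is uniformly continuous on $(0,1)$, differentiable, with $F'$ uniformly positive. Then the spacing distribution of the process is stationary if and only if the mean spacing of the process is stationary.
   Context: After $n$ splits there are $N=n(b-1)+1$ spacings; let $L_n$ denote the length of the current largest spacing, which is used as the unit of length. The normalized empirical spacing distribution is $u_n(x)=\frac1N\#\{\text{spacings of length}\le xL_n\}$, $x\in[0,1]$. The spacing distribution is called stationary if $u_n$ converges (with high probability, uniformly in $x$) to a limiting function as $n\to\infty$. The mean spacing is called stationary if the mean normalized spacing within $(0,y)$, namely $y/(L_n\cdot\#\{\text{spacings contained in }(0,y)\})$, converges as $n\to\infty$ to the same value for every $y\in(0,1]$ (equivalently, the empirical distribution of the division points is asymptotically uniform on $(0,1)$). *)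

(* Defs.v *)
From HB Require Import structures.
From mathcomp Require Import all_boot all_order all_algebra.
From mathcomp Require Import all_classical all_reals all_analysis.
Set Implicit Arguments. Unset Strict Implicit. Unset Printing Implicit Defensive.
Import Order.TTheory GRing.Theory Num.Theory.
Import numFieldNormedType.Exports.
Local Open Scope classical_set_scope.
Local Open Scope ring_scope.

Section Frag.
Variable R : realType.

(* consecutive pairs of a sorted list of endpoints = the subintervals *)
Definition gaps (e : seq R) : seq (R * R) := zip e (behead e).

Definition gap_lengths (e : seq R) : seq R := [seq p.2 - p.1 | p <- gaps e].

Definition max_len (e : seq R) : R := foldr Num.max 0 (gap_lengths e).

(* one step: split the largest subinterval (leftmost one in case of ties)
   at the rescaled positions u j, j < b-1 *)
Definition frag_step (b : nat) (e : seq R) (u : 'I_(b - 1) -> R) : seq R :=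
  let g := gaps e in
  let L := max_len e in
  let i := find (fun p => p.2 - p.1 == L) g in
  let ac := nth (0, 1) g i in
  sort <=%R (e ++ [seq ac.1 + (ac.2 - ac.1) * u j | j <- enum 'I_(b - 1)]).

Fixpoint frag_state (b : nat) (U : nat -> 'I_(b - 1) -> R) (n : nat) : seq R :=
  match n with
  | 0 => [:: 0; 1]
  | n'.+1 => frag_step (frag_state U n') (U n')
  end.

Definition one_split (b : nat) (u : 'I_(b - 1) -> R) : seq R :=
  gap_lengths (sort <=%R (0 :: 1 :: [seq u j | j <- enum 'I_(b - 1)])).

Definition spacing_distr (b : nat) (U : nat -> 'I_(b - 1) -> R) (n : nat)
    (x : R) : R :=
  let e := frag_state U n in
  (count (fun l => l <= x * max_len e) (gap_lengths e))%:R / (n * (b - 1)).+1%:R.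

Definition mean_spacing (b : nat) (U : nat -> 'I_(b - 1) -> R) (n : nat)
    (y : R) : R :=
  let e := frag_state U n in
  y / (max_len e * (count (fun p => (0 <= p.1) && (p.2 <= y)) (gaps e))%:R).

End Frag.

(* Main.v *)
Require Import Defs.
From HB Require Import structures.
From mathcomp Require Import all_boot all_order all_algebra.
From mathcomp Require Import all_classical all_reals all_analysis.
From mathcomp Require Import measurable_realfun ring lra zify.
Set Implicit Arguments. Unset Strict Implicit. Unset Printing Implicit Defensive.
Import Order.TTheory GRing.Theory Num.Theory.
Import numFieldNormedType.Exports.
Local Open Scope classical_set_scope.
Local Open Scope ring_scope.

(** Under the hypotheses both properties always hold, so the equivalence is immediate.

For [chi] nondecreasing with values in [0, 1], let [h r] be the expected [chi]-weight of the pieces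
created when an interval of length [r] is split until no piece is longer than 1. It solves the renewal
equation [h r = E (sum_l (h + chi) (r l))] for [r > 1], and [h r / r] has a limit. For a cut-off [t],
the sum of [h (l / t)] over the current spacings [l], plus the weight created so far by splitting
spacings longer than [t], is therefore a martingale; its increments are [O (L_j / t)], and
[sum_j E (L_j ^ 2)] is finite, so that for [t = theta / n] it stays within [o(n)] of its value at a
fixed time, which is the limit slope divided by [t] up to a small error. Since the largest spacing is
split first, all spacings longer than [t] have been split once [L_n <= t] and no others have before.
Constant weights then give [n L_n -> M]; keeping only the spacings on one side of [y] gives the number of
spacings in [(0, y)]; the weights [chi = 1_(x, oo)] give the number of spacings longer than [x L_n]. *)

(** * Spacings *)

(** The limit of [h r / r] rests on three facts. In mean, [excess] drops by at least [kap] at each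
    split above the cut-off, which bounds [h] linearly, and [M] is taken as the lower limit of the
    slope. At a scale where the slope nearly attains [M], positivity of [F'] makes pieces of every
    relative length occur with density at least [delta], so no smaller scale in a long window can
    have a markedly larger slope. A supersolution of the renewal equation then carries the upper
    bound from that window to all larger scales.

    The order of choices in the martingale step matters. After multiplication by [t], the variance
    accumulated after time [m] is bounded by a tail of the sum of [E (L_j ^ 2)], whatever [t] is. So
    [m] is fixed first, and every cost that depends on [m] alone vanishes with [t] as [n] grows.

    Uniform continuity of [F] makes the limit slope continuous in the threshold [x]. Since counts
    are monotone in [x], convergence on a finite grid then gives uniform convergence. *)

Section Gaps.
Variable R : realType.
Implicit Types (e s : seq R) (x y z : R).

Lemma gaps_cat s1 x s2 :
  gaps (s1 ++ x :: s2) = gaps (rcons s1 x) ++ gaps (x :: s2).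
Proof.
elim: s1 => [|y s1 IH] /=; first by rewrite /gaps /=.
case: s1 IH => [|z s1] IH; first by rewrite /gaps.
by move: IH; rewrite /gaps /= => ->.
Qed.

Lemma gaps_cons2 x y s : gaps (x :: y :: s) = (x, y) :: gaps (y :: s).
Proof. by []. Qed.

Lemma gaps_map (f : R -> R) s :
  gaps (map f s) = [seq (f p.1, f p.2) | p <- gaps s].
Proof.
elim: s => [|x [|y s] IH] //.
by rewrite [map f _]/= !gaps_cons2 /= -IH.
Qed.

Lemma size_gaps s : size (gaps s) = (size s).-1.
Proof. by rewrite /gaps size_zip size_behead; case: (size s) => //= n; lia. Qed.

Lemma nth_gaps s i p0 : (i < (size s).-1)%N ->
  nth p0 (gaps s) i = (nth 0 s i, nth 0 s i.+1).
Proof.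
move=> lti.
have szi : (i < size (gaps s))%N by rewrite size_gaps.
have szz : (i < size (zip s (behead s)))%N by rewrite -/(gaps s).
rewrite (set_nth_default (0, 0))// /gaps nth_zip_cond szz nth_behead.
by [].
Qed.

Lemma gaps_le s p : sorted <=%R s -> p \in gaps s -> p.1 <= p.2.
Proof.
elim: s => [|x [|y s] IH] //=.
rewrite gaps_cons2 in_cons => /andP[xy ps] /orP[/eqP->//|]; exact: IH.
Qed.

Lemma gaps_mem s p : p \in gaps s -> (p.1 \in s) && (p.2 \in s).
Proof.
elim: s => [|x [|y s] IH] //=.
rewrite gaps_cons2 in_cons => /orP[/eqP->|/IH /andP[h1 h2]].
  by rewrite !in_cons !eqxx orbT.
by rewrite !(in_cons x) h1 h2 !orbT.
Qed.

Lemma sum_gaps x s : \sum_(p <- gaps (x :: s)) (p.2 - p.1) = last x s - x.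
Proof.
elim: s x => [|y s IH] x; first by rewrite /gaps big_nil subrr.
by rewrite gaps_cons2 big_cons IH /=; ring.
Qed.

Lemma max_len_ge0 e : 0 <= max_len e.
Proof. by rewrite /max_len; elim: (gap_lengths e) => //= x l IH; rewrite le_max IH orbT. Qed.

Lemma max_len_ge e p : p \in gaps e -> p.2 - p.1 <= max_len e.
Proof.
rewrite /max_len /gap_lengths; elim: (gaps e) => //= q l IH.
rewrite in_cons le_max => /orP[/eqP->|/IH ->]; first by rewrite lexx.
by rewrite orbT.
Qed.

Lemma max_len_le e B : 0 <= B ->
  (forall p, p \in gaps e -> p.2 - p.1 <= B) -> max_len e <= B.
Proof.
rewrite /max_len /gap_lengths => B0; elim: (gaps e) => //= q l IH H.
rewrite ge_max H ?mem_head//= IH// => p pl; apply: H.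
by rewrite in_cons pl orbT.
Qed.

Lemma max_len_attained e : 0 < max_len e ->
  has (fun p => p.2 - p.1 == max_len e) (gaps e).
Proof.
rewrite /max_len /gap_lengths; elim: (gaps e) => [|q l IH] /=.
  by rewrite ltxx.
case: (leP (q.2 - q.1) (foldr Num.max 0 [seq p.2 - p.1 | p <- l])) => [h1|h1].
  by move=> /IH h; rewrite h orbT.
by rewrite eqxx.
Qed.

(** The default values 1 and 0 make both end tests fail on the empty list. *)
Definition valid e := [&& sorted <=%R e, head 1 e == 0 & last 0 e == 1].

Definition big_gap e : R * R :=
  nth (0, 1) (gaps e) (find (fun p => p.2 - p.1 == max_len e) (gaps e)).

Lemma valid_cons e : valid e -> exists s, e = 0 :: s /\ last 0 s = 1.
Proof.
case: e => [|x s] /and3P[_ /= /eqP]; first by move/eqP; rewrite oner_eq0.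
by move=> -> /eqP ls; exists s.
Qed.

Lemma valid_sum e : valid e -> \sum_(p <- gaps e) (p.2 - p.1) = 1.
Proof. by move=> /valid_cons[s [-> ls]]; rewrite sum_gaps ls subr0. Qed.

Lemma valid_max_gt0 e : valid e -> 0 < max_len e.
Proof.
move=> ve; have := valid_sum ve; rewrite lt_neqAle max_len_ge0 andbT eq_sym => h.
apply/negP => /eqP m0; move: h.
suff : \sum_(p <- gaps e) (p.2 - p.1) <= 0.
  by move=> h1 h2; move: h1; rewrite h2 ler10.
by rewrite big_seq; apply: sumr_le0 => p pe; rewrite -m0; apply: max_len_ge.
Qed.

Lemma big_gapP e : 0 < max_len e -> exists e1 e2,
  e = e1 ++ (big_gap e).1 :: (big_gap e).2 :: e2 /\
  (big_gap e).2 - (big_gap e).1 = max_len e.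
Proof.
move=> ve; have hh := max_len_attained ve.
have eq1 : (big_gap e).2 - (big_gap e).1 = max_len e.
  by apply/eqP; exact: (nth_find (0, 1) hh).
set i := find (fun p => p.2 - p.1 == max_len e) (gaps e).
have lti : (i < (size e).-1)%N by rewrite -size_gaps -has_find.
have bE : big_gap e = (nth 0 e i, nth 0 e i.+1) by rewrite /big_gap nth_gaps.
exists (take i e), (drop i.+2 e); split => //.
have i1 : (i.+1 < size e)%N by lia.
by rewrite bE /= -{1}(cat_take_drop i e) (drop_nth 0 (ltnW i1)) (drop_nth 0 i1).
Qed.

Lemma sorted_catP (e1 e2 s : seq R) a c : a <= c ->
  sorted <=%R (e1 ++ a :: c :: e2) -> path <=%R a (rcons s c) ->
  sorted <=%R (e1 ++ a :: rcons s c ++ e2).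
Proof.
move=> ac.
have E (t : seq R) : sorted <=%R (e1 ++ a :: t) =
    sorted <=%R (rcons e1 a) && path <=%R a t.
  rewrite -cat_rcons; case: e1 => [|x e1] //=.
  by rewrite cat_path last_rcons.
rewrite !E => /andP[->] /= /andP[_ p2] p1.
by rewrite cat_path last_rcons p1.
Qed.

End Gaps.

(** * The effect of one split on sums over the spacings *)

Section Step.
Variables (R : realType) (b : nat).
Implicit Types (e s : seq R) (u : 'I_(b - 1) -> R).

Definition pieces u : seq (R * R) :=
  gaps (sort <=%R (0 :: 1 :: [seq u j | j <- enum 'I_(b - 1)])).

Definition unitv u := forall j, 0 < u j < 1.

Lemma one_splitE u : one_split u = [seq p.2 - p.1 | p <- pieces u].
Proof. by []. Qed.

Lemma size_one_split u : (2 <= b)%N -> size (one_split u) = b.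
Proof.
move=> b2; rewrite size_map size_gaps size_sort /= size_map size_enum_ord; lia.
Qed.

Lemma sort_unit u : unitv u ->
  sort <=%R (0 :: 1 :: [seq u j | j <- enum 'I_(b - 1)]) =
  0 :: rcons (sort <=%R [seq u j | j <- enum 'I_(b - 1)]) 1.
Proof.
move=> uu; set us := [seq u j | j <- _].
have usP x : x \in sort <=%R us -> 0 < x < 1.
  by rewrite mem_sort => /mapP[j _ ->]; exact: uu.
apply: (@sorted_eq _ <=%R) => //.
- exact: le_trans.
- exact: le_anti.
- by apply: sort_sorted; exact: le_total.
- rewrite /= rcons_path; apply/andP; split.
    rewrite path_min_sorted; first by apply: sort_sorted; exact: le_total.
    by apply/allP => x /usP /andP[/ltW].
  have := mem_last 0 (sort <=%R us); rewrite in_cons => /orP[/eqP->|/usP /andP[_ /ltW]//].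
  exact: ler01.
- rewrite perm_sort perm_cons perm_sym perm_rcons perm_cons perm_sort; exact: perm_refl.
Qed.

(** The affine image of the sorted positions lies between [a] and [c], so sorting only inserts it
    there: two sorted lists that are permutations of each other are equal. *)
Lemma frag_stepE e u : valid e -> unitv u ->
  let a := (big_gap e).1 in let c := (big_gap e).2 in
  exists e1 e2, [/\ e = e1 ++ a :: c :: e2,
   valid (frag_step e u) &
   frag_step e u = e1 ++ a :: rcons [seq a + (c - a) * x | x <- sort <=%R [seq u j | j <- enum 'I_(b - 1)]] c ++ e2].
Proof.
move=> ve uu a c; have m0 := valid_max_gt0 ve.
have [e1 [e2 [eE lE]]] := big_gapP m0; rewrite -/a -/c in eE lE.
exists e1, e2.
have ca : 0 < c - a by rewrite lE.
pose f x := a + (c - a) * x.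
have fmono : {mono f : x y / x <= y} by move=> x y; rewrite /f lerD2l ler_pM2l.
set us := [seq u j | j <- _]; set fs := [seq _ | x <- _].
have so : sorted <=%R (e1 ++ a :: rcons fs c ++ e2).
  apply: sorted_catP; first by rewrite -subr_ge0 ltW.
    by rewrite -eE; case/and3P: ve.
  have := (@sort_sorted _ <=%R (@le_total _ _) (0 :: 1 :: us)).
  rewrite sort_unit// -(mono_sorted fmono) /= /f map_rcons mulr0 addr0 mulr1.
  by rewrite subrKC.
have stE : frag_step e u = e1 ++ a :: rcons fs c ++ e2.
  apply: (@sorted_eq _ <=%R) => //.
  - exact: le_trans.
  - exact: le_anti.
  - by apply: sort_sorted; exact: le_total.
  - have -> : frag_step e u = sort <=%R (e ++ map f us) by rewrite -map_comp.
    have cfs P : count P fs = count P (map f us).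
      by apply/permP: P; apply: perm_map; rewrite perm_sort.
    rewrite perm_sort; apply/permP => P.
    by rewrite {1}eE -cats1 !count_cat /= !count_cat /= cfs addn0 -!addnA; do 2 congr (_ + _)%N; rewrite addnA addnC.
split => //; apply/and3P; split => //; first by rewrite stE.
- by case/and3P: ve => _ + _; rewrite stE {1}eE; case: (e1).
- case/and3P: ve => _ _; rewrite stE {1}eE.
  by rewrite !last_cat /= last_cat last_rcons.
Qed.

(** [phi] sees the end points and not only the length, so that sums restricted to one side of a
    point are covered as well as masses, counts and squared lengths. *)
Lemma gaps_frag_step e u (phi : R * R -> R) : valid e -> unitv u ->
  \sum_(p <- gaps (frag_step e u)) phi p =
  \sum_(p <- gaps e) phi p - phi (big_gap e) +
  \sum_(q <- pieces u) phi ((big_gap e).1 + max_len e * q.1, (big_gap e).1 + max_len e * q.2).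
Proof.
move=> ve uu; have [e1 [e2 []]] := frag_stepE ve uu.
have [_ [_ [_ lE]]] := big_gapP (valid_max_gt0 ve).
have bE : big_gap e = ((big_gap e).1, (big_gap e).2) by case: (big_gap e).
rewrite {1}[in phi (big_gap e)]bE -lE.
set a := (big_gap e).1; set c := (big_gap e).2 => eE _ ->.
set fs := [seq _ | x <- _].
have -> : \sum_(p <- gaps e) phi p = \sum_(p <- gaps (rcons e1 a)) phi p + phi (a, c) + \sum_(p <- gaps (c :: e2)) phi p.
  by rewrite eE gaps_cat big_cat gaps_cons2 big_cons /= addrA.
have -> : e1 ++ a :: rcons fs c ++ e2 = e1 ++ a :: (fs ++ c :: e2) by rewrite cat_rcons.
rewrite gaps_cat big_cat /= -cat_cons gaps_cat big_cat /=.
have -> : gaps (rcons (a :: fs) c) = [seq (a + (c - a) * q.1, a + (c - a) * q.2) | q <- pieces u].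
  rewrite /pieces sort_unit// -[RHS](gaps_map (fun x => a + (c - a) * x)).
  by congr gaps; rewrite /= map_rcons mulr0 addr0 mulr1 subrKC.
rewrite big_map /=; ring.
Qed.

Lemma big_gap_len e : valid e -> (big_gap e).2 = (big_gap e).1 + max_len e.
Proof.
move=> /valid_max_gt0 /big_gapP[_ [_ [_ <-]]]; by rewrite subrKC.
Qed.

Lemma pieces_bound u q : unitv u -> q \in pieces u -> [/\ 0 <= q.1, q.1 <= q.2 & q.2 <= 1].
Proof.
move=> uu qp.
have srt : sorted <=%R (sort <=%R (0 :: 1 :: [seq u j | j <- enum 'I_(b - 1)])).
  by apply: sort_sorted; exact: le_total.
have B x : x \in (sort <=%R (0 :: 1 :: [seq u j | j <- enum 'I_(b - 1)])) -> 0 <= x <= 1.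
  rewrite mem_sort !in_cons => /or3P[/eqP->|/eqP->|/mapP[j _ ->]].
  - by rewrite lexx ler01.
  - by rewrite lexx ler01.
  - by have /andP[/ltW-> /ltW->] := uu j.
have /andP[/B /andP[-> _] /B /andP[_ ->]] := gaps_mem qp.
by split => //; exact: gaps_le qp.
Qed.

Lemma one_split_sum u : unitv u -> \sum_(l <- one_split u) l = 1.
Proof.
move=> uu; rewrite one_splitE big_map /pieces sort_unit// sum_gaps.
by rewrite last_rcons subr0.
Qed.

Lemma one_split_ge0 u l : l \in one_split u -> 0 <= l.
Proof.
rewrite one_splitE => /mapP[q qp ->]; rewrite subr_ge0; apply: (gaps_le _ qp).
by apply: sort_sorted; exact: le_total.
Qed.

Lemma one_split_le1 u l : unitv u -> l \in one_split u -> l <= 1.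
Proof.
move=> uu; rewrite one_splitE => /mapP[q qp ->].
by have [h1 h2 h3] := pieces_bound uu qp; lra.
Qed.

Lemma size_frag_step e u : size (frag_step e u) = (size e + (b - 1))%N.
Proof. by rewrite size_sort size_cat size_map size_enum_ord. Qed.

Variable U : nat -> 'I_(b - 1) -> R.

Lemma size_frag_state n : size (frag_state U n) = (n * (b - 1) + 2)%N.
Proof. by elim: n => //= n IH; rewrite size_frag_step IH; lia. Qed.

Lemma size_gaps_frag_state n : size (gaps (frag_state U n)) = (n * (b - 1)).+1.
Proof. by rewrite size_gaps size_frag_state addn2. Qed.

Hypothesis Ugood : forall k, unitv (U k).

Lemma valid_frag_state n : valid (frag_state U n).
Proof.
elim: n => [|n IH] /=; first by rewrite /valid /= ler01 !eqxx.
by have [e1 [e2 []]] := frag_stepE IH (Ugood n).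
Qed.

Lemma max_len_step n : max_len (frag_state U n.+1) <= max_len (frag_state U n).
Proof.
have ve := valid_frag_state n.
apply: max_len_le; first exact: max_len_ge0.
move=> p; rewrite leNgt => pin; apply/negP => hlt.
(* The indicator of lengths above the old maximum: it vanishes on every old gap and on every piece,
   so its sum after the split is zero. *)
have := gaps_frag_step (fun p => (max_len (frag_state U n) < p.2 - p.1)%R%:R) ve (Ugood n).
rewrite -/(frag_state U n.+1) [X in X - _]big1_seq ?[X in _ + X]big1_seq; last 2 first.
- move=> q /= qp; have [h1 h2 h3] := pieces_bound (Ugood n) qp.
  apply/eqP; rewrite pnatr_eq0 eqb0 -leNgt.
  have := max_len_ge0 (frag_state U n); set L := max_len _ => L0; nra.
- by move=> q /= qp; apply/eqP; rewrite pnatr_eq0 eqb0 -leNgt; exact: max_len_ge.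
rewrite big_gap_len// [_ + _ - _]addrC addKr ltxx subrr addr0 => /eqP.
rewrite psumr_eq0; last by move=> q _; rewrite ler0n.
by move=> /allP /(_ _ pin); rewrite /= hlt pnatr_eq0.
Qed.

Lemma max_len_mono m n : (m <= n)%N -> max_len (frag_state U n) <= max_len (frag_state U m).
Proof.
by move=> /subnKC <-; elim: (n - m)%N => [|k IH]; rewrite ?addn0// addnS (le_trans (max_len_step _)).
Qed.

Lemma max_len_frag_gt0 n : 0 < max_len (frag_state U n).
Proof. exact/valid_max_gt0/valid_frag_state. Qed.

Lemma max_len_frag_le1 n : max_len (frag_state U n) <= 1.
Proof.
apply: le_trans (max_len_mono (leq0n n)) _.
by apply: max_len_le => // p; rewrite /gaps /= inE => /eqP -> /=; rewrite subr0.
Qed.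

(** [I] is inherited by the sub-intervals of a gap. *)
Definition hered (I : R * R -> bool) := forall p q : R * R,
  p.1 <= q.1 -> q.1 <= q.2 -> q.2 <= p.2 -> I p -> I q.

Definition region_sum (I : R * R -> bool) (H : R -> R) n : R :=
  \sum_(p <- gaps (frag_state U n) | I p) H (p.2 - p.1).

(** Only an inequality: a gap outside the region may have pieces inside it, and these contribute a
    nonnegative amount. *)
Lemma region_sum_step I H n : hered I -> (forall x, 0 <= x -> 0 <= H x) ->
  let L := max_len (frag_state U n) in
  region_sum I H n + (I (big_gap (frag_state U n)))%:R *
     (\sum_(l <- one_split (U n)) H (L * l) - H L) <= region_sum I H n.+1.
Proof.
move=> hI H0; cbv zeta; set L := max_len (frag_state U n).
have ve := valid_frag_state n; set g := big_gap (frag_state U n).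
rewrite /region_sum big_mkcond [X in _ <= X]big_mkcond /=.
rewrite (gaps_frag_step (fun p => if I p then H (p.2 - p.1) else 0) ve (Ugood n)) -/g -/L.
have gE : g.2 = g.1 + L by exact: big_gap_len.
have L0 : 0 < L := max_len_frag_gt0 n.
have pe q : (g.1 + L * q.2) - (g.1 + L * q.1) = L * (q.2 - q.1) by ring.
rewrite -addrA lerD2l; case: ifPn => Ig; last first.
  rewrite mul0r oppr0 add0r big_seq; apply: sumr_ge0 => q qp; case: ifP => // _.
  apply: H0; have [h1 h2 h3] := pieces_bound (Ugood n) qp.
  rewrite pe mulr_ge0// ?(ltW L0)//; lra.
have -> : g.2 - g.1 = L by rewrite gE addrC addKr.
rewrite mul1r addrC lerD2r one_splitE big_map le_eqVlt; apply/orP; left; apply/eqP.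
apply: eq_big_seq => q qp; rewrite /= pe.
have [h1 h2 h3] := pieces_bound (Ugood n) qp.
rewrite ifT//; apply: (hI g) => //=.
- by rewrite lerDl mulr_ge0// ltW.
- by rewrite lerD2l ler_pM2l.
- by rewrite gE lerD2l ger_pMr.
Qed.

Lemma region_sum_stepT H n :
  let L := max_len (frag_state U n) in
  region_sum predT H n.+1 = region_sum predT H n +
     (\sum_(l <- one_split (U n)) H (L * l) - H L).
Proof.
move=> L; have ve := valid_frag_state n; set g := big_gap (frag_state U n).
have gE : g.2 = g.1 + L by exact: big_gap_len.
rewrite /region_sum (gaps_frag_step (fun p => H (p.2 - p.1)) ve (Ugood n)) -/g -/L.
have -> : g.2 - g.1 = L by rewrite gE addrC addKr.
rewrite one_splitE big_map -addrA [- _ + _]addrC; congr (_ + (_ - _)).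
by apply: eq_bigr => q _; congr H; rewrite /=; ring.
Qed.

Lemma region_sum_ge I H m n : hered I -> (forall x, 0 <= x -> 0 <= H x) -> (m <= n)%N ->
  region_sum I H m + \sum_(m <= j < n) (I (big_gap (frag_state U j)))%:R *
     (\sum_(l <- one_split (U j)) H (max_len (frag_state U j) * l) - H (max_len (frag_state U j)))
   <= region_sum I H n.
Proof.
move=> hI H0 /subnKC <-; elim: (n - m)%N => [|k IH].
  by rewrite addn0 big_geq// addr0.
rewrite addnS big_nat_recr ?leq_addr//= addrA.
by apply: le_trans (region_sum_step _ hI H0); rewrite lerD2r.
Qed.

Lemma region_sum_eqT H m n : (m <= n)%N ->
  region_sum predT H n = region_sum predT H m + \sum_(m <= j < n)
     (\sum_(l <- one_split (U j)) H (max_len (frag_state U j) * l) - H (max_len (frag_state U j))).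
Proof.
move=> /subnKC <-; elim: (n - m)%N => [|k IH].
  by rewrite addn0 big_geq// addr0.
by rewrite addnS big_nat_recr ?leq_addr//= addrA -IH region_sum_stepT.
Qed.

(** A gap that straddles [y] belongs to neither side; this is the loss of [max_len] in the two mass
    bounds below. *)
Definition left_of y (p : R * R) := p.2 <= y.
Definition right_of y (p : R * R) := y < p.1.

Lemma hered_left y : hered (left_of y).
Proof. by move=> p q _ _ h h'; exact: le_trans h h'. Qed.
Lemma hered_right y : hered (right_of y).
Proof. by move=> p q h _ _ h'; exact: lt_le_trans h' h. Qed.
Lemma heredT : hered predT.
Proof. by []. Qed.

Lemma region_left_mass y n : 0 <= y <= 1 ->
  y - max_len (frag_state U n) <= region_sum (left_of y) id n.
Proof.
move=> /andP[y0 y1]; rewrite /region_sum /left_of.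
have ve := valid_frag_state n; set e := frag_state U n in ve *.
have srt : sorted <=%R e by case/and3P: ve.
have [s [eE ls]] := valid_cons ve.
(* The left end is freed from 0 and the right end from 1, so that the induction can drop the first
   gap. *)
suff : forall s x L, 0 <= L -> sorted <=%R (x :: s) -> y <= last x s ->
    (forall p, p \in gaps (x :: s) -> p.2 - p.1 <= L) ->
    y - x - L <= \sum_(p <- gaps (x :: s) | p.2 <= y) (p.2 - p.1).
  move=> /(_ s 0 (max_len e)); rewrite subr0 eE; apply => //.
  - exact: max_len_ge0.
  - by rewrite -eE.
  - by rewrite ls.
  - by move=> p; rewrite -eE; exact: max_len_ge.
elim=> [|c s' IH] x L L0 so yl HL.
  rewrite /gaps big_nil; move: yl => /=; lra.
move: so => /= /andP[xc so]; rewrite gaps_cons2 big_cons.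
have hc := HL (x, c) (mem_head _ _); rewrite /= in hc.
case: ifPn => /= cy.
  have h : y - c - L <= \sum_(p <- gaps (c :: s') | p.2 <= y) (p.2 - p.1).
    by apply: IH => // p ph; apply: HL; rewrite gaps_cons2 in_cons ph orbT.
  lra.
rewrite -ltNge in cy.
apply: (@le_trans _ _ 0); first lra.
rewrite big_seq_cond; apply: sumr_ge0 => p /andP[pin _]; rewrite subr_ge0; exact: gaps_le pin.
Qed.

Lemma region_right_mass y n : 0 <= y <= 1 ->
  1 - y - max_len (frag_state U n) <= region_sum (right_of y) id n.
Proof.
move=> /andP[y0 y1]; rewrite /region_sum /right_of.
have ve := valid_frag_state n; set e := frag_state U n in ve *.
have srt : sorted <=%R e by case/and3P: ve.
have [s [eE ls]] := valid_cons ve.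
suff : forall s x L, 0 <= L -> sorted <=%R (x :: s) -> x <= y + L ->
    (forall p, p \in gaps (x :: s) -> p.2 - p.1 <= L) ->
    last x s - y - L <= \sum_(p <- gaps (x :: s) | y < p.1) (p.2 - p.1).
  move=> /(_ s 0 (max_len e)); rewrite ls eE; apply => //.
  - exact: max_len_ge0.
  - by rewrite -eE.
  - by rewrite addr_ge0// max_len_ge0.
  - by move=> p; rewrite -eE; exact: max_len_ge.
elim=> [|c s' IH] x L L0 so yl HL.
  rewrite /gaps big_nil; move: yl => /=; lra.
have [yx|xy] := ltP y x.
  have -> : \sum_(p <- gaps [:: x, c & s'] | y < p.1) (p.2 - p.1) = \sum_(p <- gaps [:: x, c & s']) (p.2 - p.1).
    rewrite big_seq_cond [RHS]big_seq; apply: eq_bigl => p.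
    case pin : (p \in gaps [:: x, c & s']) => //=; apply: (lt_le_trans yx).
    have /andP[p1 _] := gaps_mem pin.
    move: p1; rewrite in_cons => /predU1P[->//|].
    exact: (allP (order_path_min le_trans so)).
  rewrite sum_gaps; lra.
move: so => /= /andP[xc so]; rewrite gaps_cons2 big_cons /= ltNge xy /=.
have hc := HL (x, c) (mem_head _ _); rewrite /= in hc.
apply: IH => //; first lra.
by move=> p ph; apply: HL; rewrite gaps_cons2 in_cons ph orbT.
Qed.

Lemma region_mass1 n : region_sum predT id n = 1.
Proof. exact/valid_sum/valid_frag_state. Qed.

Lemma region_sum_size n : region_sum predT (fun=> 1) n = (n * (b - 1)).+1%:R.
Proof. by rewrite /region_sum big_const_seq count_predT size_gaps_frag_state iter_addr_0. Qed.

End Step.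

(** * Bounded random variables and random lists *)

Section BoundedMeasurable.
Variable R : realType.
Context d (T : measurableType d) (P : probability T R).

(** At a fixed time all variables of the proof are bounded; this class is closed under products, so
    no integrability has to be discussed afterwards. *)
Definition bm (f : T -> R) :=
  measurable_fun setT f /\ exists C, forall w, `|f w| <= C.

Definition Ex (f : T -> R) : R := (\int[P]_w f w)%R.

Lemma bm_mf f : bm f -> measurable_fun setT f. Proof. by case. Qed.

Lemma bm_int f : bm f -> P.-integrable setT (EFin \o f).
Proof.
move=> [mf [C HC]]; apply: measurable_bounded_integrable => //.
  by rewrite [X in (X < _)%E](probability_setT P) ltry.
exists C; split; first exact: num_real.
by move=> x Cx t _; apply: le_trans (HC t) (ltW Cx).
Qed.

Lemma bm_cst r : bm (fun=> r).
Proof. by split => //; exists `|r|. Qed.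

Lemma bmD f g : bm f -> bm g -> bm (fun w => f w + g w).
Proof.
move=> [mf [C HC]] [mg [D HD]]; split; first exact: measurable_funD.
by exists (C + D) => w; rewrite (le_trans (ler_normD _ _)) ?lerD.
Qed.

Lemma bmM f g : bm f -> bm g -> bm (fun w => f w * g w).
Proof.
move=> [mf [C HC]] [mg [D HD]]; split; first exact: measurable_funM.
by exists (C * D) => w; rewrite normrM ler_pM.
Qed.

Lemma bmZ r f : bm f -> bm (fun w => r * f w).
Proof. by move=> bf; apply: bmM => //; exact: bm_cst. Qed.

Lemma bmB f g : bm f -> bm g -> bm (fun w => f w - g w).
Proof.
move=> [mf [C HC]] [mg [D HD]]; split; first exact: measurable_funB.
by exists (C + D) => w; rewrite (le_trans (ler_normB _ _)) ?lerD.
Qed.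

Lemma Ex_cst r : Ex (fun=> r) = r.
Proof. by rewrite /Ex Rintegral_cst// [X in fine X](probability_setT P) mulr1. Qed.

Lemma ExD f g : bm f -> bm g -> Ex (fun w => f w + g w) = Ex f + Ex g.
Proof. by move=> bf bg; rewrite /Ex RintegralD//; exact: bm_int. Qed.

Lemma ExB f g : bm f -> bm g -> Ex (fun w => f w - g w) = Ex f - Ex g.
Proof. by move=> bf bg; rewrite /Ex RintegralB//; exact: bm_int. Qed.

Lemma ExZ r f : bm f -> Ex (fun w => r * f w) = r * Ex f.
Proof. by move=> bf; rewrite /Ex RintegralZl//; exact: bm_int. Qed.

Lemma Ex_le f g : bm f -> bm g -> (forall w, f w <= g w) -> Ex f <= Ex g.
Proof. by move=> bf bg fg; apply: le_Rintegral => //; exact: bm_int. Qed.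

Lemma Ex_ge0 f : (forall w, 0 <= f w) -> 0 <= Ex f.
Proof. by move=> f0; apply: Rintegral_ge0. Qed.

Lemma Ex_EFin f : bm f -> (\int[P]_w (f w)%:E)%E = (Ex f)%:E.
Proof. by move=> bf; rewrite /Ex /Rintegral fineK//; apply: integrable_fin_num => //; exact: bm_int. Qed.

Lemma Ex_cvg (f_ : nat -> T -> R) f C : (forall n, measurable_fun setT (f_ n)) ->
  (forall n w, `|f_ n w| <= C) -> (forall w, f_ n w @[n --> \oo] --> f w) ->
  bm f -> Ex (f_ n) @[n --> \oo] --> Ex f.
Proof.
move=> mf bf cf bff.
have bn n : bm (f_ n) by split => //; exists C.
have h : (\int[P]_w (f_ n w)%:E)%E @[n --> \oo] --> (\int[P]_w (f w)%:E)%E.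
  apply: (@dominated_cvg _ _ _ P setT measurableT (fun n w => (f_ n w)%:E) (fun w => (f w)%:E) (fun=> C%:E)) => //.
  - by move=> n; exact/measurable_EFinP.
  - by move=> w _; apply/fine_cvgP; split; [exact: nearW|exact: cf].
  - exact: (bm_int (bm_cst C)).
  - by move=> n w _; rewrite abse_EFin lee_fin.
rewrite Ex_EFin// in h.
exact: fine_cvg h.
Qed.

Lemma Ex_markov f (c : R) : bm f -> (forall w, 0 <= f w) -> 0 < c ->
  (P [set w | (c < f w)%R] <= (Ex f / c)%:E)%E.
Proof.
move=> bf f0 c0.
have mA : measurable [set w | c < f w].
  rewrite -[X in measurable X]setTI.
  by have := measurable_fun_ltr (measurable_cst c) (bm_mf bf); apply => //; exact: measurableT.
have bi : bm (\1_[set w | c < f w]).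
  by split; [exact: measurable_indic|exists 1 => w; rewrite indicE; case: (_ \in _); rewrite ?normr1 ?normr0].
rewrite -(setIT [set w | c < f w]) -integral_indic// Ex_EFin// lee_fin ler_pdivlMr// mulrC -ExZ//.
apply: Ex_le => //; first exact: bmZ.
move=> w; rewrite indicE; case: (boolP (w \in _)) => [|_]; last by rewrite mulr0.
by rewrite inE /= mulr1 => /ltW.
Qed.

End BoundedMeasurable.

(** * Measurability of random lists *)

Section MeasurableLists.
Variable R : realType.
Context d (E : measurableType d).
Implicit Types s : E -> seq R.

(** The length is the same at all sample points, so measurability is that of finitely many
    coordinates and is proved by induction on [fs]. *)
Definition mlist s := exists2 fs : seq (E -> R),
  List.Forall (measurable_fun setT) fs & forall x, s x = [seq f x | f <- fs].

Definition mlist2 (s : E -> seq (R * R)) := exists2 fs : seq ((E -> R) * (E -> R)),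
  List.Forall (fun f => measurable_fun setT f.1 /\ measurable_fun setT f.2) fs &
  forall x, s x = [seq (f.1 x, f.2 x) | f <- fs].

Lemma mlist_nil : mlist (fun=> [::]).
Proof. by exists [::]. Qed.

Lemma mlist_cons (f : E -> R) s : measurable_fun setT f -> mlist s ->
  mlist (fun x => f x :: s x).
Proof.
move=> mf [fs Hfs sE]; exists (f :: fs); first exact: List.Forall_cons.
by move=> x; rewrite sE.
Qed.

Lemma mlist_map (I : Type) (l : seq I) (F : I -> E -> R) :
  (forall i, measurable_fun setT (F i)) -> mlist (fun x => [seq F i x | i <- l]).
Proof. by move=> mF; elim: l => [|i l IH] /=; [exact: mlist_nil|exact: mlist_cons]. Qed.

Lemma mlist_cat s1 s2 : mlist s1 -> mlist s2 -> mlist (fun x => s1 x ++ s2 x).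
Proof.
move=> [fs Hfs sE] [gs Hgs s'E]; exists (fs ++ gs).
  by apply/List.Forall_app.
by move=> x; rewrite sE s'E map_cat.
Qed.

Lemma mlist_gaps s : mlist s -> mlist2 (fun x => gaps (s x)).
Proof.
move=> [fs Hfs sE]; exists (zip fs (behead fs)).
  elim: Hfs => //= f l mf Hl IH; case: Hl mf IH => //= g l' mg Hl' mf IH.
  by apply: List.Forall_cons.
by move=> x; rewrite sE /gaps; elim: (fs) => //= f [|g l] //= ->.
Qed.

Lemma mlist2_lengths (s : E -> seq (R * R)) : mlist2 s -> mlist (fun x => [seq p.2 - p.1 | p <- s x]).
Proof.
move=> [fs Hfs sE]; exists [seq (fun x => f.2 x - f.1 x) | f <- fs].
  elim: Hfs => //= f l [mf mg] Hl IH; apply: List.Forall_cons => //.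
  exact: measurable_funB.
by move=> x; rewrite sE -!map_comp.
Qed.

Lemma mlist_max s : mlist s -> measurable_fun setT (fun x => foldr Num.max 0 (s x)).
Proof.
move=> [fs Hfs sE].
rewrite (_ : (fun _ => _) = fun x => foldr Num.max 0 [seq f x | f <- fs]); last first.
  by apply/funext => x; rewrite sE.
by elim: Hfs => //= f l mf Hl IH; exact: measurable_maxr.
Qed.

(** [Phi] may depend on the sample point because later summands involve the random largest
    length. *)
Lemma mlist_sum s (Phi : E -> R -> R) : mlist s ->
  (forall f : E -> R, measurable_fun setT f -> measurable_fun setT (fun x => Phi x (f x))) ->
  measurable_fun setT (fun x => \sum_(l <- s x) Phi x l).
Proof.
move=> [fs Hfs sE] mPhi.
rewrite (_ : (fun _ => _) = fun x => \sum_(f <- fs) Phi x (f x)); last first.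
  by apply/funext => x; rewrite sE big_map.
elim: Hfs => [|f l mf Hl IH].
  by rewrite (_ : (fun _ => _) = fun=> 0)//; apply/funext => w; rewrite big_nil.
rewrite (_ : (fun _ => _) = fun x => Phi x (f x) + \sum_(f <- l) Phi x (f x)).
  by apply: measurable_funD => //; exact: mPhi.
by apply/funext => w; rewrite big_cons.
Qed.

Lemma mlist2_sum (s : E -> seq (R * R)) (Phi : R * R -> R) : mlist2 s ->
  (forall f g : E -> R, measurable_fun setT f -> measurable_fun setT g ->
     measurable_fun setT (fun x => Phi (f x, g x))) ->
  measurable_fun setT (fun x => \sum_(p <- s x) Phi p).
Proof.
move=> [fs Hfs sE] mPhi.
rewrite (_ : (fun _ => _) = fun x => \sum_(f <- fs) Phi (f.1 x, f.2 x)); last first.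
  by apply/funext => x; rewrite sE big_map.
elim: Hfs => [|f l [mf mg] Hl IH].
  by rewrite (_ : (fun _ => _) = fun=> 0)//; apply/funext => w; rewrite big_nil.
rewrite (_ : (fun _ => _) = fun x => Phi (f.1 x, f.2 x) + \sum_(f <- l) Phi (f.1 x, f.2 x)).
  by apply: measurable_funD => //; exact: mPhi.
by apply/funext => w; rewrite big_cons.
Qed.

Lemma mfun_natr_bool (f : E -> bool) : measurable_fun setT f ->
  measurable_fun setT (fun x => (f x)%:R : R).
Proof.
move=> mf; rewrite (_ : (fun _ => _) = fun x => if f x then 1 else 0 : R); last first.
  by apply/funext => x; case: (f x).
exact: measurable_fun_ifT.
Qed.

Lemma mset_bool (f : E -> bool) : measurable_fun setT f -> measurable [set x | f x].
Proof. by move=> mf; rewrite -[X in measurable X]setTI; exact: mf. Qed.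

Lemma mlist_sort s : mlist s -> mlist (fun x => sort <=%R (s x)).
Proof.
move=> ms; have [fs Hfs sE] := ms.
exists [seq (fun x => nth 0 (sort <=%R (s x)) i) | i <- iota 0 (size fs)]; last first.
  move=> x; rewrite -map_comp; apply: (@eq_from_nth _ 0).
    by rewrite size_sort sE !size_map size_iota.
  move=> i; rewrite size_sort sE size_map => ifs.
  by rewrite (nth_map 0%N) ?size_iota// nth_iota//= add0n sE.
have : forall i, i \in iota 0 (size fs) -> measurable_fun setT (fun x => nth 0 (sort <=%R (s x)) i).
  move=> i; rewrite mem_iota /= add0n => ifs.
  apply: (measurability (@RGenOInfty.G R)) => [|/= _ [_] [r] -> <-].
    exact: RGenOInfty.measurableE.
  (* The entry of rank [i], counted from 0, exceeds [r] exactly when at most [i] entries are at most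
     [r], and that count is a measurable sum. *)
  rewrite setTI (_ : _ @^-1` _ = [set x | \sum_(l <- s x) (l <= r)%R%:R <= (i%:R : R)]).
    apply: mset_bool; apply: measurable_fun_ler => //.
    apply: mlist_sum ms _ => f mf; apply: mfun_natr_bool; exact: measurable_fun_ler.
  have cE x : \sum_(l <- s x) (l <= r)%R%:R = (count (<= r) (s x))%:R :> R.
    by rewrite -natr_sum -sum1_count [in RHS]big_mkcond; congr _%:R; apply: eq_bigr => l _; case: ifP.
  have so x : sorted <=%R (sort <=%R (s x)) by apply: sort_sorted; exact: le_total.
  have pc x : count (<= r) (sort <=%R (s x)) = count (<= r) (s x).
    by apply/permP: (<= r); rewrite perm_sort.
  apply/seteqP; split => x /=; rewrite in_itv/= andbT cE ler_nat -pc.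
    move=> h; rewrite leqNgt; apply/negP => hi.
    by have := nth_count_le 0 (so x) hi; rewrite leNgt h.
  move=> h; apply: nth_count_gt => //.
  by rewrite h size_sort sE size_map.
elim: (iota 0 (size fs)) => //= i l IH H; apply: List.Forall_cons.
  by apply: H; rewrite mem_head.
by apply: IH => j jl; apply: H; rewrite in_cons jl orbT.
Qed.

(** Turns the search for the leftmost largest gap into finitely many nested conditionals, whose
    measurability is elementary. *)
Lemma nth_find (A : Type) (a : pred A) x0 (l : seq A) :
  nth x0 l (find a l) = foldr (fun y z => if a y then y else z) x0 l.
Proof. by elim: l => //= y l IH; case: (a y). Qed.

Lemma mlist_max_len s : mlist s -> measurable_fun setT (fun x => max_len (s x)).
Proof. by move=> ms; apply: mlist_max; apply: mlist2_lengths; exact: mlist_gaps. Qed.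

Lemma mlist_big_gap s : mlist s ->
  measurable_fun setT (fun x => (big_gap (s x)).1) /\
  measurable_fun setT (fun x => (big_gap (s x)).2).
Proof.
move=> ms; have mL := mlist_max_len ms.
have [fs Hfs gE] := mlist_gaps ms.
have bE x : big_gap (s x) = foldr (fun f z => if f.2 x - f.1 x == max_len (s x) then (f.1 x, f.2 x) else z) (0, 1) fs.
  by rewrite /big_gap nth_find gE; elim: (fs) => //= f l ->.
rewrite (_ : (fun x => (big_gap (s x)).1) = fun x => (foldr (fun f z => if f.2 x - f.1 x == max_len (s x) then (f.1 x, f.2 x) else z) (0, 1) fs).1); last by apply/funext => x; rewrite bE.
rewrite (_ : (fun x => (big_gap (s x)).2) = fun x => (foldr (fun f z => if f.2 x - f.1 x == max_len (s x) then (f.1 x, f.2 x) else z) (0, 1) fs).2); last by apply/funext => x; rewrite bE.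
elim: Hfs => //= f l [mf mg] Hl [IH1 IH2].
have mif : measurable_fun setT (fun x => f.2 x - f.1 x == max_len (s x)).
  by apply: measurable_fun_eqr => //; exact: measurable_funB.
split.
  rewrite (_ : (fun _ => _) = fun x => if f.2 x - f.1 x == max_len (s x) then f.1 x else
   (foldr (fun f z => if f.2 x - f.1 x == max_len (s x) then (f.1 x, f.2 x) else z) (0, 1) l).1).
    exact: measurable_fun_ifT.
  by apply/funext => x; case: ifP.
rewrite (_ : (fun _ => _) = fun x => if f.2 x - f.1 x == max_len (s x) then f.2 x else
   (foldr (fun f z => if f.2 x - f.1 x == max_len (s x) then (f.1 x, f.2 x) else z) (0, 1) l).2).
  exact: measurable_fun_ifT.
by apply/funext => x; case: ifP.
Qed.

Lemma mlist_frag_step b s (u : E -> 'I_(b - 1) -> R) : mlist s ->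
  (forall j, measurable_fun setT (u ^~ j)) -> mlist (fun x => frag_step (s x) (u x)).
Proof.
move=> ms mu; have [m1 m2] := mlist_big_gap ms.
apply: mlist_sort; apply: mlist_cat => //.
apply: (@mlist_map _ _ (fun j x => (big_gap (s x)).1 + ((big_gap (s x)).2 - (big_gap (s x)).1) * u x j)) => j.
apply: measurable_funD => //; apply: measurable_funM => //; exact: measurable_funB.
Qed.

Lemma mlist_frag_state b (U : E -> nat -> 'I_(b - 1) -> R) n :
  (forall k j, (k < n)%N -> measurable_fun setT (fun x => U x k j)) ->
  mlist (fun x => frag_state (U x) n).
Proof.
elim: n => [|n IH] mU /=.
  by apply: mlist_cons => //; apply: mlist_cons => //; exact: mlist_nil.
apply: mlist_frag_step; first by apply: IH => k j kn; apply: mU; rewrite ltnS ltnW.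
by move=> j; apply: mU.
Qed.

Lemma mlist_one_split b (u : E -> 'I_(b - 1) -> R) :
  (forall j, measurable_fun setT (u ^~ j)) -> mlist (fun x => one_split (u x)).
Proof.
move=> mu; apply: mlist2_lengths; apply: mlist_gaps; apply: mlist_sort.
apply: mlist_cons => //; apply: mlist_cons => //; exact: (@mlist_map _ _ (fun j x => u x j)).
Qed.

End MeasurableLists.

(** * From independence on generators to iterated expectations *)

Section Independence.
Variable R : realType.
Context d (T : measurableType d) (P : probability T R).
Variables (S1 S2 : pointedType) (C1 : set (set S1)) (C2 : set (set S2)).
Hypotheses (C1T : C1 setT) (C2T : C2 setT) (C1I : setI_closed C1) (C2I : setI_closed C2).
Let T1 := g_sigma_algebraType C1.
Let T2 := g_sigma_algebraType C2.

(** As both generating families contain the whole space, the rectangles over them include the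
    cylinders over each factor, which make the two projections measurable. *)
Lemma measurable_prod_generated :
  @measurable _ (T1 * T2)%type = <<s [set A `*` B | A in C1 & B in C2] >>.
Proof.
set G := [set A `*` B | A in C1 & B in C2].
rewrite measurable_prod_measurableType; apply/seteqP; split.
  have m1 : measurable_fun [set: g_sigma_algebraType G] (fst : g_sigma_algebraType G -> T1).
    apply: (@measurability _ _ (g_sigma_algebraType G) T1 setT fst C1) => // _ [A cA <-]; rewrite setTI; apply: sub_sigma_algebra.
    by exists A => //; exists setT => //; rewrite setXT.
  have m2 : measurable_fun [set: g_sigma_algebraType G] (snd : g_sigma_algebraType G -> T2).
    apply: (@measurability _ _ (g_sigma_algebraType G) T2 setT snd C2) => // _ [A cA <-]; rewrite setTI; apply: sub_sigma_algebra.
    by exists setT => //; exists A => //; rewrite setTX.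
  apply: smallest_sub; first exact: smallest_sigma_algebra.
  move=> _ [A mA [B mB <-]].
  have -> : A `*` B = fst @^-1` A `&` snd @^-1` B :> set (S1 * S2) by [].
  apply: (@measurableI _ (g_sigma_algebraType G)).
    by rewrite -[X in measurable X]setTI; exact: m1.
  by rewrite -[X in measurable X]setTI; exact: m2.
apply: smallest_sub; first exact: smallest_sigma_algebra.
move=> _ [A cA [B cB <-]]; apply: sub_sigma_algebra.
exists A; first exact: sub_sigma_algebra.
by exists B => //; exact: sub_sigma_algebra.
Qed.

Variables (Y1 : {mfun T >-> T1}) (Y2 Y0 : {mfun T >-> T2}).
Hypothesis Y12 : forall A B, C1 A -> C2 B ->
  P (Y1 @^-1` A `&` Y2 @^-1` B) = (P (Y1 @^-1` A) * P (Y0 @^-1` B))%E.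

Let joint (w : T) : T1 * T2 := (Y1 w, Y2 w).
Let mjoint : measurable_fun setT joint.
Proof. exact: measurable_fun_pair. Qed.
HB.instance Definition _ := isMeasurableFun.Build _ _ _ _ joint mjoint.

(** [Y12] expresses at once that [Y1] and [Y2] are independent and that [Y2] has the law of [Y0]. It
    holds on a family of rectangles stable under intersection that generates the product, which
    determines the law. *)
Lemma joint_law (X : set (T1 * T2)) : measurable X ->
  distribution P joint X = (distribution P Y1 \x distribution P Y0)%E X.
Proof.
move=> mX; refine (@measure_unique _ R (T1 * T2)%type [set A `*` B | A in C1 & B in C2] (fun=> setT) _ _ _ _ (distribution P joint) (distribution P Y1 \x distribution P Y0)%E _ _ X mX).
- exact: measurable_prod_generated.
- move=> _ _ [A cA [B cB <-]] [A' cA' [B' cB' <-]].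
  rewrite -setXI; exists (A `&` A'); first exact: C1I.
  by exists (B `&` B') => //; exact: C2I.
- by move=> _; exists setT => //; exists setT => //; rewrite setXTT.
- by rewrite bigcup_const.
- move=> _ [A cA [B cB <-]].
  transitivity (P (Y1 @^-1` A) * P (Y0 @^-1` B))%E; first exact: Y12.
  by symmetry; apply: product_measure1E; exact: sub_sigma_algebra.
- by move=> _; rewrite [X in (X < _)%E](probability_setT (distribution P joint)) ltry.
Qed.

Lemma indep_ge0 (G : T1 * T2 -> R) : measurable_fun setT G -> (forall z, 0 <= G z) ->
  (\int[P]_w (G (Y1 w, Y2 w))%:E = \int[P]_w \int[P]_w' (G (Y1 w, Y0 w'))%:E)%E.
Proof.
move=> mG G0; have mG' : measurable_fun setT (EFin \o G) by exact/measurable_EFinP.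
have G0' z : (0 <= (EFin \o G) z)%E by rewrite lee_fin.
rewrite -[LHS](ge0_integral_distribution (P := P) joint mG' G0').
rewrite (eq_measure_integral (distribution P Y1 \x distribution P Y0)%E); last first.
  by move=> A mA _; exact: joint_law.
have FE v : fubini_F (distribution P Y0) (EFin \o G) v = (\int[P]_w' (G (v, Y0 w'))%:E)%E.
  rewrite /fubini_F (ge0_integral_distribution (P := P) Y0 (f := fun u => (G (v, u))%:E)) //.
    by apply/measurable_EFinP; apply: measurableT_comp mG _; exact: measurable_pair1.
  by move=> u; rewrite lee_fin.
transitivity (\int[distribution P Y1]_v fubini_F (distribution P Y0) (EFin \o G) v)%E.
  exact: (fubini_tonelli1 (EFin \o G) mG' G0').
rewrite -[RHS](ge0_integral_distribution (P := P) Y1 (f := fun v => \int[P]_w' (G (v, Y0 w'))%:E)%E).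
- by apply: eq_integral => v _; exact: FE.
- apply: (eq_measurable_fun (fubini_F (distribution P Y0) (EFin \o G))).
    by move=> v _; exact: FE.
  exact: measurable_fun_fubini_tonelli_F.
- by move=> v; apply: integral_ge0 => w _; rewrite lee_fin.
Qed.

Lemma indep_Ex (G : T1 * T2 -> R) (g : T1 -> R) C : measurable_fun setT G ->
  (forall z, `|G z| <= C) -> measurable_fun setT g ->
  (forall v, Ex P (fun w => G (v, Y0 w)) = g v) ->
  Ex P (fun w => G (Y1 w, Y2 w)) = Ex P (fun w => g (Y1 w)).
Proof.
move=> mG GC mg Hg.
have bG v : bm (fun w => G (v, Y0 w)).
  split; last by exists C.
  by apply: measurableT_comp mG _; apply: measurableT_comp (measurable_pair1 _) _.
have bgC v : `|g v| <= C.
  rewrite -Hg ler_norml; apply/andP; split.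
    rewrite -(Ex_cst P (- C)); apply: Ex_le => //; first exact: bm_cst.
    by move=> w; have := GC (v, Y0 w); rewrite ler_norml => /andP[].
  rewrite -(Ex_cst P C); apply: Ex_le => //; first exact: bm_cst.
  by move=> w; have := GC (v, Y0 w); rewrite ler_norml => /andP[].
have bG2 : bm (fun w => G (Y1 w, Y2 w)).
  by split; [exact: measurableT_comp mG mjoint|exists C].
have bg : bm (fun w => g (Y1 w)).
  by split; [exact: measurableT_comp mg _|exists C].
have bC : bm (fun _ : T => C) by exact: bm_cst.
(* Adding the bound [C] makes the integrand nonnegative, as [indep_ge0] requires. *)
suff : Ex P (fun w => G (Y1 w, Y2 w) + C) = Ex P (fun w => g (Y1 w) + C).
  by rewrite !ExD// Ex_cst => /addIr.
apply: EFin_inj; rewrite -!Ex_EFin; [|exact: bmD|exact: bmD].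
rewrite (indep_ge0 (G := fun z => G z + C)).
- apply: eq_integral => w _; rewrite Ex_EFin; last exact: bmD.
  by rewrite ExD// Ex_cst Hg.
- exact: measurable_funD.
- by move=> z; have := GC z; rewrite ler_norml => /andP[]; rewrite -subr_ge0 opprK.
Qed.

End Independence.

(** * The renewal equation *)

Section Renewal.
Variable R : realType.
Context d (T : measurableType d) (P : probability T R).
Variables (S : T -> seq R) (b : nat).
Hypothesis mS : mlist S.
Hypothesis sizeS : forall w, size (S w) = b.
Hypothesis sumS : forall w, \sum_(l <- S w) l = 1.
Hypothesis S01 : forall w l, l \in S w -> 0 <= l <= 1.
Variable delta : R.
Hypothesis delta0 : 0 < delta.

(** Bounded on the range of the pieces only, so that unbounded functions such as the identity
    qualify. *)
Definition regular (Phi : R -> R) := measurable_fun setT Phi /\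
  exists C, forall l, 0 <= l <= 1 -> `|Phi l| <= C.

(** The integral of [Phi] against the mean measure of the pieces, that is, against [dF]. *)
Definition ES (Phi : R -> R) : R := Ex P (fun w => \sum_(l <- S w) Phi l).

Hypothesis density : forall x y : R, 0 < x -> x < y -> y < 1 ->
  delta * (y - x) <= ES (fun l => (x <= l < y)%R%:R).

Lemma regular_bm Phi : regular Phi -> bm (fun w => \sum_(l <- S w) Phi l).
Proof.
move=> [mP [C HC]]; split.
  by apply: mlist_sum mS _ => f mf; exact: measurableT_comp.
exists (b%:R * C) => w; apply: le_trans (ler_norm_sum _ _ _) _.
rewrite -(sizeS w) -sum1_size natr_sum mulr_suml big_seq [X in _ <= X]big_seq.
by apply: ler_sum => l lS; rewrite mul1r; exact/HC/(S01 lS).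
Qed.

Lemma regular_nd Phi : {homo Phi : x y / x <= y} -> regular Phi.
Proof.
move=> nd; split; first exact: nondecreasing_measurable.
exists (`|Phi 0| + `|Phi 1|) => l /andP[l0 l1].
have := nd _ _ l0; have := nd _ _ l1.
have := ler_norm (Phi 1); have := lerNnormlW (lexx `|Phi 0|).
rewrite ler_norml => h1 h2 h3 h4.
by have := normr_ge0 (Phi 0); have := normr_ge0 (Phi 1); move=> ? ?; apply/andP; split; lra.
Qed.

Lemma regular_scale Phi r : 0 <= r -> {homo Phi : x y / x <= y} ->
  regular (fun l => Phi (r * l)).
Proof. by move=> r0 nd; apply: regular_nd => x y xy; apply: nd; rewrite ler_wpM2l. Qed.

Lemma regularD Phi Psi : regular Phi -> regular Psi -> regular (fun l => Phi l + Psi l).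
Proof.
move=> [mf [C HC]] [mg [D HD]]; split; first exact: measurable_funD.
by exists (C + D) => l hl; rewrite (le_trans (ler_normD _ _)) ?lerD ?HC ?HD.
Qed.

Lemma regularM Phi Psi : regular Phi -> regular Psi -> regular (fun l => Phi l * Psi l).
Proof.
move=> [mf [C HC]] [mg [D HD]]; split; first exact: measurable_funM.
by exists (C * D) => l hl; rewrite normrM ler_pM ?HC ?HD.
Qed.

Lemma regular_cst c : regular (fun=> c).
Proof. by split => //; exists `|c|. Qed.

Lemma regular_id : regular id.
Proof. by apply: regular_nd. Qed.

Lemma regularZ c Phi : regular Phi -> regular (fun l => c * Phi l).
Proof. by move=> h; apply: regularM => //; exact: regular_cst. Qed.

Lemma regular_bool (f : R -> bool) : measurable_fun setT f -> regular (fun l => (f l)%:R).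
Proof.
move=> mf; split; first exact: mfun_natr_bool.
by exists 1 => l _; case: (f l); rewrite ?normr1 ?normr0.
Qed.

Lemma regular_itv x y : regular (fun l => (x <= l < y)%R%:R).
Proof.
apply: (regular_bool (f := fun l => x <= l < y)); apply: measurable_and.
  exact: measurable_fun_ler.
exact: measurable_fun_ltr.
Qed.

Lemma ESD Phi Psi : regular Phi -> regular Psi ->
  ES (fun l => Phi l + Psi l) = ES Phi + ES Psi.
Proof.
move=> r1 r2; rewrite /ES -ExD; [|exact: regular_bm..].
by congr Ex; apply/funext => w; rewrite big_split.
Qed.

Lemma ESZ c Phi : regular Phi -> ES (fun l => c * Phi l) = c * ES Phi.
Proof.
move=> r1; rewrite /ES -ExZ; last exact: regular_bm.
by congr Ex; apply/funext => w; rewrite mulr_sumr.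
Qed.

Lemma ES_cst c : ES (fun=> c) = b%:R * c.
Proof.
rewrite /ES -[RHS](Ex_cst P); congr Ex; apply/funext => w.
by rewrite big_const_seq count_predT sizeS iter_addr_0 mulr_natl.
Qed.

Lemma ES_id : ES id = 1.
Proof. by rewrite /ES -[RHS](Ex_cst P); congr Ex; apply/funext => w; rewrite sumS. Qed.

Lemma ES_le Phi Psi : regular Phi -> regular Psi ->
  (forall l, 0 <= l <= 1 -> Phi l <= Psi l) -> ES Phi <= ES Psi.
Proof.
move=> r1 r2 H; apply: Ex_le; [exact: regular_bm..|] => w.
by rewrite big_seq [X in _ <= X]big_seq; apply: ler_sum => l /S01; exact: H.
Qed.

Lemma ES_ge0 Phi : (forall l, 0 <= l <= 1 -> 0 <= Phi l) -> 0 <= ES Phi.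
Proof.
move=> H; apply: Ex_ge0 => w; rewrite big_seq; apply: sumr_ge0 => l /S01; exact: H.
Qed.

(** A common lower bound for [l - l ^ 2], the relative loss of squared length, and for
    [excess r * l - excess (r * l)] with [r >= 1]; hence one constant [kap] serves both
    estimates. *)
Definition loss (l : R) : R := Num.min l (1 - l) / 2.
Definition kap := ES loss.

Lemma regular_loss : regular loss.
Proof.
split.
  apply: measurable_funM => //; apply: measurable_minr => //.
  exact: measurable_funB.
exists 1 => l /andP[l0 l1]; rewrite /loss ger0_norm; first by have [h|h] := leP l (1 - l); lra.
by rewrite divr_ge0// le_min l0 subr_ge0.
Qed.

(** Pieces of length in [1/4, 1/2) have positive mean number, and [loss] is at least 1/8 there. *)
Lemma kap_gt0 : 0 < kap.
Proof.
have h1 : delta * (1/2 - 1/4) <= ES (fun l => (1/4 <= l < 1/2)%R%:R) by apply: density; lra.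
suff : 1/8 * ES (fun l => (1/4 <= l < 1/2)%R%:R) <= kap.
  by move: h1 delta0; move: (ES _) kap => e k; lra.
rewrite -ESZ; last exact: regular_itv.
apply: ES_le; [exact/regularZ/regular_itv|exact: regular_loss|] => l /andP[l0 l1].
rewrite /loss; case: (boolP (1/4 <= l < 1/2)) => [/andP[h3 h4]|_] /=; have [h|h] := leP l (1 - l); lra.
Qed.

(** Lyapunov function of the splitting: [excess_drop] pays for the weight created by each split, which
bounds all the renewal sums linearly. *)
Definition excess (r : R) : R := Num.max (r - 1/2) 0.

Lemma excess_nd : {homo excess : x y / x <= y}.
Proof. by move=> x y xy; rewrite /excess; have [h|h] := leP (x - 1/2) 0; have [k|k] := leP (y - 1/2) 0; lra. Qed.

Lemma excess_ge0 r : 0 <= excess r.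
Proof. by rewrite /excess le_max lexx orbT. Qed.

Lemma excess_le r : 0 <= r -> excess r <= r.
Proof. by move=> r0; rewrite /excess ge_max r0 andbT; lra. Qed.

Lemma regular_excess r : 0 <= r -> regular (fun l => excess (r * l)).
Proof. by move=> r0; apply: regular_scale => //; exact: excess_nd. Qed.

Lemma excess_drop r : 1 <= r -> ES (fun l => excess (r * l)) <= excess r - kap.
Proof.
move=> r1; have r0 : 0 <= r by lra.
suff : ES (fun l => excess (r * l) + loss l) <= ES (fun l => excess r * l).
  rewrite ESD; [|exact: regular_excess|exact: regular_loss].
  by rewrite ESZ ?ES_id ?mulr1 -/kap; [lra|exact: regular_id].
apply: ES_le; [apply: regularD; [exact: regular_excess|exact: regular_loss]|exact/regularZ/regular_id|].
move=> l /andP[l0 l1].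
have -> : excess r = r - 1/2 by rewrite /excess; have [h|h] := leP (r - 1/2) 0; lra.
rewrite /excess /loss; have [h|h] := leP (r * l - 1/2) 0; have [k|k] := leP l (1 - l); nra.
Qed.

Section Weight.

(** [chi] weights the pieces created by each split. *)
Variable chi : R -> R.
Hypothesis chi_nd : {homo chi : x y / x <= y}.
Hypothesis chi01 : forall x, 0 <= chi x <= 1.

(** [renewal_iter n r]: expected total weight of the pieces created by the splits of the first [n]
generations when an interval of length [r] is split until no piece is longer than 1. *)
Fixpoint renewal_iter n (r : R) : R :=
  if n is n'.+1 then
    if 1 < r then ES (fun l => renewal_iter n' (r * l) + chi (r * l)) else 0
  else 0.

Let h_ := renewal_iter.
Let K := b%:R / kap.

Lemma K_ge0 : 0 <= K.
Proof. by rewrite /K divr_ge0// ltW// kap_gt0. Qed.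

(** A longer initial interval makes every piece longer, and both the splitting condition and [chi]
    are monotone in the length. Monotonicity is inherited by [renewal], where it yields
    measurability and is essential in [window]. *)
Lemma iter_nd n : {homo h_ n : x y / x <= y}.
Proof.
elim: n => [|n IH] x y xy //=; rewrite -/h_.
have nd2 : {homo (fun r => h_ n r + chi r) : x y / x <= y}.
  by move=> r s rs; rewrite lerD ?IH ?chi_nd.
case: ifPn => x1; case: ifPn => y1 //.
- apply: ES_le; [apply: (regular_scale (Phi := fun r => h_ n r + chi r)) => //; lra..|].
  by move=> l /andP[l0 l1]; apply: nd2; rewrite ler_wpM2r.
- by exfalso; move: x1 y1 xy; lra.
- apply: ES_ge0 => l /andP[l0 l1].
  have := nd2 0 (y * l); have := chi01 0; have -> : h_ n 0 = 0 by case: (n) => //= n'; rewrite ltr10.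
  have : 0 <= y * l by rewrite mulr_ge0//; lra.
  by move=> h /andP[h1 h2] /(_ h); lra.
Qed.

Lemma iter_regular n r : 0 <= r -> regular (fun l => h_ n (r * l) + chi (r * l)).
Proof.
move=> r0; apply: (regular_scale (Phi := fun r => h_ n r + chi r)) => // x y xy.
by rewrite lerD ?iter_nd ?chi_nd.
Qed.

Lemma iter_le1 n r : r <= 1 -> h_ n r = 0.
Proof. by case: n => //= n; rewrite ltNge => ->. Qed.

Lemma iter_ge0 n r : 0 <= h_ n r.
Proof.
have [r1|r1] := leP r 1; first by rewrite iter_le1.
by rewrite -(iter_le1 n (lexx 1)); apply: iter_nd; exact: ltW.
Qed.

Lemma iter_incr n r : h_ n r <= h_ n.+1 r.
Proof.
elim: n r => [|n IH] r; first exact: (iter_ge0 1).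
rewrite /h_ /= -/h_; case: ifPn => // r1.
apply: ES_le; [apply: iter_regular; lra|apply: (iter_regular n.+1); lra|].
by move=> l _; rewrite lerD2r; exact: IH.
Qed.

Lemma iter_mono r : {homo h_^~ r : m n / (m <= n)%N >-> m <= n}.
Proof. by apply/nondecreasing_seqP => n; exact: iter_incr. Qed.

(** A split creates weight at most [b = K * kap], which is what the mean drop of [K * excess]
    provides. *)
Lemma iter_excess n r : h_ n r <= K * excess r.
Proof.
elim: n r => [|n IH] r; first by rewrite mulr_ge0 ?K_ge0 ?excess_ge0.
rewrite /h_ /= -/h_; case: ifPn => [r1|_]; last by rewrite mulr_ge0 ?K_ge0 ?excess_ge0.
have r0 : 0 <= r by lra.
apply: (@le_trans _ _ (ES (fun l => K * excess (r * l) + 1))).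
  apply: ES_le; [exact: iter_regular|apply: regularD; [exact/regularZ/regular_excess|exact: regular_cst]|].
  by move=> l _; rewrite lerD ?IH//; have /andP[] := chi01 (r * l).
rewrite ESD; [|exact/regularZ/regular_excess|exact: regular_cst].
rewrite ESZ; last exact: regular_excess.
rewrite ES_cst mulr1.
have Kk : K * kap = b%:R by rewrite /K divfK// gt_eqF// kap_gt0.
have := ler_wpM2l K_ge0 (excess_drop (ltW r1)); rewrite mulrBr Kk; lra.
Qed.

Definition renewal (r : R) : R := limn (fun n => h_ n r).
Let h := renewal.

Lemma iter_cvg r : h_ n r @[n --> \oo] --> h r.
Proof.
apply: nondecreasing_is_cvgn; first exact: iter_mono.
by exists (K * excess r) => _ [n _ <-]; exact: iter_excess.
Qed.

Lemma iter_le_renewal n r : h_ n r <= h r.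
Proof.
apply: nondecreasing_cvgn_le; first exact: iter_mono.
exact: (cvgP (h r) (@iter_cvg r)).
Qed.

Lemma renewal_le r C : (forall n, h_ n r <= C) -> h r <= C.
Proof.
move=> H; apply: (@cvgr_to_le _ _ _ _ _ _ _ (@iter_cvg r)).
by near=> n; exact: H.
Unshelve. all: by end_near. Qed.

Lemma renewal_ge0 r : 0 <= h r.
Proof. exact: le_trans (iter_ge0 0 r) (iter_le_renewal 0 r). Qed.

Lemma renewal_excess r : h r <= K * excess r.
Proof. by apply: renewal_le => n; exact: iter_excess. Qed.

Lemma renewal_linear r : 0 <= r -> h r <= K * r.
Proof.
by move=> r0; apply: le_trans (renewal_excess r) _; rewrite ler_wpM2l ?K_ge0 ?excess_le.
Qed.

Lemma renewal_nd : {homo h : x y / x <= y}.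
Proof.
by move=> x y xy; apply: renewal_le => n; apply: le_trans (iter_le_renewal n y); exact: iter_nd.
Qed.

Lemma renewal_le1 r : r <= 1 -> h r = 0.
Proof.
move=> r1; apply/eqP; rewrite eq_le renewal_ge0 andbT.
by apply: renewal_le => n; rewrite iter_le1.
Qed.

Lemma renewal_regular r : 0 <= r -> regular (fun l => h (r * l) + chi (r * l)).
Proof.
move=> r0; apply: (regular_scale (Phi := fun r => h r + chi r)) => // x y xy.
by rewrite lerD ?renewal_nd ?chi_nd.
Qed.

Lemma renewal_fix r : 1 < r -> h r = ES (fun l => h (r * l) + chi (r * l)).
Proof.
move=> r1; have r0 : 0 <= r by lra.
have c1 : h_ n.+1 r @[n --> \oo] --> h r by have := @iter_cvg r; rewrite -(cvg_shiftS (fun n => h_ n r)).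
apply: (cvg_unique _ c1) => //.
rewrite /h_ /= r1 -/h_.
apply: (@Ex_cvg _ _ _ P _ _ (b%:R * (K * excess r + 1))).
- by move=> n; exact: (bm_mf (regular_bm (iter_regular n r0))).
- move=> n w; apply: le_trans (ler_norm_sum _ _ _) _.
  rewrite -(sizeS w) -sum1_size natr_sum mulr_suml big_seq [X in _ <= X]big_seq.
  apply: ler_sum => l lS; rewrite mul1r; have /andP[l0 l1] := S01 lS.
  have := chi01 (r * l) => /andP[c0 c1'].
  rewrite ger0_norm ?addr_ge0 ?iter_ge0// lerD//.
  apply: le_trans (iter_excess n (r * l)) _.
  by rewrite ler_wpM2l ?K_ge0// excess_nd// ger_pMr//; lra.
- move=> w; elim: (S w) => [|l s IH].
    rewrite big_nil; under eq_fun do rewrite big_nil; exact: cvg_cst.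
  rewrite big_cons; under eq_fun do rewrite big_cons.
  apply: cvgD => //; apply: cvgD; [exact: iter_cvg|exact: cvg_cst].
- exact: regular_bm (renewal_regular r0).
Qed.

(** [m * rho] is invariant under splitting since the pieces sum to 1; the [Num.min] term dominates [h] below
the window; the [excess] term absorbs [chi] and the [Num.min] term at each split above it. *)
Lemma barrier m r A n rho : 0 <= m -> 1 <= r -> 1 <= A ->
  (forall x, r / A <= x <= r -> h x <= m * x) -> 0 <= rho ->
  h_ n rho <= m * rho + K * Num.min rho (r / A) +
     (b%:R + K * b%:R * (r / A)) / kap * excess (rho / r).
Proof.
move=> m0 r1 A1 hw; have A0 : 0 < A by lra.
 (* [D * kap] is the mean cost of a split above the window: weight at most 1 and a truncated term at
    most [K * (r / A)] for each of the [b] pieces. *)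
 set D := _ / kap.
have k0 := kap_gt0; have K0 := K_ge0; have r0 : 0 < r by lra.
have rA : 0 < r / A by rewrite divr_gt0.
have D0 : 0 <= D.
  apply: divr_ge0; last exact: ltW.
  by apply: addr_ge0 => //; apply: mulr_ge0; [exact: mulr_ge0|exact: ltW].
elim: n rho => [|n IH] rho rho0.
  have ? : 0 <= Num.min rho (r / A) by rewrite le_min rho0 ltW.
  by rewrite (_ : h_ 0 rho = 0)//; do !apply: addr_ge0; apply: mulr_ge0 => //; exact: excess_ge0.
have [rr|rr] := leP rho r.
  apply: le_trans (iter_le_renewal _ _) _.
  apply: (@le_trans _ _ (m * rho + K * Num.min rho (r / A))); last first.
    by rewrite lerDl mulr_ge0// excess_ge0.
  have [h1|h1] := leP (r / A) rho.
    apply: (@le_trans _ _ (m * rho)); first by apply: hw; rewrite h1.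
    by rewrite lerDl mulr_ge0// ltW.
  apply: le_trans (renewal_linear rho0) _.
  by rewrite lerDr mulr_ge0.
have rho1 : 1 < rho by lra.
have q0 : 0 <= rho / r by rewrite divr_ge0// ltW.
rewrite /h_ /= -/h_ rho1.
apply: (@le_trans _ _ (ES (fun l => (m * rho) * l + (D * excess (rho / r * l) + (K * (r / A) + 1))))).
  apply: ES_le; [exact: iter_regular| |].
    apply: regularD; first exact/regularZ/regular_id.
    by apply: regularD; [exact/regularZ/regular_excess|exact: regular_cst].
  move=> l /andP[l0 l1]; have := IH (rho * l) (mulr_ge0 rho0 l0).
  have /andP[_ c1] := chi01 (rho * l).
  have : K * Num.min (rho * l) (r / A) <= K * (r / A).
    by rewrite ler_wpM2l// ge_min lexx orbT.
  have -> : rho * l / r = rho / r * l by ring.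
  by rewrite mulrA; lra.
rewrite ESD; [|exact/regularZ/regular_id|by apply: regularD; [exact/regularZ/regular_excess|exact: regular_cst]].
rewrite ESD; [|exact/regularZ/regular_excess|exact: regular_cst].
rewrite !ESZ; [|exact: regular_excess|exact: regular_id].
rewrite ES_id ES_cst mulr1.
have q1 : 1 <= rho / r by rewrite ler_pdivlMr// mul1r ltW.
have := ler_wpM2l D0 (excess_drop q1); rewrite mulrBr.
have -> : D * kap = b%:R + K * b%:R * (r / A) by rewrite /D divfK// gt_eqF.
have -> : Num.min rho (r / A) = r / A.
  by apply: min_r; rewrite ler_pdivrMr//; nra.
have : 0 <= K * (r / A) by apply: mulr_ge0 => //; exact: ltW.
lra.
Qed.

(** In terms of slopes, the errors are made small by separate choices: [A] large, then [r] large,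
    then [rho] large compared with [r]. *)
Lemma renewal_barrier m r A rho : 0 <= m -> 1 <= r -> 1 <= A ->
  (forall x, r / A <= x <= r -> h x <= m * x) -> 0 < rho ->
  h rho <= (m + K / A * (r / rho) + (b%:R / r + K * b%:R / A) / kap) * rho.
Proof.
move=> m0 r1 A1 hw rho0.
have [A0 r0] : 0 < A /\ 0 < r by split; lra.
have k0 := kap_gt0; have K0 := K_ge0.
apply: renewal_le => n; apply: le_trans (barrier n m0 r1 A1 hw (ltW rho0)) _.
have D0 : 0 <= (b%:R + K * b%:R * (r / A)) / kap.
  apply: divr_ge0; last exact: ltW.
  by apply: addr_ge0 => //; apply: mulr_ge0; [exact: mulr_ge0|apply: divr_ge0; exact: ltW].
rewrite (mulrDl (m + _)) (mulrDl m); apply: lerD; first apply: lerD => //.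
  rewrite (_ : K / A * (r / rho) * rho = K * (r / A)); last by field; rewrite !gt_eqF.
  by rewrite ler_wpM2l// ge_min lexx orbT.
apply: le_trans (ler_wpM2l D0 (excess_le (divr_ge0 (ltW rho0) (ltW r0)))) _.
by rewrite le_eqVlt; apply/orP; left; apply/eqP; field; rewrite !gt_eqF.
Qed.

(** [m] is the lower limit slope of [h], and [r] is chosen with [h r] nearly [m * r]. If [h] exceeded slope
[m + eta] at some [x] of the window, monotonicity would keep it above slope [m + eta / 2] slightly to the
right of [x], where pieces of [r] fall with probability bounded below; the renewal equation at [r] would
then push [h r] above [m * r]. *)
Lemma window m eta A r1 : 0 <= m -> 0 < eta -> 1 <= A -> 1 < r1 ->
  (forall e, 0 < e -> exists r0, forall r, r0 <= r -> (m - e) * r <= h r) ->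
  (forall e r0, 0 < e -> exists2 r, r0 <= r & h r < (m + e) * r) ->
  exists2 r, r1 <= r & forall x, r / A <= x <= r -> h x <= (m + eta) * x.
Proof.
move=> m0 e0 A1 r11 lowm highm; have A0 : 0 < A by lra.
(* The relative length over which monotonicity alone keeps the slope above [m + eta / 2], since
   [(m + eta / 2) * (1 + s) <= m + eta]. *)
pose s := eta / 2 / (m + eta).
have s0 : 0 < s by rewrite !divr_gt0//; lra.
have s1 : s <= 1/2.
  by rewrite /s ler_pdivrMr; lra.
have sE : s * (m + eta) = eta / 2 by rewrite /s divfK// gt_eqF//; lra.
clearbody s.
(* The pieces near [x] will gain at least [4 * e * r]; the two deviations of the slope from [m] cost
   [2 * e * r], and pieces below the threshold [r0] at most another [e * r]. *)
pose e := eta * delta * s / (32 * A ^+ 2).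
have ee0 : 0 < e by rewrite /e; apply: divr_gt0; do ?apply: mulr_gt0 => //; exact: exprn_gt0.
have [r0' low] := lowm e ee0; pose r0 := Num.max r0' 0.
have r00 : 0 <= r0 by rewrite le_max lexx orbT.
have {}low r : r0 <= r -> (m - e) * r <= h r.
  by move=> hr; apply: low; apply: le_trans hr; rewrite le_max lexx.
have [r hr hlt] := highm e (Num.max (2 * r1) (b%:R * m * r0 / e)) ee0.
move: hr; rewrite ge_max => /andP[hr1 hr2].
have rb : b%:R * m * r0 <= e * r by move: hr2; rewrite ler_pdivrMr// [r * e]mulrC.
(* Halving gives [u <= 1/2], so that [u * (1 + s)] stays below 1, inside the range of [density]. *)
exists (r / 2); first lra.
move=> x /andP[xA xr]; rewrite leNgt; apply/negP => hx.
have r2 : 2 < r by lra.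
have rp : 0 < r by lra.
pose u := x / r.
have xE : x = r * u by rewrite /u mulrC divfK// gt_eqF.
have u1 : u <= 1/2 by rewrite /u ler_pdivrMr//; lra.
have uA : 1 / (2 * A) <= u.
  by rewrite /u ler_pdivlMr//; apply: le_trans xA; rewrite le_eqVlt; apply/orP; left; apply/eqP; field; rewrite gt_eqF.
have u0 : 0 < u by apply: lt_le_trans uA; rewrite divr_gt0// mulr_gt0.
clearbody u.
have := density (x := u) (y := u * (1 + s)) u0; rewrite [u * (1 + s) - u](_ : _ = u * s); last by ring.
move=> dens0; have {dens0} dens : delta * (u * s) <= ES (fun l => (u <= l < u * (1 + s))%R%:R).
  by apply: dens0; nra.
have key : ES (fun l => ((m - e) * r) * l + (eta / 2 * r * u * (u <= l < u * (1 + s))%R%:R + (- (m * r0)))) <= h r.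
  rewrite (renewal_fix); last lra.
  apply: ES_le.
  - apply: regularD; first exact/regularZ/regular_id.
    by apply: regularD; [exact/regularZ/regular_itv|exact: regular_cst].
  - by apply: renewal_regular; lra.
  move=> l /andP[l0 l1]; have /andP[c0 _] := chi01 (r * l).
  apply: (@le_trans _ _ (h (r * l))); last by rewrite lerDl.
  have mr0 : 0 <= m * r0 by rewrite mulr_ge0.
  have [/andP[ul lu]|_] := boolP (u <= l < u * (1 + s)).
    have h1 : (m + eta) * x <= h (r * l).
      by apply: le_trans (ltW hx) _; apply: renewal_nd; rewrite xE ler_pM2l.
    have h2 : (m + eta / 2) * (r * l) <= (m + eta) * x.
      rewrite xE; have : (m + eta / 2) * (1 + s) <= m + eta by nra.
      have : r * l <= (r * u) * (1 + s) by rewrite -mulrA ler_pM2l// ltW.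
      have : 0 < r * u by rewrite mulr_gt0.
      set ru := r * u; set rl := r * l; move=> h3 h4 h5.
      apply: (@le_trans _ _ ((m + eta / 2) * (ru * (1 + s)))); first by rewrite ler_pM2l//; lra.
      by rewrite mulrCA [_ * ru]mulrC ler_pM2l.
    have h6 : 0 <= e * r * l by exact: (mulr_ge0 (mulr_ge0 (ltW ee0) (ltW rp)) l0).
    have h7 : eta / 2 * (r * u) <= eta / 2 * (r * l) by rewrite ler_pM2l ?divr_gt0// ler_pM2l.
    by rewrite /= mulr1; move: h1 h2 h6 h7; rewrite !mulrA; lra.
  rewrite /= mulr0 add0r.
  have [h1|h1] := leP r0 (r * l).
    by have := low _ h1; rewrite mulrA; lra.
  apply: le_trans (renewal_ge0 _).
  have h6 : 0 <= e * r * l by exact: (mulr_ge0 (mulr_ge0 (ltW ee0) (ltW rp)) l0).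
  have h7 : m * (r * l) <= m * r0 by rewrite ler_wpM2l// ltW.
  by move: h7; rewrite mulrA; lra.
move: key; rewrite ESD; [|exact/regularZ/regular_id|by apply: regularD; [exact/regularZ/regular_itv|exact: regular_cst]].
rewrite ESD; [|exact/regularZ/regular_itv|exact: regular_cst].
rewrite !ESZ; [|exact: regular_itv|exact: regular_id].
rewrite ES_id ES_cst mulr1 => key.
have h1 : eta / 2 * r * u * (delta * (u * s)) <= eta / 2 * r * u * ES (fun l => (u <= l < u * (1 + s))%R%:R).
  by apply: ler_wpM2l => //; do ?apply: mulr_ge0; lra.
have h2 : 4 * e * r <= eta / 2 * r * u * (delta * (u * s)).
  rewrite (_ : eta / 2 * r * u * _ = eta * delta * s * r / 2 * u ^+ 2); last by ring.
  rewrite (_ : 4 * e * r = eta * delta * s * r / 2 * (1 / (2 * A)) ^+ 2); last first.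
    by rewrite /e; field; rewrite gt_eqF.
  apply: ler_wpM2l.
    exact: (divr_ge0 (mulr_ge0 (mulr_ge0 (mulr_ge0 (ltW e0) (ltW delta0)) (ltW s0)) (ltW rp)) (ler0n _ 2)).
  by rewrite ler_sqr// nnegrE ?divr_ge0// ltW// ?mulr_gt0.
have h3 : 0 < e * r by rewrite mulr_gt0.
move: hlt key h1 h2 rb h3; rewrite !mulrDl mulrN mulNr -!mulrA; lra.
Qed.

Definition renewal_rate M := forall eps, 0 < eps ->
  exists r0, forall r, r0 <= r -> `|h r - M * r| <= eps * r.

Lemma renewal_limit : exists2 M, 0 <= M & renewal_rate M.
Proof.
have k0 := kap_gt0; have K0 := K_ge0.
(* The slopes that [h] eventually dominates; their supremum is the lower limit of [h r / r]. *)
pose A0 := [set x | exists r0, forall r, r0 <= r -> x * r <= h r].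
have A00 : A0 0 by exists 0 => r _; rewrite mul0r renewal_ge0.
have ubA : ubound A0 K.
  move=> x [r0 H]; pose r := Num.max r0 1.
  have rp : 0 < r by rewrite lt_max ltr01 orbT.
  rewrite -(ler_pM2r rp); apply: le_trans (renewal_linear (ltW rp)).
  by apply: H; rewrite le_max lexx.
have hs : has_sup A0 by split; [exists 0|exists K].
pose M := sup A0.
have M0 : 0 <= M by apply: ub_le_sup => //; exists K.
have low e : 0 < e -> exists r0, forall r, r0 <= r -> (M - e) * r <= h r.
  move=> e0; have [x [r0 H] xM] := sup_adherent e0 hs.
  exists (Num.max r0 0) => r; rewrite ge_max => /andP[rr r00].
  by apply: le_trans (H _ rr); rewrite ler_wpM2r// ltW.
have high e r0 : 0 < e -> exists2 r, r0 <= r & h r < (M + e) * r.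
  move=> e0; apply: contrapT => H.
  suff : A0 (M + e) by move=> /(ub_le_sup (ex_intro _ K ubA)); rewrite -/M; lra.
  exists r0 => r rr; rewrite leNgt; apply/negP => hr; apply: H; by exists r.
exists M => // eps eps0.
have [r0 Hlow] := low eps eps0.
(* [A], [r1] and the threshold on [rho] each bring one error term of [renewal_barrier] down to
   [eps / 4]; the fourth quarter is the slope tolerance of the window. *)
pose A := 1 + 4 * K * b%:R / (kap * eps).
have A1 : 1 <= A.
  rewrite /A lerDl; apply: divr_ge0; last exact: ltW (mulr_gt0 k0 eps0).
  by apply: mulr_ge0 => //; exact: mulr_ge0.
pose r1 := 2 + 4 * b%:R / (kap * eps).
have r11 : 1 < r1.
  have : 0 <= 4 * b%:R / (kap * eps) :> R.
    by apply: divr_ge0; [exact: mulr_ge0|exact: ltW (mulr_gt0 k0 eps0)].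
  by rewrite /r1; lra.
have e4 : 0 < eps / 4 by rewrite divr_gt0.
have [r rr Hr] := window M0 e4 A1 r11 low high.
exists (Num.max (Num.max r0 1) (4 * K * r / eps)) => rho.
rewrite !ge_max => /andP[/andP[hr0 hr1] hr2].
have rho0 : 0 < rho by lra.
have Ap : 0 < A by lra.
have rp : 0 < r by lra.
have Me : 0 <= M + eps / 4 by lra.
have r1' : 1 <= r by lra.
have := renewal_barrier Me r1' A1 Hr rho0.
have b1 : K / A * (r / rho) <= eps / 4.
  rewrite mulrA ler_pdivrMr//; move: hr2; rewrite ler_pdivrMr// => hr2.
  have : K / A * r <= K * r.
    by rewrite ler_wpM2r ?(ltW rp)// ler_pdivrMr// ler_peMr.
  lra.
have b2 : b%:R / r / kap <= eps / 4.
  rewrite ler_pdivrMr// ler_pdivrMr//.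
  have : 4 * b%:R / (kap * eps) <= r by move: rr; rewrite /r1; lra.
  rewrite ler_pdivrMr ?mulr_gt0//; lra.
have b3 : K * b%:R / A / kap <= eps / 4.
  rewrite ler_pdivrMr// ler_pdivrMr//.
  have : 4 * K * b%:R / (kap * eps) <= A by rewrite /A; lra.
  rewrite ler_pdivrMr ?mulr_gt0//; lra.
move=> hb; have := Hlow _ hr0 => hl.
have hc : M + eps / 4 + K / A * (r / rho) + (b%:R / r + K * b%:R / A) / kap <= M + eps.
  by rewrite mulrDl; lra.
have := ler_wpM2r (ltW rho0) hc => hd.
rewrite ler_norml; apply/andP; split; move: hl hb hd; rewrite !mulrDl ?mulNr; lra.
Qed.

(** An estimate valid at all scales, as it will be summed over gaps of arbitrary length; the
    constant is then paid once per gap. *)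
Lemma renewal_affine M : renewal_rate M ->
  forall eps, 0 < eps -> exists C, forall r, 0 <= r -> `|h r - M * r| <= eps * r + C.
Proof.
move=> H eps e0; have [r0 Hr] := H eps e0.
pose r1 := Num.max r0 0.
have r10 : 0 <= r1 by rewrite le_max lexx orbT.
exists (K * r1 + `|M| * r1) => r rr0.
have C0 : 0 <= K * r1 + `|M| * r1 by rewrite addr_ge0// mulr_ge0// K_ge0.
have [h1|h1] := leP r0 r.
  by apply: le_trans (Hr _ h1) _; rewrite lerDl.
have rr1 : r <= r1 by rewrite le_max ltW.
apply: (@le_trans _ _ (K * r1 + `|M| * r1)); last by rewrite lerDr mulr_ge0// ltW.
apply: le_trans (ler_normB _ _) _; rewrite normrM (ger0_norm (renewal_ge0 r)) (ger0_norm rr0).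
apply: lerD; last by rewrite ler_wpM2l.
by apply: le_trans (renewal_linear rr0) _; rewrite ler_wpM2l// K_ge0.
Qed.

End Weight.

(** The two renewal functions differ by a source of mean at most [omega] per split, and
    [omega / kap * excess] pays for it as in [iter_excess]. *)
Lemma renewal_rate_compare chi chi' M M' omega :
  {homo chi : x y / x <= y} -> (forall x, 0 <= chi x <= 1) ->
  {homo chi' : x y / x <= y} -> (forall x, 0 <= chi' x <= 1) -> 0 <= omega ->
  (forall r, 1 < r -> ES (fun l => chi' (r * l)) <= ES (fun l => chi (r * l)) + omega) ->
  renewal_rate chi M -> renewal_rate chi' M' -> M' <= M + omega / kap.
Proof.
move=> nd c01 nd' c01' om0 H HM HM'.
have k0 := kap_gt0; set D := omega / kap.
have D0 : 0 <= D by apply: divr_ge0 => //; exact: ltW.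
have Dk : D * kap = omega by rewrite /D divfK// gt_eqF.
have cmp n r : renewal_iter chi' n r <= renewal chi r + D * excess r.
  elim: n r => [|n IH] r /=; first by apply: addr_ge0; [exact: renewal_ge0|apply: mulr_ge0 => //; exact: excess_ge0].
  case: ifPn => [r1|_]; last by apply: addr_ge0; [exact: renewal_ge0|apply: mulr_ge0 => //; exact: excess_ge0].
  have r0 : 0 <= r by lra.
  have rh' : regular (fun l => renewal_iter chi' n (r * l)) by apply: regular_scale => //; exact: iter_nd.
  have rh : regular (fun l => renewal chi (r * l)) by apply: regular_scale => //; exact: renewal_nd.
  have rc' : regular (fun l => chi' (r * l)) by exact: regular_scale.
  have rc : regular (fun l => chi (r * l)) by exact: regular_scale.
  rewrite ESD// (renewal_fix nd c01 r1) ESD//.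
  have : ES (fun l => renewal_iter chi' n (r * l)) <= ES (fun l => renewal chi (r * l) + D * excess (r * l)).
    by apply: ES_le => //; apply: regularD => //; exact/regularZ/regular_excess.
  rewrite ESD//; last exact/regularZ/regular_excess.
  rewrite ESZ; last exact: regular_excess.
  have := ler_wpM2l D0 (excess_drop (ltW r1)); rewrite mulrBr Dk.
  have := H r r1; lra.
apply/ler_addgt0Pr => eps eps0.
have e2 : 0 < eps / 2 by rewrite divr_gt0.
have [r0 H0] := HM _ e2; have [r0' H0'] := HM' _ e2.
pose r := Num.max (Num.max r0 r0') 1.
have r1 : 1 <= r by rewrite le_max lexx orbT.
have rr0 : r0 <= r by rewrite !le_max lexx.
have rr0' : r0' <= r by rewrite !le_max lexx orbT.
have rp : 0 < r by lra.
have h1 := H0 _ rr0; have h2 := H0' _ rr0'.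
have h3 : renewal chi' r <= renewal chi r + D * r.
  apply: (renewal_le nd' c01') => n; apply: le_trans (cmp n r) _.
  by rewrite lerD2l ler_wpM2l// excess_le// ltW.
move: h1 h2; rewrite !ler_norml => /andP[_ h1] /andP[h2 _].
rewrite -(ler_pM2r rp) !mulrDl; lra.
Qed.

End Renewal.

Lemma ler_norm_sum_size (R : realType) (s : seq R) (f : R -> R) C n : size s = n ->
  (forall l, l \in s -> `|f l| <= C) -> `|\sum_(l <- s) f l| <= n%:R * C.
Proof.
move=> <- H; apply: le_trans (ler_norm_sum _ _ _) _.
rewrite -sum1_size natr_sum mulr_suml big_seq [X in _ <= X]big_seq.
by apply: ler_sum => l lS; rewrite mul1r H.
Qed.

(** * Independence of the splits *)

Section Cylinders.
Variables (R : realType) (b : nat).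
Notation V := ('I_(b - 1) -> R).

(** Generators of the history up to step [k]. *)
Definition cyl k : set (set (nat -> V)) := [set C | exists A : nat -> 'I_(b - 1) -> set R,
  (forall i j, measurable (A i j)) /\ C = [set v | forall i j, (i < k)%N -> A i j (v i j)]].

Definition cyl1 : set (set V) := [set C | exists A : 'I_(b - 1) -> set R,
  (forall j, measurable (A j)) /\ C = [set u | forall j, A j (u j)]].

Lemma cylT k : cyl k setT.
Proof. by exists (fun _ _ => setT); split => //; apply/seteqP; split. Qed.

Lemma cyl1T : cyl1 setT.
Proof. by exists (fun _ => setT); split => //; apply/seteqP; split. Qed.

Lemma cylI k : setI_closed (cyl k).
Proof.
move=> _ _ [A [mA ->]] [B [mB ->]]; exists (fun i j => A i j `&` B i j); split.
  by move=> i j; exact: measurableI.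
apply/seteqP; split => v /=; first by move=> [h1 h2] i j ik; split; [exact: h1|exact: h2].
by move=> H; split => i j ik; have [] := H i j ik.
Qed.

Lemma cyl1I : setI_closed cyl1.
Proof.
move=> _ _ [A [mA ->]] [B [mB ->]]; exists (fun j => A j `&` B j); split.
  by move=> j; exact: measurableI.
apply/seteqP; split => v /=; first by move=> [h1 h2] j; split; [exact: h1|exact: h2].
by move=> H; split => j; have [] := H j.
Qed.

Lemma measurable_coord k i j : (i < k)%N ->
  measurable_fun setT (fun v : g_sigma_algebraType (cyl k) => v i j).
Proof.
move=> ik _ B mB; rewrite setTI; apply: sub_sigma_algebra.
exists (fun i' j' => if (i' == i) && (j' == j) then B else setT); split.
  by move=> i' j'; case: ifP.
apply/seteqP; split => v /=.
  by move=> Bv i' j' _; case: ifP => // /andP[/eqP -> /eqP ->].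
by move=> /(_ i j ik); rewrite !eqxx.
Qed.

Lemma measurable_coord1 j :
  measurable_fun setT (fun u : g_sigma_algebraType cyl1 => u j).
Proof.
move=> _ B mB; rewrite setTI; apply: sub_sigma_algebra.
exists (fun j' => if j' == j then B else setT); split.
  by move=> j'; case: ifP.
apply/seteqP; split => v /=.
  by move=> Bv j'; case: ifP => // /eqP ->.
by move=> /(_ j); rewrite !eqxx.
Qed.

Lemma measurable_to_cyl d (E : measurableType d) k (f : E -> nat -> V) :
  (forall i j, (i < k)%N -> measurable_fun setT (fun x => f x i j)) ->
  measurable_fun setT (f : E -> g_sigma_algebraType (cyl k)).
Proof.
move=> mf; apply: (@measurability _ _ E (g_sigma_algebraType (cyl k)) setT f (cyl k)) => //.
move=> _ [_ [A [mA ->]] <-]; rewrite setTI.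
rewrite (_ : _ @^-1` _ = \bigcap_(i in [set i | (i < k)%N]) \bigcap_(j in [set: 'I_(b - 1)]) (f ^~ i ^~ j @^-1` A i j)).
  apply: fin_bigcap_measurable => [|i ik]; first exact: finite_II.
  apply: fin_bigcap_measurable => // j _.
  by rewrite -[X in measurable X]setTI; exact: mf.
apply/seteqP; split => x /=; first by move=> H i ik j _; exact: H.
by move=> H i j ik; exact: H.
Qed.

Lemma measurable_to_cyl1 d (E : measurableType d) (f : E -> V) :
  (forall j, measurable_fun setT (fun x => f x j)) ->
  measurable_fun setT (f : E -> g_sigma_algebraType cyl1).
Proof.
move=> mf; apply: (@measurability _ _ E (g_sigma_algebraType cyl1) setT f cyl1) => //.
move=> _ [_ [A [mA ->]] <-]; rewrite setTI.
rewrite (_ : _ @^-1` _ = \bigcap_(j in [set: 'I_(b - 1)]) ((fun x => f x j) @^-1` A j)).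
  apply: fin_bigcap_measurable => // j _.
  by rewrite -[X in measurable X]setTI; exact: mf.
apply/seteqP; split => x /=; first by move=> H j _; exact: H.
by move=> H j; exact: H.
Qed.

Definition clip (x : R) : R := if 0 < x < 1 then x else 1/2.

Lemma clip_unit x : 0 < clip x < 1.
Proof. by rewrite /clip; case: ifPn => // _; apply/andP; split; lra. Qed.

Lemma clip_id x : 0 < x < 1 -> clip x = x.
Proof. by rewrite /clip => ->. Qed.

Lemma measurable_clip : measurable_fun setT clip.
Proof.
apply: measurable_fun_ifT => //; apply: measurable_and.
  exact: measurable_fun_ltr.
exact: measurable_fun_ltr.
Qed.

End Cylinders.

(** * The Markov property of the process *)

Section Process.
Variable R : realType.
Context d (T : measurableType d) (P : probability T R).
Variables (b : nat) (X : nat -> 'I_(b - 1) -> T -> R).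
Hypothesis b2 : (2 <= b)%N.
Hypothesis mX : forall k j, measurable_fun setT (X k j).
Hypothesis X01 : forall k j w, 0 < X k j w < 1.
Hypothesis indX : forall (n : nat) (A : nat -> 'I_(b - 1) -> set R),
  (forall k j, measurable (A k j)) ->
  P (\bigcap_(k in [set k | (k < n)%N]) \bigcap_(j in [set: 'I_(b - 1)]) (X k j @^-1` A k j))
  = (\prod_(k < n) P (\bigcap_(j in [set: 'I_(b - 1)]) (X 0%N j @^-1` A k j)))%E.
Notation V := ('I_(b - 1) -> R).

Definition path (w : T) : nat -> V := fun k j => X k j w.

Definition first_split (w : T) : seq R := one_split (path w 0).

Lemma path_unit w k : unitv (path w k).
Proof. by move=> j; exact: X01. Qed.

Section Step.
Variable k : nat.
Let Y1 (w : T) : g_sigma_algebraType (@cyl R b k) := path w.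
Let Y2 (w : T) : g_sigma_algebraType (@cyl1 R b) := path w k.
Let Y0 (w : T) : g_sigma_algebraType (@cyl1 R b) := path w 0.
Let mY1 : measurable_fun setT Y1.
Proof. by apply: measurable_to_cyl => i j _; exact: mX. Qed.
Let mY2 : measurable_fun setT Y2.
Proof. by apply: measurable_to_cyl1 => j; exact: mX. Qed.
Let mY0 : measurable_fun setT Y0.
Proof. by apply: measurable_to_cyl1 => j; exact: mX. Qed.
HB.instance Definition _ := isMeasurableFun.Build _ _ _ _ Y1 mY1.
HB.instance Definition _ := isMeasurableFun.Build _ _ _ _ Y2 mY2.
HB.instance Definition _ := isMeasurableFun.Build _ _ _ _ Y0 mY0.

Lemma step_indep A B : cyl k A -> cyl1 B ->
  P (Y1 @^-1` A `&` Y2 @^-1` B) = (P (Y1 @^-1` A) * P (Y0 @^-1` B))%E.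
Proof.
move=> [A' [mA ->]] [B' [mB ->]].
(* The event on the first [k] splits extended by [B'] at index [k]: the i.i.d. hypothesis for [k.+1]
   and for [k] differ by exactly the last factor. *)
pose C i j := if (i < k)%N then A' i j else B' j.
have mC i j : measurable (C i j) by rewrite /C; case: ifP.
have E1 : Y1 @^-1` [set v | forall i j, (i < k)%N -> A' i j (v i j)] =
   \bigcap_(i in [set i | (i < k)%N]) \bigcap_(j in [set: 'I_(b - 1)]) (X i j @^-1` C i j).
  apply/seteqP; split => w /= H.
    by move=> i /= ik j _; rewrite /C ik; exact: H.
  by move=> i j ik; have := H i ik j I; rewrite /C ik.
have E2 : Y1 @^-1` [set v | forall i j, (i < k)%N -> A' i j (v i j)] `&` Y2 @^-1` [set u | forall j, B' j (u j)] =
   \bigcap_(i in [set i | (i < k.+1)%N]) \bigcap_(j in [set: 'I_(b - 1)]) (X i j @^-1` C i j).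
  rewrite E1; apply/seteqP; split => w /=.
    move=> [H1 H2] i /=; rewrite ltnS leq_eqVlt => /predU1P[->|ik] j _.
      by rewrite /C ltnn; exact: H2.
    exact: H1.
  move=> H; split => [i /= ik j _|j]; first by apply: H => //=; rewrite ltnS ltnW.
  by have := H k (ltnSn k) j I; rewrite /C ltnn.
rewrite E2 E1 !indX// big_ord_recr /=; congr (_ * _)%E.
congr (P _); apply/seteqP; split => w /= H j; last by move=> _; rewrite /C ltnn; exact: H.
by have := H j I; rewrite /C ltnn.
Qed.

(** Conditioning on the first [k] splits in integrated form: given the past, the next split has the
    law of split 0 and is independent of the current largest length, so its sum may be replaced by
    its mean. *)
Lemma split_step (a : (nat -> V) -> R) (phi : R -> R -> R) (psi : R -> R) :
  measurable_fun setT (a : g_sigma_algebraType (@cyl R b k) -> R) ->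
  (exists C, forall v, (forall i, unitv (v i)) -> `|a v| <= C) ->
  measurable_fun setT (fun z : R * R => phi z.1 z.2) ->
  (exists C, forall x l, 0 <= x <= 1 -> 0 <= l <= 1 -> `|phi x l| <= C) ->
  measurable_fun setT psi ->
  (forall x, 0 <= x <= 1 -> ES P first_split (phi x) = psi x) ->
  Ex P (fun w => a (path w) * \sum_(l <- one_split (path w k)) phi (max_len (frag_state (path w) k)) l) =
  Ex P (fun w => a (path w) * psi (max_len (frag_state (path w) k))).
Proof.
move=> ma [C HC] mphi [C' HC'] mpsi phipsi.
(* The bounds on [a] and [phi] hold for positions in (0,1) only, while the generated spaces contain
   arbitrary real sequences. Clipping makes the bounds global and changes nothing along [path]. *)
pose cv (v : nat -> V) : nat -> V := fun i j => clip (v i j).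
pose cu (u : V) : V := fun j => clip (u j).
have cvp w : cv (path w) = path w.
  by apply/funext => i; apply/funext => j; rewrite /cv clip_id//; exact: X01.
have cup w i : cu (path w i) = path w i.
  by apply/funext => j; rewrite /cu clip_id//; exact: X01.
have cvu v i : unitv (cv v i) by move=> j; exact: clip_unit.
have cuu u : unitv (cu u) by move=> j; exact: clip_unit.
have mcv d' (E : measurableType d') (f : E -> nat -> V) : (forall i j, (i < k)%N -> measurable_fun setT (fun x => f x i j)) ->
   measurable_fun setT (fun x => cv (f x) : g_sigma_algebraType (@cyl R b k)).
  move=> mf; apply: measurable_to_cyl => i j ik.
  by apply: measurableT_comp (@measurable_clip R) _; exact: mf.
pose G (z : g_sigma_algebraType (@cyl R b k) * g_sigma_algebraType (@cyl1 R b)) : R :=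
  a (cv z.1) * \sum_(l <- one_split (cu z.2)) phi (max_len (frag_state (cv z.1) k)) l.
pose g (v : g_sigma_algebraType (@cyl R b k)) : R := a (cv v) * psi (max_len (frag_state (cv v) k)).
have m1 : forall i j, (i < k)%N -> measurable_fun setT (fun z : g_sigma_algebraType (@cyl R b k) * g_sigma_algebraType (@cyl1 R b) => z.1 i j).
  move=> i j ik; exact: (measurableT_comp (measurable_coord j ik) measurable_fst).
have m1c d' (E : measurableType d') (f : E -> nat -> V) : (forall i j, (i < k)%N -> measurable_fun setT (fun x => f x i j)) ->
   measurable_fun setT (fun x => max_len (frag_state (cv (f x)) k)).
  move=> mf; apply: mlist_max_len; apply: mlist_frag_state => i j ik.
  by apply: measurableT_comp (@measurable_clip R) _; exact: mf.
have mid : forall i j, (i < k)%N -> measurable_fun setT (fun v : g_sigma_algebraType (@cyl R b k) => v i j).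
  by move=> i j ik; exact: measurable_coord.
have L01 v i : 0 <= max_len (frag_state (cv v) i) <= 1.
  by rewrite max_len_ge0 (max_len_frag_le1 (cvu v)).
have -> : (fun w => a (path w) * \sum_(l <- one_split (path w k)) phi (max_len (frag_state (path w) k)) l) = (fun w => G (Y1 w, Y2 w)).
  by apply/funext => w; rewrite /G /= /Y1 /Y2 cvp cup.
have -> : (fun w => a (path w) * psi (max_len (frag_state (path w) k))) = (fun w => g (Y1 w)).
  by apply/funext => w; rewrite /g /= /Y1 cvp.
apply: (indep_Ex (@cylT R b k) (@cyl1T R b) (@cylI R b k) (@cyl1I R b) (Y1 := Y1) (Y2 := Y2) (Y0 := Y0) step_indep (G := G) (g := g) (C := C * (b%:R * C'))).
- apply: measurable_funM; first by apply: measurableT_comp ma _; exact: mcv.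
  apply: (@mlist_sum R _ (g_sigma_algebraType (@cyl R b k) * g_sigma_algebraType (@cyl1 R b))%type
    (fun z => one_split (cu z.2)) (fun z l => phi (max_len (frag_state (cv z.1) k)) l)).
    apply: mlist_one_split => j; apply: measurableT_comp (@measurable_clip R) _.
    exact: (measurableT_comp (measurable_coord1 j) measurable_snd).
  by move=> f mf; exact: (measurableT_comp mphi (measurable_fun_pair (m1c _ _ _ m1) mf)).
- move=> [v u]; rewrite /G normrM ler_pM//=; first by apply: HC; exact: cvu.
  apply: ler_norm_sum_size (size_one_split (cu u) b2) _ => l lS; apply: HC' => //.
  by rewrite (one_split_ge0 lS) (one_split_le1 (cuu u) lS).
- apply: measurable_funM; first by apply: measurableT_comp ma _; exact: mcv.
  by apply: measurableT_comp mpsi _; exact: m1c.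
- move=> v; rewrite /G /g /=.
  rewrite -phipsi//; rewrite /ES -ExZ; last first.
    split.
      apply: mlist_sum (fun _ l => phi _ l) _ _; first by apply: mlist_one_split => j; exact: mX.
      move=> f mf; exact: (measurableT_comp mphi (measurable_fun_pair (measurable_cst _) mf)).
    exists (b%:R * C') => w.
    apply: ler_norm_sum_size (size_one_split (path w 0) b2) _ => l lS; apply: HC' => //.
    by rewrite (one_split_ge0 lS) (one_split_le1 (path_unit w 0) lS).
  by congr Ex; apply/funext => w; rewrite /Y0 cup.
Qed.

End Step.

End Process.

(** * Asymptotics of the fragmentation *)

Section HighProbability.
Variable R : realType.
Context d (T : measurableType d) (P : probability T R).

(** [Q n] holds with probability tending to 1; stated through measurable exceptional sets because [P]
is meaningless on non-measurable sets. *)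
Definition whp (Q : nat -> T -> Prop) := forall p : R, 0 < p -> exists n0, forall n, (n0 <= n)%N ->
  exists B, [/\ measurable B, (P B <= p%:E)%E & forall w, ~ B w -> Q n w].

Lemma whp_and Q1 Q2 : whp Q1 -> whp Q2 -> whp (fun n w => Q1 n w /\ Q2 n w).
Proof.
move=> h1 h2 p p0; have p2 : 0 < p / 2 by rewrite divr_gt0.
have [n1 H1] := h1 _ p2; have [n2 H2] := h2 _ p2.
exists (maxn n1 n2) => n; rewrite geq_max => /andP[k1 k2].
have [B1 [mB1 PB1 HB1]] := H1 _ k1; have [B2 [mB2 PB2 HB2]] := H2 _ k2.
exists (B1 `|` B2); split; first exact: measurableU.
  apply: le_trans (measureU2 _ mB1 mB2) _.
  by apply: le_trans (leeD PB1 PB2) _; rewrite -EFinD lee_fin -splitr.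
by move=> w /not_orP[b1 b2]; split; [exact: HB1|exact: HB2].
Qed.

Lemma whp_imp Q1 Q2 N : (forall n w, (N <= n)%N -> Q1 n w -> Q2 n w) -> whp Q1 -> whp Q2.
Proof.
move=> H h1 p p0; have [n1 H1] := h1 _ p0; exists (maxn N n1) => n.
rewrite geq_max => /andP[k0 k1]; have [B [mB PB HB]] := H1 _ k1.
by exists B; split => // w nB; apply: H => //; exact: HB.
Qed.

Lemma whp_all (s : nat) (Q : nat -> nat -> T -> Prop) : (forall i, (i < s)%N -> whp (Q i)) ->
  whp (fun n w => forall i, (i < s)%N -> Q i n w).
Proof.
elim: s => [|s IH] H.
  by apply: (@whp_imp (fun _ _ => True) _ 0) => // p p0; exists 0%N => n _; exists set0; rewrite measure0 lee_fin ltW.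
have h1 : whp (fun n w => forall i, (i < s)%N -> Q i n w) by apply: IH => i is_; apply: H; exact: ltnW.
apply: (whp_imp (N := 0) _ (whp_and h1 (H s (ltnSn s)))) => n w _ [g1 g2] i.
by rewrite ltnS leq_eqVlt => /predU1P[->//|]; exact: g1.
Qed.

Lemma whp_ex Q : whp Q -> exists N, forall n, (N <= n)%N -> exists w, Q n w.
Proof.
move=> h; have [n0 H] := h (1/2) ltac:(lra); exists n0 => n nn.
have [B [mB PB HB]] := H n nn; apply: contrapT => h1.
have BT : B = setT.
  by apply/seteqP; split => // w _; apply: contrapT => nB; apply: h1; exists w; exact: HB.
move: PB; rewrite BT [X in (X <= _)%E](probability_setT P) lee_fin; lra.
Qed.

Lemma whp_cvg (A : nat -> set T) : (forall n, measurable (A n)) -> whp (fun n w => ~ A n w) ->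
  P (A n) @[n --> \oo] --> 0%E.
Proof.
move=> mA h; apply/fine_cvgP; split.
  by near=> n; exact: fin_num_measure.
apply/cvgrPdist_le => e e0; have [n0 H] := h e e0; exists n0 => // n /= nn.
have [B [mB PB HB]] := H n nn.
have PA : (P (A n) <= e%:E)%E.
  apply: le_trans PB; apply: le_measure; rewrite ?inE//.
  by move=> w Aw; apply: contrapT => nB; exact: (HB w nB).
rewrite sub0r normrN ger0_norm ?fine_ge0// -lee_fin fineK//; exact: fin_num_measure.
Unshelve. all: by end_near. Qed.

End HighProbability.

Section Fragmentation.
Variable R : realType.
Context d (T : measurableType d) (P : probability T R).
Variables (b : nat) (X : nat -> 'I_(b - 1) -> T -> R).
Hypothesis b2 : (2 <= b)%N.
Hypothesis mX : forall k j, measurable_fun setT (X k j).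
Hypothesis X01 : forall k j w, 0 < X k j w < 1.
Hypothesis indX : forall (n : nat) (A : nat -> 'I_(b - 1) -> set R),
  (forall k j, measurable (A k j)) ->
  P (\bigcap_(k in [set k | (k < n)%N]) \bigcap_(j in [set: 'I_(b - 1)]) (X k j @^-1` A k j))
  = (\prod_(k < n) P (\bigcap_(j in [set: 'I_(b - 1)]) (X 0%N j @^-1` A k j)))%E.
Notation V := ('I_(b - 1) -> R).
Let S := first_split X.
Variable delta : R.
Hypothesis delta0 : 0 < delta.
Hypothesis density : forall x y : R, 0 < x -> x < y -> y < 1 ->
  delta * (y - x) <= ES P S (fun l => (x <= l < y)%R%:R).

Let mS : mlist S. Proof. by apply: mlist_one_split => j; exact: mX. Qed.
Let sizeS w : size (S w) = b. Proof. exact: size_one_split. Qed.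
Let sumS w : \sum_(l <- S w) l = 1. Proof. exact/one_split_sum/path_unit. Qed.
Let S01 w l : l \in S w -> 0 <= l <= 1.
Proof. by move=> lS; rewrite (one_split_ge0 lS) (one_split_le1 (path_unit X01 w 0) lS). Qed.
Let kap := kap P S.
Let kap0 : 0 < kap. Proof. exact: (kap_gt0 mS sizeS S01 delta0 density). Qed.

Notation len v k := (max_len (frag_state v k)).
Notation gap v k := (big_gap (frag_state v k)).

Lemma len01 w k : 0 <= len (path X w) k <= 1.
Proof. by rewrite max_len_ge0 (max_len_frag_le1 (path_unit X01 w)). Qed.

Lemma measurable_len k : measurable_fun setT (fun w => len (path X w) k).
Proof. by apply: mlist_max_len; apply: mlist_frag_state => i j _; exact: mX. Qed.

Definition EL2 k := Ex P (fun w => len (path X w) k ^+ 2).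

Lemma bm_len2 k : bm (fun w => len (path X w) k ^+ 2).
Proof.
split; first by apply: measurable_funX; exact: measurable_len.
exists 1 => w; have /andP[h0 h1] := len01 w k.
by rewrite ger0_norm ?exprn_ge0// exprn_ile1.
Qed.

Lemma EL2_ge0 k : 0 <= EL2 k.
Proof. by apply: Ex_ge0 => w; rewrite exprn_ge0// max_len_ge0. Qed.

(** Each split lowers the expected sum of squared spacings by at least [kap * L ^ 2], whence the
summability of [EL2]. *)
Definition energy (w : T) n := region_sum (path X w) predT (fun x => x ^+ 2) n.

Lemma energy_step n : bm (fun w => energy w n) -> bm (fun w => energy w n.+1) ->
  Ex P (fun w => energy w n.+1) + kap * EL2 n <= Ex P (fun w => energy w n).
Proof.
move=> be be'.
pose q2 := ES P S (fun l => l ^+ 2).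
have rsq : regular (fun l : R => l ^+ 2).
  split; first exact: measurable_funX.
  by exists 1 => l /andP[l0 l1]; rewrite ger0_norm ?exprn_ge0// exprn_ile1.
have q2k : kap <= 1 - q2.
  rewrite lerBrDr -(ES_id P sumS) -(ESD P mS sizeS S01)//; last exact: regular_loss.
  apply: (ES_le P mS sizeS S01); [apply: regularD => //; exact: regular_loss|exact: regular_id|].
  by move=> l /andP[l0 l1]; rewrite /loss; have [k|k] := leP l (1 - l); nra.
have E1 : (fun w => energy w n.+1) = (fun w => (energy w n - len (path X w) n ^+ 2) + len (path X w) n ^+ 2 * \sum_(l <- one_split (path X w n)) l ^+ 2).
  apply/funext => w; rewrite /energy (region_sum_stepT (path_unit X01 w)) mulr_sumr.
  rewrite -addrA [- _ + _]addrC; congr (_ + (_ - _)).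
  by apply: eq_bigr => l _; rewrite exprMn.
have bS : bm (fun w => len (path X w) n ^+ 2 * \sum_(l <- one_split (path X w n)) l ^+ 2).
  rewrite (_ : (fun _ => _) = (fun w => energy w n.+1 - (energy w n - len (path X w) n ^+ 2))).
    by apply: bmB => //; apply: bmB => //; exact: bm_len2.
  by apply/funext => w; rewrite (congr1 (fun f => f w) E1); ring.
rewrite E1 ExD//; last by apply: bmB => //; exact: bm_len2.
rewrite ExB//; last exact: bm_len2.
have -> : Ex P (fun w => len (path X w) n ^+ 2 * \sum_(l <- one_split (path X w n)) l ^+ 2) = q2 * EL2 n.
  rewrite -ExZ; last exact: bm_len2.
  rewrite [RHS](_ : _ = Ex P (fun w => len (path X w) n ^+ 2 * q2)); last first.
    by congr Ex; apply/funext => w; rewrite mulrC.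
  apply: (split_step b2 mX X01 indX (k := n) (a := fun v => len v n ^+ 2) (phi := fun _ l => l ^+ 2) (psi := fun=> q2)).
  - apply: measurable_funX; apply: mlist_max_len; apply: mlist_frag_state => i j ik.
    exact: measurable_coord.
  - exists 1 => v vu; have L1 : len v n <= 1 by exact: max_len_frag_le1.
    by rewrite ger0_norm ?exprn_ge0 ?max_len_ge0// exprn_ile1// max_len_ge0.
  - by apply: measurable_funX; exact: measurable_snd.
  - by exists 1 => x l _ /andP[l0 l1]; rewrite ger0_norm ?exprn_ge0// exprn_ile1.
  - exact: measurable_cst.
  - by [].
rewrite -/(EL2 n); have := EL2_ge0 n; move: (EL2 n) => e e0.
have : kap * e <= (1 - q2) * e by rewrite ler_wpM2r.
by rewrite mulrBl mul1r; lra.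
Qed.

Lemma bm_energy n : bm (fun w => energy w n).
Proof.
split.
  rewrite /energy /region_sum; apply: (mlist2_sum (Phi := fun p => (p.2 - p.1) ^+ 2)).
    by apply: mlist_gaps; apply: mlist_frag_state => i j _; exact: mX.
  by move=> f g mf mg; apply: measurable_funX; exact: measurable_funB.
exists 1 => w; have uw := path_unit X01 w.
have srt : sorted <=%R (frag_state (path X w) n) by case/and3P: (valid_frag_state uw n).
rewrite ger0_norm; last by apply: sumr_ge0 => p _; exact: sqr_ge0.
rewrite -(region_mass1 uw n) /energy /region_sum big_seq [X in _ <= X]big_seq.
apply: ler_sum => p pin; have p0 : 0 <= p.2 - p.1 by rewrite subr_ge0; exact: gaps_le pin.
have p1 : p.2 - p.1 <= 1 by apply: le_trans (max_len_ge pin) (max_len_frag_le1 uw n).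
by rewrite expr2 ler_piMr.
Qed.

Lemma EL2_sum n : kap * \sum_(0 <= j < n) EL2 j <= 1.
Proof.
suff : Ex P (fun w => energy w n) + kap * \sum_(0 <= j < n) EL2 j <= 1.
  have : 0 <= Ex P (fun w => energy w n).
    by apply: Ex_ge0 => w; apply: sumr_ge0 => p _; exact: sqr_ge0.
  lra.
elim: n => [|n IH].
  rewrite big_geq// mulr0 addr0 -(Ex_cst P 1); apply: Ex_le; [exact: bm_energy|exact: bm_cst|].
  by move=> w; rewrite /energy /region_sum /= /gaps /= big_cons big_nil /=; lra.
rewrite big_nat_recr//= mulrDr.
by have := energy_step (bm_energy n) (bm_energy n.+1); lra.
Qed.

Lemma EL2_tail eps : 0 < eps -> exists m, forall n, (m <= n)%N -> \sum_(m <= j < n) EL2 j <= eps.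
Proof.
move=> e0; pose E := [set x | exists n, x = \sum_(0 <= j < n) EL2 j].
have hs : has_sup E.
  split; first by exists 0, 0%N; rewrite big_geq.
  exists (1 / kap) => _ [n ->]; rewrite ler_pdivlMr// mulrC; exact: EL2_sum.
have [_ [m ->] hm] := sup_adherent e0 hs; exists m => n mn.
have : \sum_(0 <= j < n) EL2 j <= sup E by apply: sup_upper_bound => //; exists n.
rewrite (@big_cat_nat _ _ _ m 0 n)//=; lra.
Qed.

(** * The martingale of potential and created weight *)

Section Weighted.
Variable chi : R -> R.
Hypothesis chi_nd : {homo chi : x y / x <= y}.
Hypothesis chi01 : forall x, 0 <= chi x <= 1.
Let h := renewal P S chi.
Let K := b%:R / kap.
Let K0 : 0 <= K. Proof. by rewrite /K divr_ge0// ltW. Qed.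
Let h0 r : 0 <= h r. Proof. exact: (renewal_ge0 mS sizeS sumS S01 delta0 density chi_nd chi01 r). Qed.
Let h1 r : r <= 1 -> h r = 0.
Proof. exact: (renewal_le1 mS sizeS sumS S01 delta0 density chi_nd chi01). Qed.
Let hK r : 0 <= r -> h r <= K * r.
Proof. exact: (renewal_linear mS sizeS sumS S01 delta0 density chi_nd chi01). Qed.
Let hnd : {homo h : x y / x <= y}.
Proof. exact: (renewal_nd mS sizeS sumS S01 delta0 density chi_nd chi01). Qed.
Let mh : measurable_fun setT h. Proof. exact: nondecreasing_measurable. Qed.
Let mchi : measurable_fun setT chi. Proof. exact: nondecreasing_measurable. Qed.

(** What a piece of relative length [l] brings, as potential and as created weight, when a gap of
    length [x] is split; lengths are measured in units of [t], and gaps not longer than [t] count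
    for nothing. *)
Definition drift t x l : R := if t < x then h (x / t * l) + chi (x / t * l) else 0.
Definition drift_mean t x : R := if t < x then h (x / t) else 0.

Lemma drift_ES t x : 0 < t -> ES P S (drift t x) = drift_mean t x.
Proof.
move=> t0; rewrite /drift /drift_mean; case: ifPn => [tx|_].
  by rewrite [RHS](renewal_fix mS sizeS sumS S01 delta0 density chi_nd chi01)// ltr_pdivlMr ?mul1r.
by rewrite (ES_cst P sizeS) mulr0.
Qed.

Lemma measurable_drift t : measurable_fun setT (fun z : R * R => drift t z.1 z.2).
Proof.
have m1 : measurable_fun setT (fun z : R * R => z.1 / t * z.2).
  by apply: measurable_funM; [apply: measurable_funM => //; exact: measurable_fst|exact: measurable_snd].
apply: measurable_fun_ifT => //; first by apply: measurable_fun_ltr => //; exact: measurable_fst.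
by apply: measurable_funD; exact: measurableT_comp.
Qed.

Lemma measurable_drift_mean t : measurable_fun setT (drift_mean t).
Proof.
apply: measurable_fun_ifT => //; first exact: measurable_fun_ltr.
by apply: measurableT_comp mh _; exact: measurable_funM.
Qed.

Lemma drift_bound t x l : 0 < t -> 0 <= x -> 0 <= l <= 1 -> 0 <= drift t x l <= (K + 1) * (x / t).
Proof.
move=> t0 x0 /andP[l0 l1]; have q0 : 0 <= x / t by rewrite divr_ge0// ltW.
rewrite /drift; case: ifPn => [tx|_]; last by rewrite lexx mulr_ge0// addr_ge0.
have q1 : 1 < x / t by rewrite ltr_pdivlMr// mul1r.
have /andP[c0 c1] := chi01 (x / t * l).
rewrite addr_ge0//= mulrDl mul1r lerD//; last by lra.
apply: le_trans (hnd (_ : _ <= x / t)) (hK q0).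
by rewrite ger_pMr//; lra.
Qed.

Lemma drift_mean_bound t x : 0 < t -> 0 <= x -> 0 <= drift_mean t x <= K * (x / t).
Proof.
move=> t0 x0; have q0 : 0 <= x / t by rewrite divr_ge0// ltW.
by rewrite /drift_mean; case: ifPn => [tx|_]; [rewrite h0 hK|rewrite lexx mulr_ge0].
Qed.

Definition mart_incr t x (u : V) : R := \sum_(l <- one_split u) drift t x l - drift_mean t x.

Let Cb := b%:R * (K + 1) + K.

Lemma mart_incr_bound t x u : 0 < t -> 0 <= x -> unitv u -> `|mart_incr t x u| <= Cb * (x / t).
Proof.
move=> t0 x0 uu; apply: le_trans (ler_normB _ _) _; rewrite /Cb mulrDl lerD//; last first.
  by have /andP[a1 a2] := drift_mean_bound t0 x0; rewrite ger0_norm.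
rewrite -mulrA; apply: ler_norm_sum_size (size_one_split u b2) _ => l lS.
have l01 : 0 <= l <= 1 by rewrite (one_split_ge0 lS) (one_split_le1 uu lS).
by have /andP[a1 a2] := drift_bound t0 x0 l01; rewrite ger0_norm.
Qed.

(** The source space is arbitrary because the region is evaluated both on [T] and on the space of
    the first [n] splits. *)
Definition mpred (I : R * R -> bool) := forall d' (E : measurableType d') (f g : E -> R),
  measurable_fun setT f -> measurable_fun setT g -> measurable_fun setT (fun x => I (f x, g x)).

Section Region.
Variable I : R * R -> bool.
Hypothesis mI : mpred I.
Hypothesis hI : hered I.

(** The martingale follows only the splits inside the region [I]: a hereditary region loses no potential
when an outside gap is split, so that [potential_ge] still holds. *)
Definition mart t m n (v : nat -> V) : R :=
  \sum_(m <= j < n) (I (gap v j))%:R * mart_incr t (len v j) (v j).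

Lemma measurable_gapI d' (E : measurableType d') k (f : E -> nat -> V) :
  (forall i j, (i < k)%N -> measurable_fun setT (fun x => f x i j)) ->
  measurable_fun setT (fun x => (I (gap (f x) k))%:R : R).
Proof.
move=> mf; have [m1 m2] := mlist_big_gap (mlist_frag_state mf).
apply: mfun_natr_bool; have := mI m1 m2.
by congr measurable_fun; apply/funext => x; rewrite -surjective_pairing.
Qed.

Lemma measurable_mart d' (E : measurableType d') t m n (f : E -> nat -> V) :
  (forall i j, (i < n)%N -> measurable_fun setT (fun x => f x i j)) ->
  measurable_fun setT (fun x => mart t m n (f x)).
Proof.
move=> mf; rewrite /mart.
have -> : (fun x => \sum_(m <= j < n) (I (gap (f x) j))%:R * mart_incr t (len (f x) j) (f x j)) =
  (fun x => \sum_(j <- index_iota m n) (if (j < n)%N then (I (gap (f x) j))%:R * mart_incr t (len (f x) j) (f x j) else 0)).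
  apply/funext => x; apply: eq_big_seq => j; rewrite mem_index_iota => /andP[_ jn].
  by rewrite jn.
apply: measurable_sum => j; case: (boolP (j < n)%N) => // jn.
have mfj i j' : (i < j)%N -> measurable_fun setT (fun x => f x i j').
  by move=> ij; apply: mf; exact: ltn_trans ij jn.
apply: measurable_funM; first exact: measurable_gapI.
have mlen : measurable_fun setT (fun x => len (f x) j).
  by apply: mlist_max_len; exact: mlist_frag_state.
apply: measurable_funB; last by apply: measurableT_comp mlen; exact: measurable_drift_mean.
apply: (@mlist_sum R _ E (fun x => one_split (f x j)) (fun x l => drift t (len (f x) j) l)).
  by apply: mlist_one_split => j'; exact: mf.
move=> g mg; exact: (measurableT_comp (measurable_drift t) (measurable_fun_pair mlen mg)).
Qed.

Lemma mart_bound t m n v : 0 < t -> (forall i, unitv (v i)) -> `|mart t m n v| <= n%:R * (Cb / t).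
Proof.
move=> t0 vu; have C0 : 0 <= Cb by rewrite /Cb addr_ge0// mulr_ge0// addr_ge0.
apply: le_trans (ler_norm_sum _ _ _) _.
apply: (@le_trans _ _ (\sum_(m <= j < n) (Cb / t))).
  apply: ler_sum => j _; rewrite normrM.
  have L0 : 0 <= len v j by exact: max_len_ge0.
  have L1 : len v j <= 1 by exact: max_len_frag_le1.
  have := mart_incr_bound t0 L0 (vu j); set a := `|mart_incr _ _ _| => ha.
  apply: (@le_trans _ _ a).
    by case: (I _); rewrite ?normr1 ?normr0 ?mul1r ?mul0r// normr_ge0.
  by apply: le_trans ha _; rewrite mulrA ler_pM2r ?invr_gt0// ler_piMr.
by rewrite sumr_const_nat -[_ *+ (n - m)]mulr_natl ler_wpM2r ?ler_nat ?leq_subr// divr_ge0// ltW.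
Qed.

Lemma bm_mart t m n : 0 < t -> bm (fun w => mart t m n (path X w)).
Proof.
move=> t0; split; first by apply: measurable_mart => i j _; exact: mX.
by exists (n%:R * (Cb / t)) => w; apply: mart_bound => // i; exact: path_unit.
Qed.

(** The earlier sum and the indicator that the current gap lies in [I] depend on the first [n]
    splits only; given these, the new increment has mean zero by [drift_ES]. *)
Lemma mart_orth t m n : 0 < t ->
  Ex P (fun w => mart t m n (path X w) * ((I (gap (path X w) n))%:R * mart_incr t (len (path X w) n) (path X w n))) = 0.
Proof.
move=> t0; have C0 : 0 <= Cb by rewrite /Cb addr_ge0// mulr_ge0// addr_ge0.
pose a v := mart t m n v * (I (gap v n))%:R.
have ba : bm (fun w => a (path X w)).
  apply: bmM; first exact: bm_mart.
  split; first by apply: measurable_gapI => i j _; exact: mX.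
  by exists 1 => w; case: (I _); rewrite ?normr1 ?normr0.
have bdm : bm (fun w => drift_mean t (len (path X w) n)).
  split; first by apply: measurableT_comp (measurable_len n); exact: measurable_drift_mean.
  exists (K / t) => w; have /andP[l0 l1] := len01 w n.
  have /andP[a1 a2] := drift_mean_bound t0 l0; rewrite ger0_norm//; apply: le_trans a2 _.
  by rewrite mulrA ler_pM2r ?invr_gt0// ler_piMr.
have bds : bm (fun w => \sum_(l <- one_split (path X w n)) drift t (len (path X w) n) l).
  split.
    apply: (@mlist_sum R _ T (fun w => one_split (path X w n)) (fun w l => drift t (len (path X w) n) l)).
      by apply: mlist_one_split => j; exact: mX.
    move=> g mg; exact: (measurableT_comp (measurable_drift t) (measurable_fun_pair (measurable_len n) mg)).
  exists (b%:R * ((K + 1) / t)) => w; apply: ler_norm_sum_size (size_one_split _ b2) _ => l lS.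
  have l01 : 0 <= l <= 1 by rewrite (one_split_ge0 lS) (one_split_le1 (path_unit X01 w n) lS).
  have /andP[L0 L1] := len01 w n.
  have /andP[a1 a2] := drift_bound t0 L0 l01; rewrite ger0_norm//; apply: le_trans a2 _.
  by rewrite mulrA ler_pM2r ?invr_gt0// ler_piMr// addr_ge0.
have -> : (fun w => mart t m n (path X w) * ((I (gap (path X w) n))%:R * mart_incr t (len (path X w) n) (path X w n))) =
  (fun w => a (path X w) * \sum_(l <- one_split (path X w n)) drift t (len (path X w) n) l - a (path X w) * drift_mean t (len (path X w) n)).
  by apply/funext => w; rewrite /a /mart_incr; ring.
rewrite ExB; [|exact: bmM|exact: bmM].
rewrite (_ : Ex P (fun w => a (path X w) * \sum_(l <- one_split (path X w n)) drift t (len (path X w) n) l) = Ex P (fun w => a (path X w) * drift_mean t (len (path X w) n))) ?subrr//.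
apply: (split_step b2 mX X01 indX (k := n) (a := a) (phi := drift t) (psi := drift_mean t)).
- apply: measurable_funM; first by apply: measurable_mart => i j ij; exact: measurable_coord.
  by apply: measurable_gapI => i j ij; exact: measurable_coord.
- exists (n%:R * (Cb / t)) => v vu; rewrite /a normrM.
  apply: le_trans (mart_bound m n t0 vu); case: (I _); rewrite ?normr1 ?normr0 ?mulr1 ?mulr0//.
- exact: measurable_drift.
- exists ((K + 1) / t) => x l /andP[x0 x1] l01.
  have /andP[a1 a2] := drift_bound t0 x0 l01; rewrite ger0_norm//; apply: le_trans a2 _.
  by rewrite mulrA ler_pM2r ?invr_gt0// ler_piMr// addr_ge0.
- exact: measurable_drift_mean.
- by move=> x _; exact: drift_ES.
Qed.

(** The increments are orthogonal, and the one at step [j] is at most [Cb / t] times the largest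
    length. *)
Lemma mart_sq t m n : 0 < t -> (m <= n)%N ->
  Ex P (fun w => mart t m n (path X w) ^+ 2) <= (Cb / t) ^+ 2 * \sum_(m <= j < n) EL2 j.
Proof.
move=> t0 /subnKC <-; elim: (n - m)%N => [|k IH].
  rewrite addn0 !big_geq// mulr0 -[leRHS](Ex_cst P); apply: Ex_le; [|exact: bm_cst|].
    by apply: bmM; exact: bm_mart.
  by move=> w; rewrite /mart big_geq// expr0n.
rewrite addnS big_nat_recr ?leq_addr//= mulrDr; set q := (m + k)%N in IH *.
pose D w := (I (gap (path X w) q))%:R * mart_incr t (len (path X w) q) (path X w q).
have bD : bm D.
  rewrite (_ : D = fun w => mart t q q.+1 (path X w)); first exact: bm_mart.
  by apply/funext => w; rewrite /mart big_nat1.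
have E1 : (fun w => mart t m q.+1 (path X w) ^+ 2) =
   (fun w => (mart t m q (path X w) ^+ 2 + 2 * (mart t m q (path X w) * D w)) + D w ^+ 2).
  by apply/funext => w; rewrite /mart big_nat_recr ?leq_addr//= -/(D w); ring.
have bm1 : bm (fun w => mart t m q (path X w)) by exact: bm_mart.
rewrite E1 !ExD; [|exact: bmM|exact/bmZ/bmM|apply: bmD; [exact: bmM|exact/bmZ/bmM]|exact: bmM].
rewrite ExZ; last exact: bmM.
rewrite (mart_orth m q t0) mulr0 addr0 lerD//.
rewrite -ExZ; last exact: bm_len2.
apply: Ex_le; [exact: bmM|apply: bmZ; exact: bm_len2|] => w.
have /andP[l0 l1] := len01 w q.
have := mart_incr_bound t0 l0 (path_unit X01 w q).
rewrite /D; set x := mart_incr _ _ _ => hx.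
rewrite exprMn; apply: (@le_trans _ _ (x ^+ 2)).
  by case: (I _); rewrite ?expr1n ?mul1r// expr0n mul0r sqr_ge0.
rewrite -exprMn mulrAC -mulrA -real_normK ?num_real//.
by rewrite ler_sqr// nnegrE ?(le_trans _ hx).
Qed.

Definition created t m n (v : nat -> V) : R := \sum_(m <= j < n)
  (I (gap v j))%:R * (if t < len v j then \sum_(l <- one_split (v j)) chi (len v j / t * l) else 0).

Definition potential t n (v : nat -> V) : R := region_sum v I (fun x => h (x / t)) n.

(** When the split gap is not longer than [t] all terms vanish, as [h] is 0 up to 1; otherwise the
    drift separates into its two components. *)
Lemma created_term t (v : nat -> V) j : 0 < t -> unitv (v j) -> 0 <= len v j ->
  (I (gap v j))%:R * mart_incr t (len v j) (v j) =
  (I (gap v j))%:R * (\sum_(l <- one_split (v j)) h (len v j * l / t) - h (len v j / t)) +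
  (I (gap v j))%:R * (if t < len v j then \sum_(l <- one_split (v j)) chi (len v j / t * l) else 0).
Proof.
move=> t0 vu L0; rewrite -mulrDr; congr (_ * _); rewrite /mart_incr /drift /drift_mean.
case: ifPn => tL.
  rewrite big_split /= addrAC; congr (_ + _ + _).
  by apply: eq_bigr => l _; rewrite mulrAC.
rewrite big1// subrr addr0 big1_seq ?sub0r ?h1 ?oppr0//.
  by rewrite ler_pdivrMr// mul1r leNgt.
move=> l /= lS; apply: h1; rewrite ler_pdivrMr// mul1r.
apply: le_trans (_ : len v j <= _); last by rewrite leNgt.
by rewrite ler_piMr// (one_split_le1 vu lS).
Qed.

Lemma potential_ge t m n v : 0 < t -> (forall i, unitv (v i)) -> (m <= n)%N ->
  potential t m v + mart t m n v <= potential t n v + created t m n v.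
Proof.
move=> t0 vu mn; rewrite -lerBlDr; apply: le_trans (region_sum_ge vu hI _ mn); last by move=> x _; exact: h0.
rewrite -addrA lerD2l lerBlDr /mart /created -big_split /= le_eqVlt; apply/orP; left; apply/eqP.
by apply: eq_bigr => j _; rewrite created_term// max_len_ge0.
Qed.

Lemma potential_eq t m n v : (forall p, I p) -> 0 < t -> (forall i, unitv (v i)) -> (m <= n)%N ->
  potential t m v + mart t m n v = potential t n v + created t m n v.
Proof.
move=> IT t0 vu mn.
have E k : potential t k v = region_sum v predT (fun x => h (x / t)) k.
  by apply: eq_bigl => p; rewrite IT.
rewrite !E (region_sum_eqT vu _ mn) -addrA; congr (_ + _).
rewrite /mart /created -big_split /=.
by apply: eq_bigr => j _; rewrite created_term// ?max_len_ge0// IT mul1r.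
Qed.

Lemma created_split t m n v : (m <= n)%N -> created t 0 n v = created t 0 m v + created t m n v.
Proof. by move=> mn; rewrite /created (@big_cat_nat _ _ _ m 0 n). Qed.

Lemma created_bound t m v : 0 <= created t 0 m v <= (m * b)%:R.
Proof.
have B j : 0 <= (I (gap v j))%:R * (if t < len v j then \sum_(l <- one_split (v j)) chi (len v j / t * l) else 0) <= b%:R.
  have S0 : 0 <= \sum_(l <- one_split (v j)) chi (len v j / t * l) <= b%:R.
    apply/andP; split; first by apply: sumr_ge0 => l _; have /andP[] := chi01 (len v j / t * l).
    rewrite -[b%:R]mulr1; apply: le_trans (ler_norm _) _.
    apply: ler_norm_sum_size (size_one_split _ b2) _ => l _.
    by have /andP[c0 c1] := chi01 (len v j / t * l); rewrite ger0_norm.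
  case: (I _); case: ifP => _; rewrite ?mul1r ?mul0r// lexx /=; exact: ler0n.
rewrite /created; apply/andP; split.
  by apply: sumr_ge0 => j _; have /andP[] := B j.
apply: (@le_trans _ _ (\sum_(0 <= j < m) b%:R)); first by apply: ler_sum => j _; have /andP[] := B j.
by rewrite sumr_const_nat subn0 -[_ *+ m]mulr_natr -natrM mulnC.
Qed.

Lemma region_id_le1 (v : nat -> V) n : (forall i, unitv (v i)) -> region_sum v I id n <= 1.
Proof.
move=> vu; rewrite -(region_mass1 vu n) /region_sum big_mkcond /= big_seq [leRHS]big_seq.
have srt : sorted <=%R (frag_state v n) by case/and3P: (valid_frag_state vu n).
apply: ler_sum => p pin; case: ifP => // _; rewrite subr_ge0; exact: gaps_le pin.
Qed.

(** To be used at a fixed time: after multiplication by [t], the term carrying the number of gaps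
    tends to 0 and only [eps] remains. *)
Lemma potential_mass t (v : nat -> V) n M eps C : 0 < t -> (forall i, unitv (v i)) -> 0 <= eps -> 0 <= C ->
  (forall r, 0 <= r -> `|h r - M * r| <= eps * r + C) ->
  `|potential t n v - M / t * region_sum v I id n| <= eps / t + C * (n * (b - 1)).+1%:R.
Proof.
move=> t0 vu e0 C0 H.
have srt : sorted <=%R (frag_state v n) by case/and3P: (valid_frag_state vu n).
rewrite /potential /region_sum mulr_sumr -sumrB.
apply: le_trans (ler_norm_sum _ _ _) _.
apply: (@le_trans _ _ (\sum_(p <- gaps (frag_state v n)) (eps / t * (p.2 - p.1) + C))).
  rewrite big_mkcond /= big_seq [leRHS]big_seq; apply: ler_sum => p pin.
  have p0 : 0 <= p.2 - p.1 by rewrite subr_ge0; exact: gaps_le pin.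
  have q0 : 0 <= (p.2 - p.1) / t by rewrite divr_ge0// ltW.
  case: ifP => _; last by rewrite addr_ge0// mulr_ge0// divr_ge0// ltW.
  by have := H _ q0; rewrite mulrAC mulrA mulrAC [eps * _]mulrA [eps * _ / t]mulrAC.
rewrite big_split /= -mulr_sumr -/(region_sum v predT id n) (region_mass1 vu) mulr1 lerD2l.
by rewrite big_const_seq count_predT size_gaps_frag_state iter_addr_0 mulr_natr.
Qed.

Lemma eventually_small (c rho : R) : 0 < rho -> exists N, forall n, (N <= n)%N -> c <= rho * n%:R.
Proof.
move=> r0; exists (Num.bound `|c / rho|) => n nn.
have h2 : `|c / rho| < n%:R by apply: lt_le_trans (archi_boundP (normr_ge0 _)) _; rewrite ler_nat.
rewrite mulrC -ler_pdivrMr//; apply: le_trans (ler_norm _) (ltW h2).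
Qed.

(** In the bound of [mart_sq] the factor [t ^ 2] cancels, so [m] depends on the tail of [EL2] alone.
    Only then is [n] taken large, to absorb an arbitrary cost [c m]. *)
Lemma mart_small theta rho (c : nat -> R) : 0 < theta -> 0 < rho -> forall p, 0 < p ->
  exists m n0, forall n, (n0 <= n)%N ->
  [/\ (m <= n)%N, (0 < n)%N, theta / n%:R * c m <= rho &
  exists B, [/\ measurable B, (P B <= p%:E)%E & forall w, ~ B w ->
   len (path X w) m <= rho /\ theta / n%:R * `|mart (theta / n%:R) m n (path X w)| <= rho]].
Proof.
move=> th0 r0 p p0.
(* Half of [p] for each of two Markov bounds on squares: the denominator is at least 1 for the
   largest length at time [m], and at least [Cb ^+ 2] for the martingale. *)
pose eps := p / 2 * rho ^+ 2 / (Cb ^+ 2 + 1).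
have C1 : 0 < Cb ^+ 2 + 1 by rewrite ltr_wpDl// sqr_ge0.
have r2 : 0 < rho ^+ 2 by rewrite exprn_gt0.
have e0 : 0 < eps by rewrite /eps divr_gt0// mulr_gt0// divr_gt0.
have [m Hm] := EL2_tail e0.
have [N HN] := eventually_small (theta * c m) r0.
exists m, (maxn m (maxn 1 N)) => n; rewrite !geq_max => /and3P[mn n0 Nn].
have nR : 0 < n%:R :> R by rewrite ltr0n.
split => //; first by rewrite mulrAC ler_pdivrMr// HN.
set t := theta / n%:R; have t0 : 0 < t by rewrite divr_gt0.
pose f1 w := len (path X w) m ^+ 2; pose f2 w := t ^+ 2 * mart t m n (path X w) ^+ 2.
have b1 : bm f1 by exact: bm_len2.
have b2' : bm f2 by apply: bmZ; apply: bmM; exact: bm_mart.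
have p1 : (P [set w | (rho ^+ 2 < f1 w)%R] <= (p / 2)%:E)%E.
  apply: le_trans (Ex_markov P b1 _ r2) _; first by move=> w; exact: sqr_ge0.
  rewrite lee_fin ler_pdivrMr//.
  (* [EL2 m] is itself the first term of the tail. *)
  have : EL2 m <= eps by have := Hm m.+1 (leqnSn m); rewrite big_nat1.
  move=> /le_trans; apply; rewrite /eps ler_pdivrMr// ler_peMr//; last by rewrite lerDr sqr_ge0.
  by rewrite ltW// mulr_gt0// divr_gt0.
have p2 : (P [set w | (rho ^+ 2 < f2 w)%R] <= (p / 2)%:E)%E.
  apply: le_trans (Ex_markov P b2' _ r2) _; first by move=> w; rewrite mulr_ge0// sqr_ge0.
  rewrite lee_fin ler_pdivrMr// ExZ; last by apply: bmM; exact: bm_mart.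
  apply: (@le_trans _ _ (t ^+ 2 * ((Cb / t) ^+ 2 * eps))).
    rewrite ler_wpM2l ?sqr_ge0//; apply: le_trans (mart_sq t0 mn) _.
    by rewrite ler_wpM2l ?sqr_ge0// Hm.
  rewrite mulrA -exprMn [t * _]mulrC divfK ?gt_eqF// /eps mulrA ler_pdivrMr// mulrC.
  rewrite ler_wpM2l//; first by rewrite ltW// mulr_gt0// divr_gt0.
  by rewrite lerDl.
have mB (f : T -> R) : bm f -> measurable [set w | (rho ^+ 2 < f w)%R].
  by move=> bf; apply: mset_bool; apply: measurable_fun_ltr => //; exact: bm_mf.
exists ([set w | (rho ^+ 2 < f1 w)%R] `|` [set w | (rho ^+ 2 < f2 w)%R]); split.
- by apply: measurableU; exact: mB.
- apply: le_trans (measureU2 _ (mB _ b1) (mB _ b2')) _.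
  by apply: le_trans (leeD p1 p2) _; rewrite -EFinD lee_fin -splitr.
- move=> w /not_orP[/= /negP h2 /negP h3]; rewrite -leNgt in h2; rewrite -leNgt in h3; split.
    by rewrite -ler_sqr ?nnegrE ?max_len_ge0// (ltW r0).
  have q0 : 0 <= t * `|mart t m n (path X w)| by rewrite mulr_ge0// ltW.
  by rewrite -ler_sqr ?nnegrE ?(ltW r0)// exprMn real_normK ?num_real.
Qed.

Variable M : R.
Hypothesis M0 : 0 <= M.
Hypothesis rateM : renewal_rate P S chi M.

Let affM eps : 0 < eps -> exists2 C, 0 <= C & forall r, 0 <= r -> `|h r - M * r| <= eps * r + C.
Proof.
move=> e0; have [C HC] := renewal_affine mS sizeS sumS S01 delta0 density chi_nd chi01 rateM e0.
exists `|C| => // r r0; apply: le_trans (HC r r0) _; by rewrite lerD2l ler_norm.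
Qed.

Lemma population_lower mu theta rho : 0 < theta -> 0 < rho ->
  (forall n w, mu - len (path X w) n <= region_sum (path X w) I id n) ->
  whp P (fun n w => M * mu - rho <= theta / n%:R *
    (potential (theta / n%:R) n (path X w) + created (theta / n%:R) 0 n (path X w))).
Proof.
move=> th0 r0 Hmu p p0.
have e0 : 0 < rho / 4 by rewrite divr_gt0.
have [C C0 HC] := affM e0.
(* The second bound gives [M * rho' <= rho / 4]; the denominator [M + 1] allows [M = 0], positivity
   being known only later. *)
pose rho' := Num.min (rho / 4) (rho / 4 / (M + 1)).
have M1 : 0 < M + 1 by rewrite ltr_wpDl.
have r0' : 0 < rho' by rewrite lt_min e0 divr_gt0.
have [m [n0 H]] := mart_small (fun m => C * (m * (b - 1)).+1%:R) th0 r0' p0.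
exists n0 => n nn; have [mn n_gt0 Hc [B [mB PB HB]]] := H n nn.
exists B; split => // w nB; have [Lm Hmart] := HB w nB.
have vu := path_unit X01 w; set v := path X w in Lm Hmart vu *.
set t := theta / n%:R in Hc Hmart *.
have t0 : 0 < t by rewrite divr_gt0// ltr0n.
have hr1 : rho' <= rho / 4 by rewrite ge_min lexx.
have hr2 : M * rho' <= rho / 4.
  apply: (@le_trans _ _ (M * (rho / 4 / (M + 1)))).
    by rewrite ler_wpM2l// ge_min lexx orbT.
  by rewrite mulrA ler_pdivrMr// mulrDr mulr1 mulrC lerDl ltW.
have cr : created t m n v <= created t 0 n v.
  by rewrite (created_split _ _ mn) lerDr; have /andP[] := created_bound t m v.
have pg := potential_ge t0 vu mn.
have pm := potential_mass m t0 vu (ltW e0) C0 HC.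
have hm := Hmu m w; rewrite -/v in hm.
have k1 : t * (potential t m v + mart t m n v) <= t * (potential t n v + created t 0 n v).
  by rewrite ler_pM2l//; lra.
apply: le_trans k1; rewrite mulrDr.
have k2 : - rho' <= t * mart t m n v.
  have : t * - `|mart t m n v| <= t * mart t m n v by rewrite ler_pM2l// lerNnormlW.
  by rewrite mulrN; lra.
move: pm; rewrite ler_norml => /andP[pm _].
have k3 : M * region_sum v I id m - rho / 4 - t * (C * (m * (b - 1)).+1%:R) <= t * potential t m v.
  have := ler_wpM2l (ltW t0) pm; rewrite mulrN mulrDr mulrBr !mulrA.
  have -> : t * rho / 4 / t = rho / 4 by field; rewrite gt_eqF.
  have -> : t * M / t = M by field; rewrite gt_eqF.
  lra.
have k4 : M * (mu - len v m) <= M * region_sum v I id m by rewrite ler_wpM2l.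
have k5 : M * len v m <= M * rho' by rewrite ler_wpM2l.
rewrite mulrBr in k4; lra.
Qed.

Lemma population_upper theta rho : (forall p, I p) -> 0 < theta -> 0 < rho ->
  whp P (fun n w => theta / n%:R *
    (potential (theta / n%:R) n (path X w) + created (theta / n%:R) 0 n (path X w)) <= M + rho).
Proof.
move=> IT th0 r0 p p0.
have e0 : 0 < rho / 4 by rewrite divr_gt0.
have [C C0 HC] := affM e0.
have [m [n0 H]] := mart_small (fun m => C * (m * (b - 1)).+1%:R + (m * b)%:R) th0 e0 p0.
exists n0 => n nn; have [mn n_gt0 Hc [B [mB PB HB]]] := H n nn.
exists B; split => // w nB; have [_ Hmart] := HB w nB.
have vu := path_unit X01 w; set v := path X w in Hmart vu *.
set t := theta / n%:R in Hc Hmart *.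
have t0 : 0 < t by rewrite divr_gt0// ltr0n.
have pg := potential_eq IT t0 vu mn.
have pm := potential_mass m t0 vu (ltW e0) C0 HC.
rewrite (created_split _ _ mn) addrCA -pg !mulrDr.
have k1 : t * created t 0 m v <= t * (m * b)%:R.
  by apply: ler_wpM2l; [exact: ltW|have /andP[] := created_bound t m v].
have k2 : t * mart t m n v <= rho / 4.
  by apply: le_trans Hmart; rewrite ler_pM2l// ler_norm.
move: pm; rewrite ler_norml => /andP[_ pm].
have k3 : t * potential t m v <= M * region_sum v I id m + rho / 4 + t * (C * (m * (b - 1)).+1%:R).
  have := ler_wpM2l (ltW t0) pm; rewrite mulrBr mulrDr !mulrA.
  have -> : t * rho / 4 / t = rho / 4 by field; rewrite gt_eqF.
  have -> : t * M / t = M by field; rewrite gt_eqF.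
  lra.
have k4 : M * region_sum v I id m <= M by rewrite ler_piMr// region_id_le1.
rewrite mulrDr in Hc; lra.
Qed.

End Region.
End Weighted.

(** * The largest spacing and the spacings on either side of a point *)

Let b_gt0 : 0 < b%:R :> R. Proof. by rewrite ltr0n; lia. Qed.
Lemma pred_b_ge1 : 1 <= (b - 1)%:R :> R. Proof. by rewrite (ler_nat R 1); lia. Qed.
Lemma b_pred : b%:R = (b - 1)%:R + 1 :> R. Proof. by rewrite -(natrD R _ 1); congr _%:R; lia. Qed.

Lemma mpredT : mpred (predT : R * R -> bool).
Proof. by move=> d' E f g mf mg; exact: measurable_cst. Qed.
Lemma mpred_left (y : R) : mpred (left_of y).
Proof. by move=> d' E f g mf mg; exact: measurable_fun_ler. Qed.
Lemma mpred_right (y : R) : mpred (right_of y).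
Proof. by move=> d' E f g mf mg; exact: measurable_fun_ltr. Qed.

Lemma potential0 chi I t n (v : nat -> V) : {homo chi : x y / x <= y} -> (forall x, 0 <= chi x <= 1) ->
  0 < t -> (forall i, unitv (v i)) -> len v n <= t -> potential chi I t n v = 0.
Proof.
move=> nd c01 t0 vu Lt; apply: big1_seq => p /andP[_ pin].
apply: (renewal_le1 mS sizeS sumS S01 delta0 density nd c01).
by rewrite ler_pdivrMr// mul1r; apply: le_trans Lt; exact: max_len_ge.
Qed.

Lemma potential_ge0 chi I t n (v : nat -> V) : {homo chi : x y / x <= y} -> (forall x, 0 <= chi x <= 1) ->
  0 <= potential chi I t n v.
Proof.
move=> nd c01; apply: sumr_ge0 => p _.
exact: (renewal_ge0 mS sizeS sumS S01 delta0 density nd c01).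
Qed.

(** With weight [1 / b] per piece each split creates total weight 1, so the created weight counts
    splits. *)
Let unit_weight : R -> R := fun=> b%:R^-1.
Let uw_nd : {homo unit_weight : x y / x <= y}. Proof. by []. Qed.
Let uw01 x : 0 <= unit_weight x <= 1.
Proof. by rewrite invr_ge0 ler0n invf_le1// (ler_nat R 1); lia. Qed.

Definition splits I t n (v : nat -> V) : R := created unit_weight I t 0 n v.

Lemma splitsE I t n v : splits I t n v = \sum_(0 <= j < n) (I (gap v j))%:R * (t < len v j)%R%:R.
Proof.
apply: eq_bigr => j _; congr (_ * _); case: ifP => // _.
by rewrite big_const_seq count_predT (size_one_split _ b2) iter_addr_0 -[LHS]mulr_natl mulfV// gt_eqF.
Qed.

Lemma splits_le t n v : splits predT t n v <= n%:R.
Proof.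
rewrite splitsE; apply: (@le_trans _ _ (\sum_(0 <= j < n) 1)).
  by apply: ler_sum => j _; rewrite mul1r; case: (_ < _)%R.
by rewrite sumr_const_nat subn0.
Qed.

Lemma splits_all t n v : (forall i, unitv (v i)) -> t < len v n -> splits predT t n v = n%:R.
Proof.
move=> vu tL; rewrite splitsE -[RHS](_ : \sum_(0 <= j < n) 1 = _); last by rewrite sumr_const_nat subn0.
apply: eq_big_nat => j /andP[_ jn]; rewrite mul1r (lt_le_trans tL)//.
by apply: max_len_mono => //; exact: ltnW.
Qed.

(** A split inside a hereditary region keeps all [b] pieces there, which is [b - 1] more gaps. *)
Lemma splits_count I t n (v : nat -> V) : hered I -> (forall i, unitv (v i)) ->
  (b - 1)%:R * splits I t n v <= region_sum v I (fun=> 1) n.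
Proof.
move=> hI vu; have := region_sum_ge vu hI (H := fun=> 1) (fun _ _ => ler01) (leq0n n).
apply: le_trans.
apply: (@le_trans _ _ (\sum_(0 <= j < n) (I (gap v j))%:R * (b - 1)%:R)); last first.
  rewrite [leLHS](_ : _ = \sum_(0 <= j < n) (I (gap v j))%:R * (\sum_(l <- one_split (v j)) 1 - 1)).
    by rewrite lerDr; apply: sumr_ge0 => p _.
  apply: eq_bigr => j _; rewrite big_const_seq count_predT (size_one_split _ b2) iter_addr_0.
  by rewrite b_pred addrK.
rewrite splitsE mulr_sumr; apply: ler_sum => j _; rewrite mulrCA ler_wpM2l//.
by case: (_ < _)%R; rewrite ?mulr1 ?mulr0.
Qed.

Variable M : R.
Hypothesis M_ge0 : 0 <= M.
Hypothesis rateM : renewal_rate P S unit_weight M.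

(** If the largest length still exceeded [t = theta / n], all [n] splits would have been above the
    cut-off, and [t] times their number would be [theta], beyond the upper limit [M]. *)
Lemma len_upper (theta : R) : M < theta -> whp P (fun n w => len (path X w) n <= theta / n%:R).
Proof.
move=> Mt; have th0 : 0 < theta by exact: le_lt_trans M_ge0 Mt.
have r0 : 0 < (theta - M) / 2 by lra.
have := population_upper uw_nd uw01 mpredT M_ge0 rateM (fun _ => erefl) th0 r0.
apply: (whp_imp (N := 1)) => n w n1 H; rewrite leNgt; apply/negP => tL.
move: H; rewrite -/(splits _ _ _ _) (splits_all (path_unit X01 w) tL).
have nR : 0 < n%:R :> R by rewrite ltr0n.
have := potential_ge0 predT (theta / n%:R) n (path X w) uw_nd uw01.
move: (potential _ _ _ _ _) => q q0.
rewrite mulrDr divfK ?gt_eqF//.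
have : 0 <= theta / n%:R * q by rewrite mulr_ge0// divr_ge0// ltW.
lra.
Qed.

(** If the largest length were already at most [t], the potential would be 0, and about [M / t]
    splits would be needed, more than the [n] available. *)
Lemma len_lower (theta : R) : 0 < theta -> theta < M -> whp P (fun n w => theta / n%:R < len (path X w) n).
Proof.
move=> th0 tM.
have r0 : 0 < (M - theta) / 2 by lra.
have Hmu n w : 1 - len (path X w) n <= region_sum (path X w) predT id n.
  by rewrite (region_mass1 (path_unit X01 w)) lerBlDr lerDl max_len_ge0.
have := population_lower uw_nd uw01 mpredT (@heredT R) M_ge0 rateM th0 r0 Hmu.
apply: (whp_imp (N := 1)) => n w n1 H; rewrite ltNge; apply/negP => tL.
have nR : 0 < n%:R :> R by rewrite ltr0n.
have tn : 0 < theta / n%:R by rewrite divr_gt0.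
move: H; rewrite -/(splits _ _ _ _) (potential0 predT uw_nd uw01 tn (path_unit X01 w) tL) add0r.
have : theta / n%:R * splits predT (theta / n%:R) n (path X w) <= theta / n%:R * n%:R.
  by rewrite ler_pM2l// splits_le.
rewrite divfK ?gt_eqF//; lra.
Qed.

(** The [n * (b - 1) + 1] spacings have total length 1, so [n * L_n] stays away from 0. *)
Lemma rate_gt0 : 0 < M.
Proof.
rewrite ltNge; apply/negP => Mle.
pose B1 : R := (b - 1)%:R; have B11 : 1 <= B1 by exact: pred_b_ge1.
have B1p : 0 < B1 by exact: lt_le_trans ltr01 B11.
have th : M < 1 / (2 * B1) by apply: le_lt_trans Mle _; rewrite divr_gt0// mulr_gt0.
have [N HN] := whp_ex (len_upper th).
pose n := maxn N 2.
have [w] := HN n (leq_maxl _ _); set v := path X w => Hw.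
have vu := path_unit X01 w; rewrite -/v in vu.
have : 1 <= len v n * (n * (b - 1)).+1%:R.
  rewrite -[leLHS](region_mass1 vu n) -(region_sum_size v n) /region_sum mulr_sumr big_seq [leRHS]big_seq.
  by apply: ler_sum => p pin; rewrite mulr1; exact: max_len_ge.
have n2 : 2 <= n%:R :> R by rewrite (ler_nat R 2) leq_maxr.
rewrite -addn1 natrD natrM -/B1 => h1.
have h2 : len v n * (n%:R * B1 + 1) <= 1 / (2 * B1) / n%:R * (n%:R * B1 + 1).
  by rewrite ler_wpM2r// addr_ge0// mulr_ge0// ltW.
have h3 : 1 / (2 * B1) / n%:R * (n%:R * B1 + 1) = 1 / 2 + 1 / (2 * (B1 * n%:R)).
  by field; rewrite !gt_eqF//; lra.
have h4 : 1 / (2 * (B1 * n%:R)) <= 1 / 4.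
  have h5 : 1 * 2 <= B1 * n%:R by rewrite ler_pM.
  by rewrite ler_pdivrMr; lra.
move: h1 h2; rewrite h3; clearbody B1; lra.
Qed.

Lemma splits_lower I (mu theta rho : R) : mpred I -> hered I -> M < theta -> 0 < rho ->
  (forall n w, mu - len (path X w) n <= region_sum (path X w) I id n) ->
  whp P (fun n w => M * mu - rho <= theta / n%:R * splits I (theta / n%:R) n (path X w)).
Proof.
move=> mI hI Mt r0 Hmu; have th0 : 0 < theta by exact: le_lt_trans M_ge0 Mt.
have h1 := population_lower uw_nd uw01 mI hI M_ge0 rateM th0 r0 Hmu.
apply: (whp_imp (N := 1) _ (whp_and h1 (len_upper Mt))) => n w n1 [H tL].
have tn : 0 < theta / n%:R by rewrite divr_gt0// ltr0n.
by move: H; rewrite (potential0 I uw_nd uw01 tn (path_unit X01 w) tL) add0r.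
Qed.

Definition left_count (y : R) n (v : nat -> V) : R := region_sum v (@left_of R y) (fun=> 1) n.

Lemma left_countE y n (v : nat -> V) : (forall i, unitv (v i)) ->
  (count (fun p => (0 <= p.1) && (p.2 <= y)) (gaps (frag_state v n)))%:R = left_count y n v.
Proof.
move=> vu; rewrite /left_count /region_sum -sum1_count natr_sum big_seq_cond [RHS]big_seq_cond.
apply: eq_bigl => p; case pin : (p \in _) => //=.
have ve := valid_frag_state vu n.
have /andP[p1 _] := gaps_mem pin.
have [s [eE _]] := valid_cons ve.
have srt : sorted <=%R (frag_state v n) by case/and3P: ve.
suff -> : 0 <= p.1 by [].
move: p1 srt; rewrite eE in_cons => /predU1P[->//|ps] /= srt.
exact: (allP (order_path_min le_trans srt)).
Qed.

Lemma left_right_count y n (v : nat -> V) : (forall i, unitv (v i)) ->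
  left_count y n v + region_sum v (right_of y) (fun=> 1) n <= (n * (b - 1)).+1%:R.
Proof.
move=> vu; rewrite -(region_sum_size v) /left_count /region_sum.
have srt : sorted <=%R (frag_state v n) by case/and3P: (valid_frag_state vu n).
rewrite big_mkcond /= [X in _ + X]big_mkcond /= -big_split /= big_seq [leRHS]big_seq.
apply: ler_sum => p pin; have p12 := gaps_le srt pin.
rewrite /left_of /right_of; have [h1|h1] := leP p.2 y; have [h2|h2] := ltP y p.1; rewrite ?addr0 ?add0r//.
by have := lt_le_trans h2 (le_trans p12 h1); rewrite ltxx.
Qed.

(** [splits_lower] bounds the counts on both sides of [y] from below; as their sum is at most the total
number of spacings, both bounds are sharp. *)
Lemma left_count_limit (y eps : R) : 0 <= y <= 1 -> 0 < eps ->
  whp P (fun n w => `|len (path X w) n * left_count y n (path X w) - (b - 1)%:R * M * y| <= eps).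
Proof.
move=> y01 eps0; have /andP[y0 y1] := y01.
pose B1 : R := (b - 1)%:R; have B11 : 1 <= B1 by exact: pred_b_ge1.
have B1p : 0 < B1 by exact: lt_le_trans ltr01 B11.
have M0 := rate_gt0.
(* [M / 2] keeps [M - e] positive. The total error is at most [5 * (B1 * e)] from below and
   [2 * (B1 * e) + eps / 4] from above. *)
pose e := Num.min (M / 2) (eps / (8 * B1)).
have e0 : 0 < e by rewrite lt_min !divr_gt0// mulr_gt0.
have eM : e <= M / 2 by rewrite ge_min lexx.
have eB : B1 * e <= eps / 8.
  have : e <= eps / (8 * B1) by rewrite ge_min lexx orbT.
  by rewrite ler_pdivlMr ?mulr_gt0//; lra.
have Mt : M < M + e by lra.
have tM : M - e < M by lra.
have t0 : 0 < M - e by lra.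
have HL n w : y - len (path X w) n <= region_sum (path X w) (left_of y) id n.
  exact: (region_left_mass (path_unit X01 w)).
have HR n w : 1 - y - len (path X w) n <= region_sum (path X w) (right_of y) id n.
  exact: (region_right_mass (path_unit X01 w)).
have e4 : 0 < eps / 4 by rewrite divr_gt0.
have [N HN] := eventually_small (M + e) e4.
apply: (whp_imp (N := maxn 1 N) _ (whp_and (whp_and (len_upper Mt) (len_lower t0 tM))
  (whp_and (splits_lower (@mpred_left y) (@hered_left R y) Mt e0 HL)
           (splits_lower (@mpred_right y) (@hered_right R y) Mt e0 HR)))) => n w.
rewrite geq_max => /andP[n1 nN] [[L1 L2] [S1 S2]].
have vu := path_unit X01 w; set v := path X w in L1 L2 S1 S2 vu *.
have nR : 0 < n%:R :> R by rewrite ltr0n.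
set tp := (M + e) / n%:R in L1 S1 S2.
have tp0 : 0 < tp by rewrite divr_gt0//; lra.
have C1 := splits_count tp n (@hered_left R y) vu; rewrite -/(left_count y n v) in C1.
have C2 := splits_count tp n (@hered_right R y) vu.
have C3 := left_right_count y n vu.
set Y := left_count y n v in C1 C3 *; set Z := region_sum _ _ _ _ in C2 C3.
set L := len v n in L1 L2 *.
set s1 := splits (left_of y) tp n v in S1 C1; set s2 := splits (right_of y) tp n v in S2 C2.
have Y0 : 0 <= Y by apply: sumr_ge0.
have tpY : B1 * (M * y - e) <= tp * Y.
  have a1 : tp * (B1 * s1) <= tp * Y by rewrite ler_pM2l.
  have a2 : B1 * (M * y - e) <= B1 * (tp * s1) by rewrite ler_pM2l.
  by move: a1 a2; rewrite mulrCA; lra.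
have tpZ : B1 * (M * (1 - y) - e) <= tp * Z.
  have a1 : tp * (B1 * s2) <= tp * Z by rewrite ler_pM2l.
  have a2 : B1 * (M * (1 - y) - e) <= B1 * (tp * s2) by rewrite ler_pM2l.
  by move: a1 a2; rewrite mulrCA; lra.
have tpN : tp * (Y + Z) <= (M + e) * B1 + eps / 4.
  have a1 : tp * (Y + Z) <= tp * (n * (b - 1)).+1%:R by rewrite ler_pM2l.
  apply: le_trans a1 _; rewrite -addn1 natrD natrM mulrDr mulr1 -/B1.
  have -> : tp * (n%:R * B1) = (M + e) * B1 by rewrite /tp mulrA divfK// gt_eqF.
  by rewrite lerD2l /tp ler_pdivrMr// HN.
have LY : L * Y <= tp * Y by rewrite ler_wpM2r.
have LY2 : tp * Y - 2 * e / n%:R * Y <= L * Y.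
  rewrite -mulrBl ler_wpM2r//; apply: le_trans (ltW L2).
  by rewrite /tp le_eqVlt; apply/orP; left; apply/eqP; field; rewrite gt_eqF.
have LY3 : 2 * e / n%:R * Y <= 4 * e * B1.
  have YN : Y <= n%:R * B1 + 1.
    have Z0 : 0 <= Z by apply: sumr_ge0.
    by move: C3; rewrite -addn1 natrD natrM -/B1; lra.
  have : 2 * e / n%:R * Y <= 2 * e / n%:R * (n%:R * B1 + 1).
    by rewrite ler_wpM2l// divr_ge0// ?mulr_ge0// ltW.
  move=> /le_trans; apply; rewrite mulrDr mulr1.
  have -> : 2 * e / n%:R * (n%:R * B1) = 2 * e * B1 by rewrite mulrA divfK// gt_eqF.
  have : 2 * e / n%:R <= 2 * e * 1.
    by rewrite ler_wpM2l ?mulr_ge0 ?(ltW e0)// invf_le1// ler1n.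
  have : 2 * e * 1 <= 2 * e * B1 by rewrite ler_wpM2l ?mulr_ge0 ?(ltW e0).
  lra.
rewrite ler_norml -/B1; move: tpY tpZ tpN; rewrite !mulrBr mulrDr !mulrDl mulr1 !mulrA; move: LY LY2 LY3 eB.
rewrite [4 * e * B1]mulrAC [e * B1]mulrC [M * B1]mulrC [4 * B1 * e](_ : _ = 4 * (B1 * e)); last by ring.
move=> LY LY2 LY3 eB tpY tpZ tpN; apply/andP; split; lra.
Qed.

Theorem mean_spacing_whp (y eps : R) : 0 < y <= 1 -> 0 < eps ->
  whp P (fun n w => `|mean_spacing (path X w) n y - ((b - 1)%:R * M)^-1| <= eps).
Proof.
move=> /andP[y0 y1] eps0.
pose z0 := (b - 1)%:R * M * y.
have M0 := rate_gt0; have bp : 0 < (b - 1)%:R :> R by exact: lt_le_trans ltr01 pred_b_ge1.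
have z00 : 0 < z0 by rewrite !mulr_gt0.
(* The first bound keeps [z >= z0 / 2], after which the inverses differ by at most [2 / z0 ^+ 2]
   times [|z - z0|]. *)
pose e := Num.min (z0 / 2) (eps * z0 ^+ 2 / 2).
have e0 : 0 < e by rewrite lt_min !divr_gt0// mulr_gt0// exprn_gt0.
have y01 : 0 <= y <= 1 by rewrite (ltW y0).
apply: (whp_imp (N := 0) _ (left_count_limit y01 e0)) => n w _.
rewrite /mean_spacing (left_countE y n (path_unit X01 w)) -/z0.
set z := _ * left_count _ _ _ => hz.
have hz1 : `|z - z0| <= z0 / 2 by apply: le_trans hz _; rewrite ge_min lexx.
have hz2 : `|z - z0| <= eps * z0 ^+ 2 / 2 by apply: le_trans hz _; rewrite ge_min lexx orbT.
have zz : z0 / 2 <= z by move: hz1; rewrite ler_norml => /andP[]; lra.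
have zp : 0 < z by lra.
have -> : ((b - 1)%:R * M)^-1 = y / z0.
  by rewrite /z0; field; rewrite !gt_eqF.
rewrite -mulrBr (_ : z^-1 - z0^-1 = (z0 - z) / (z * z0)); last by field; rewrite !gt_eqF.
rewrite normrM (gtr0_norm y0) normrM normfV (gtr0_norm (mulr_gt0 zp z00)) distrC.
apply: (@le_trans _ _ (`|z - z0| / (z * z0))).
  by rewrite ler_piMl// divr_ge0// ltW// mulr_gt0.
rewrite ler_pdivrMr; last exact: mulr_gt0.
apply: le_trans hz2 _; rewrite -mulrA ler_pM2l//.
by rewrite expr2 mulrAC ler_pM2r.
Qed.

(** * The limit of the spacing distribution *)

Let M0 : 0 < M. Proof. exact: rate_gt0. Qed.

Let b_ge1 : 1 <= b%:R :> R. Proof. by rewrite (ler_nat R 1); lia. Qed.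

Definition weight (x r : R) : R := (x < r)%R%:R.

Lemma weight_nd x : {homo weight x : y z / y <= z}.
Proof.
move=> y z yz; rewrite /weight; have [xy|//] := ltP x y.
by rewrite (lt_le_trans xy yz).
Qed.

Lemma weight01 x r : 0 <= weight x r <= 1.
Proof. by rewrite /weight; case: (_ < _)%R; rewrite ?lexx ?ler01. Qed.

Lemma rate_exists : {r : R -> R | forall x, 0 <= r x /\ renewal_rate P S (weight x) (r x)}.
Proof.
have H x : exists m, 0 <= m /\ renewal_rate P S (weight x) m.
  have [m m0 Hm] := renewal_limit mS sizeS sumS S01 delta0 density (@weight_nd x) (weight01 x).
  by exists m.
by have [r Hr] := choice H; exists r.
Qed.

Definition rate : R -> R := proj1_sig rate_exists.

Lemma rateP x : 0 <= rate x /\ renewal_rate P S (weight x) (rate x).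
Proof. exact: (proj2_sig rate_exists). Qed.

Lemma rate_compare x x' omega : 0 <= omega ->
  (forall r, 1 < r -> ES P S (fun l => weight x' (r * l)) <= ES P S (fun l => weight x (r * l)) + omega) ->
  rate x' <= rate x + omega / kap.
Proof.
move=> om0 H; have [_ r1] := rateP x; have [_ r2] := rateP x'.
exact: (renewal_rate_compare mS sizeS sumS S01 delta0 density (@weight_nd x) (weight01 x) (@weight_nd x') (weight01 x') om0 H r1 r2).
Qed.

Lemma weight_regular x r : 0 <= r -> regular (fun l => weight x (r * l)).
Proof. by move=> r0; apply: regular_scale => //; exact: weight_nd. Qed.

Lemma rate_antitone x x' : x <= x' -> rate x' <= rate x.
Proof.
move=> xx; rewrite -[leRHS]addr0 -(mul0r kap^-1); apply: rate_compare => // r r1.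
have r0 : 0 <= r by lra.
rewrite addr0; apply: (ES_le P mS sizeS S01); [exact: weight_regular..|] => l _.
rewrite /weight; have [h|//] := ltP x' (r * l); first by rewrite (le_lt_trans xx h).
Qed.

Definition gt_count s n (v : nat -> V) : R := region_sum v predT (fun l => (s < l)%R%:R) n.

Lemma gt_count_antitone s s' n v : s <= s' -> gt_count s' n v <= gt_count s n v.
Proof.
move=> ss; apply: ler_sum => p _; have [h|//] := ltP s' (p.2 - p.1).
by rewrite (le_lt_trans ss h).
Qed.

Lemma gt_count_created x t n (v : nat -> V) : 0 < t -> 0 <= x <= 1 -> (forall i, unitv (v i)) ->
  `|gt_count (x * t) n v - (created (weight x) predT t 0 n v - splits predT t n v)|
  <= 1 + b%:R * (n%:R - splits predT t n v).
Proof.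
move=> t0 /andP[x0 x1] vu.
rewrite /gt_count (region_sum_eqT vu _ (leq0n n)).
set H0 := region_sum _ _ _ 0.
have H01 : `|H0| <= 1.
  rewrite /H0 /region_sum /= /gaps /= big_cons big_nil addr0 /=.
  by case: (_ < _)%R; rewrite ?normr1 ?normr0.
rewrite (splitsE) /created -sumrB -addrA; apply: le_trans (ler_normD _ _) _; rewrite lerD//.
have -> : n%:R = \sum_(0 <= j < n) 1 :> R by rewrite sumr_const_nat subn0.
rewrite -!sumrB mulr_sumr; apply: le_trans (ler_norm_sum _ _ _) _.
apply: ler_sum => j _; rewrite !mul1r.
set L := len v j; have L0 : 0 <= L by exact: max_len_ge0.
case: ifPn => tL.
  rewrite subrr mulr0.
  have -> : (x * t < L)%R by apply: le_lt_trans tL; rewrite ler_piMl// ltW.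
  rewrite [X in `|X|](_ : _ = 0) ?normr0//.
  apply/eqP; rewrite subr_eq0; apply/eqP; congr (_ - _); apply: eq_bigr => l _.
  by rewrite /weight mulrAC ltr_pdivlMr.
rewrite !subr0 mulr1.
have s0 : 0 <= \sum_(l <- one_split (v j)) ((x * t < L * l)%R%:R : R) by apply: sumr_ge0.
have s1 : \sum_(l <- one_split (v j)) ((x * t < L * l)%R%:R : R) <= b%:R.
  apply: le_trans (ler_norm _) _; rewrite -[b%:R]mulr1.
  apply: ler_norm_sum_size (size_one_split _ b2) _ => l _.
  by case: (_ < _)%R; rewrite ?normr1 ?normr0.
have b1 := b_ge1.
move: s0 s1; move: (\sum_(l <- _) _) => s s0 s1.
by rewrite ler_norml; case: (_ < _)%R => /=; rewrite ?subr0; apply/andP; split; lra.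
Qed.

Lemma created_whp chi m theta rho : {homo chi : x y / x <= y} -> (forall x, 0 <= chi x <= 1) ->
  0 <= m -> renewal_rate P S chi m -> M < theta -> 0 < rho ->
  whp P (fun n w => `|theta / n%:R * created chi predT (theta / n%:R) 0 n (path X w) - m| <= rho).
Proof.
move=> nd c01 m0 rm Mt rho0; have th0 : 0 < theta by exact: lt_trans M0 Mt.
have Hmu n w : 1 - len (path X w) n <= region_sum (path X w) predT id n.
  by rewrite (region_mass1 (path_unit X01 w)) lerBlDr lerDl max_len_ge0.
have h1 := population_lower nd c01 mpredT (@heredT R) m0 rm th0 rho0 Hmu.
have h2 := population_upper nd c01 mpredT m0 rm (fun _ => erefl) th0 rho0.
have h3 := len_upper Mt.
apply: (whp_imp (N := 1) _ (whp_and (whp_and h1 h2) h3)) => n w n1 [[H1 H2] tL].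
have tn : 0 < theta / n%:R by rewrite divr_gt0// ltr0n.
move: H1 H2; rewrite (potential0 predT nd c01 tn (path_unit X01 w) tL) add0r mulr1 => H1 H2.
by rewrite ler_norml; apply/andP; split; lra.
Qed.

(** [theta > M] makes the potential vanish at time [n]. The price is the splits below the cut-off, a
    proportion of about [(theta - M) / theta], so [theta] must stay close to [M]. *)
Lemma tail_count (eps : R) : 0 < eps -> exists2 e0 : R, 0 < e0 & forall x theta : R,
  0 <= x <= 1 -> M < theta -> theta < M + e0 ->
  whp P (fun n w => `|gt_count (x * (theta / n%:R)) n (path X w) / n%:R - (rate x - M) / M| <= eps).
Proof.
move=> eps0; have Mp := M0.
have bp : 0 < b%:R :> R by exact: b_gt0.
pose B := rate 0 + M; have [r00 _] := rateP 0.
have Bp : 0 < B by rewrite /B; lra.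
(* Balances the two errors proportional to [theta - M]: the splits below the cut-off, and the
   replacement of [theta] by [M] in a quotient whose numerator is at most [B]. *)
pose e0 := eps / 4 / (b%:R / M + B / M ^+ 2).
have q0 : 0 < b%:R / M + B / M ^+ 2 by rewrite addr_gt0// divr_gt0// exprn_gt0.
have e00 : 0 < e0 by rewrite /e0 !divr_gt0.
exists e0 => // x theta x01 Mt tM.
have th0 : 0 < theta by lra.
pose rho := eps * M / (4 * (2 + b%:R)).
have rho0 : 0 < rho by rewrite /rho divr_gt0 ?mulr_gt0// addr_gt0.
have rhoE : (2 + b%:R) * rho = eps / 4 * M by rewrite /rho; field; rewrite gt_eqF//; lra.
have e0E : b%:R * e0 / M + B * e0 / M ^+ 2 = eps / 4.
  transitivity (e0 * (b%:R / M + B / M ^+ 2)); first by ring.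
  by rewrite /e0 divfK// gt_eqF.
clearbody e0 rho.
have [rx0 rx] := rateP x.
have h1 := created_whp (@weight_nd x) (weight01 x) rx0 rx Mt rho0.
have h2 := created_whp uw_nd uw01 M_ge0 rateM Mt rho0.
have eM4 : 0 < eps / 4 * M by rewrite mulr_gt0// divr_gt0.
have [N HN] := eventually_small theta eM4.
apply: (whp_imp (N := maxn 1 N) _ (whp_and h1 h2)) => n w.
rewrite geq_max => /andP[n1 nN] [H1 H2].
have nR : 0 < n%:R :> R by rewrite ltr0n.
have vu := path_unit X01 w; set v := path X w in H1 H2 vu *.
set t := theta / n%:R in H1 H2 *.
have t0 : 0 < t by rewrite divr_gt0.
have H3 := gt_count_created n t0 x01 vu.
have tn : t * n%:R = theta by rewrite /t divfK// gt_eqF.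
have t_small : t <= eps / 4 * M by rewrite /t ler_pdivrMr// HN.
rewrite -/(splits predT t n v) in H2.
clearbody t; move: H1 H2 H3; move: (gt_count _ _ _) (created _ _ _ _ _ _) (splits _ _ _ _) => G A s H1 H2 H3.
have xr : `|rate x - M| <= B.
  have [x0 _] := andP x01; have := rate_antitone x0.
  by rewrite ler_norml /B => ?; apply/andP; split; lra.
have Gn : G / n%:R = t * G / theta by rewrite -tn; field; rewrite !gt_eqF.
have tG : `|t * G - (rate x - M)| <= 2 * rho + t + b%:R * (theta - M + rho).
  have k1 : t * `|G - (A - s)| <= t * (1 + b%:R * (n%:R - s)) by rewrite ler_pM2l.
  rewrite -(gtr0_norm t0) -normrM (gtr0_norm t0) in k1.
  have k2 : t * (1 + b%:R * (n%:R - s)) = t + b%:R * (theta - t * s) by rewrite -tn; ring.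
  have k3 : b%:R * (theta - t * s) <= b%:R * (theta - M + rho).
    by rewrite ler_pM2l//; move: H2; rewrite ler_norml => /andP[]; lra.
  have k4 : `|t * G - (rate x - M)| <= `|t * (G - (A - s))| + (`|t * A - rate x| + `|t * s - M|).
    rewrite (_ : t * G - _ = t * (G - (A - s)) + ((t * A - rate x) - (t * s - M))); last by ring.
    by apply: le_trans (ler_normD _ _) _; rewrite lerD2l ler_normB.
  by move: k1 k4; rewrite k2; lra.
rewrite Gn (_ : _ - _ = (t * G - (rate x - M)) / theta - (rate x - M) * ((theta - M) / (M * theta))); last by field; rewrite !gt_eqF.
apply: le_trans (ler_normB _ _) _; rewrite normrM [X in _ + X]normrM.
have k1 : `|t * G - (rate x - M)| * `|theta^-1| <= (2 * rho + t + b%:R * (theta - M + rho)) / M.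
  apply: ler_pM => //; rewrite ger0_norm ?invr_ge0 ?(ltW th0)// lef_pV2 ?posrE// ltW//.
have k2 : `|rate x - M| * `|(theta - M) / (M * theta)| <= B * (e0 / M ^+ 2).
  have p0 : 0 < M * theta by rewrite mulr_gt0.
  have p1 : 0 <= (theta - M) / (M * theta) by rewrite divr_ge0 ?subr_ge0// ltW.
  apply: ler_pM => //; rewrite (ger0_norm p1).
  have p2 : 0 < M * M by rewrite mulr_gt0.
  rewrite expr2; apply: (@le_trans _ _ (e0 / (M * theta))).
    by rewrite ler_pM2r ?invr_gt0//; lra.
  by rewrite ler_pM2l// lef_pV2 ?posrE// ler_pM2l// ltW.
have k3 : (2 * rho + t + b%:R * (theta - M + rho)) / M <= eps / 4 + eps / 4 + b%:R * e0 / M.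
  have : b%:R * (theta - M + rho) <= b%:R * e0 + b%:R * rho by rewrite -mulrDr ler_pM2l//; lra.
  move=> k4; rewrite -(ler_pM2r Mp) divfK ?gt_eqF// !mulrDl divfK ?gt_eqF//.
  by move: rhoE; rewrite mulrDl; lra.
rewrite (mulrA B) in k2.
apply: le_trans (lerD k1 k2) _; move: k3 e0E; move: (_ / M) (_ / M ^+ 2) (b%:R * e0 / M) => p q r; lra.
Qed.

Hypothesis Fcont : forall omega : R, 0 < omega -> exists2 eta : R, 0 < eta &
  forall x y : R, 0 < x -> x < y -> y < 1 -> y - x < eta ->
    ES P S (fun l => (x <= l < y)%R%:R) <= omega.

(** The left end 0 is outside the range of the continuity hypothesis; it is reached by points [a n]
    decreasing to [x], the open interval being the union of the intervals [[a n, y)]. *)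
Lemma open_interval_mass (omega eta x y : R) : (forall x y : R, 0 < x -> x < y -> y < 1 -> y - x < eta ->
    ES P S (fun l => (x <= l < y)%R%:R) <= omega) -> 0 <= x -> x < y -> y < 1 -> y - x < eta ->
  ES P S (fun l => (x < l < y)%R%:R) <= omega.
Proof.
move=> H x0 xy y1 yx.
pose a n : R := x + (y - x) / n.+2%:R.
have yx0 : 0 < y - x by lra.
have a0 n : x < a n by rewrite /a ltrDl divr_gt0.
have ay n : a n < y.
  by rewrite /a -ltrBrDl ltr_pdivrMr// ltr_pMr// (ltr_nat R 1).
have ab n : ES P S (fun l => (a n <= l < y)%R%:R) <= omega.
  by apply: H => //; [exact: le_lt_trans (a0 n)|have := a0 n; lra].
have cv : ES P S (fun l => (a n <= l < y)%R%:R) @[n --> \oo] --> ES P S (fun l => (x < l < y)%R%:R).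
  apply: (@Ex_cvg _ _ _ P _ _ b%:R).
  - by move=> n; exact: (bm_mf (regular_bm mS sizeS S01 (regular_itv _ _))).
  - move=> n w; rewrite -[b%:R]mulr1; apply: (ler_norm_sum_size (sizeS w)) => l _.
    by case: (_ <= _ < _)%R; rewrite ?normr1 ?normr0.
  - move=> w; elim: (S w) => [|l s IH].
      by rewrite big_nil; under eq_fun do rewrite big_nil; exact: cvg_cst.
    rewrite big_cons; under eq_fun do rewrite big_cons.
    apply: cvgD => //; have [xl|lx] := ltP x l.
      have lx0 : 0 < l - x by rewrite subr_gt0.
      have [N HN] := eventually_small (y - x) lx0.
      apply: cvg_near_cst; exists N => // n /= nN.
      suff -> : a n <= l by [].
      rewrite /a -lerBrDl ler_pdivrMr//; apply: HN.
      by rewrite (leq_trans nN)// -addn2 leq_addr.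
    apply: cvg_near_cst; near=> n.
    by rewrite leNgt (le_lt_trans lx (a0 n)).
  - apply: (regular_bm mS sizeS S01); apply: (regular_bool (f := fun l => x < l < y)).
    by apply: measurable_and; exact: measurable_fun_ltr.
by apply: (@cvgr_to_le _ _ _ _ _ _ _ cv); near=> n; exact: ab.
Unshelve. all: by end_near. Qed.

(** The two weights differ only on pieces between [x' / r] and [x / r]; as [r > 1] this interval is
    shorter than [x - x'], so its mean number of pieces is at most [omega * kap], and [rate_compare]
    divides by [kap]. *)
Lemma rate_cont (omega : R) : 0 < omega -> exists2 eta : R, 0 < eta &
  forall x' x : R, 0 <= x' -> x' <= x -> x <= 1 -> x - x' < eta -> rate x' <= rate x + omega.
Proof.
move=> om0; have ok0 : 0 < omega * kap by rewrite mulr_gt0.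
have [eta eta0 H] := Fcont ok0; exists eta => // x' x x'0 x'x x1 xx.
have omE : omega = omega * kap / kap by rewrite mulfK// gt_eqF.
rewrite omE; apply: rate_compare (ltW ok0) _ => r r1.
have r0 : 0 < r by lra.
pose a := x' / r; pose c := x / r.
have a0 : 0 <= a by rewrite divr_ge0// ltW.
have ac : a <= c by rewrite ler_pM2r// invr_gt0.
have c1 : c < 1 by rewrite ltr_pdivrMr// mul1r; lra.
have ca : c - a < eta.
  rewrite /c /a -mulrBl ltr_pdivrMr//; apply: lt_le_trans xx _.
  by rewrite ler_peMr ?ltW.
(* Slightly to the right of [c], so that the open interval contains [c], yet below 1 and within
   [eta] of [a]. *)
pose y := c + Num.min ((1 - c) / 2) ((eta - (c - a)) / 2).
have m0 : 0 < Num.min ((1 - c) / 2) ((eta - (c - a)) / 2) by rewrite lt_min !divr_gt0// subr_gt0.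
have m1 : Num.min ((1 - c) / 2) ((eta - (c - a)) / 2) <= (1 - c) / 2 by rewrite ge_min lexx.
have m2 : Num.min ((1 - c) / 2) ((eta - (c - a)) / 2) <= (eta - (c - a)) / 2 by rewrite ge_min lexx orbT.
have cy : c < y by rewrite /y ltrDl.
have y1 : y < 1 by rewrite /y; lra.
have ya : y - a < eta by rewrite /y; lra.
have HI := open_interval_mass H a0 (le_lt_trans ac cy) y1 ya.
have ri : regular (fun l => (a < l < y)%R%:R).
  by apply: (regular_bool (f := fun l => a < l < y)); apply: measurable_and; exact: measurable_fun_ltr.
have rw := weight_regular x (ltW r0).
apply: (@le_trans _ _ (ES P S (fun l => weight x (r * l) + (a < l < y)%R%:R))); last first.
  by rewrite (ESD P mS sizeS S01)// lerD2l.
apply: (ES_le P mS sizeS S01); [exact: weight_regular (ltW r0)|exact: regularD|] => l _.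
have := weight01 x (r * l) => /andP[w0 _].
rewrite {1}/weight; have [h1|_] := ltP x' (r * l); last by rewrite addr_ge0.
rewrite /weight; have [_|h2] := ltP x (r * l); first by rewrite lerDl.
have al : a < l by rewrite ltr_pdivrMr// mulrC.
have ly : l < y by apply: le_lt_trans cy; rewrite ler_pdivlMr// mulrC.
by rewrite al ly add0r.
Qed.

(** Each split removes one spacing and creates in the limit [rate x / M] spacings longer than [x * L_n], out
of [b - 1] additional ones. *)
Definition limit_distr x : R := 1 - (rate x - M) / ((b - 1)%:R * M).

(** Needed for the measurability of the event in the conclusion, where [x] ranges over uncountably
    many values. *)
Lemma limit_distr_right_cont x eps : 0 <= x -> 0 < eps -> exists2 eta : R, 0 < eta &
  forall y, x <= y -> y <= 1 -> y - x < eta -> `|limit_distr x - limit_distr y| <= eps.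
Proof.
move=> x0 eps0; have Mp := M0.
have Bp : 0 < (b - 1)%:R * M by rewrite mulr_gt0//; exact: (lt_le_trans ltr01 pred_b_ge1).
have om0 : 0 < eps * ((b - 1)%:R * M) by rewrite mulr_gt0.
have [eta eta0 H] := rate_cont om0; exists eta => // y xy y1 yx.
have h1 := H x y x0 xy y1 yx; have h2 := rate_antitone xy.
have -> : limit_distr x - limit_distr y = (rate y - rate x) / ((b - 1)%:R * M).
  by rewrite /limit_distr; move: ((b - 1)%:R * M) => z; ring.
rewrite normrM normfV (gtr0_norm Bp) ler_pdivrMr//.
by rewrite ler_norml; move: h1 h2 om0; move: (eps * _) => z; move=> *; apply/andP; split; lra.
Qed.

Lemma grid_cell (q : nat) (x : R) : 0 <= x -> x <= q.+1%:R ->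
  exists2 i, (i < q.+1)%N & i%:R <= x <= i.+1%:R.
Proof.
move=> x0; elim: q => [|q IH] xq; first by exists 0%N => //; rewrite x0.
have [h|h] := leP x q.+1%:R; first by have [i iq hi] := IH h; exists i => //; rewrite ltnS ltnW.
by exists q.+1 => //; rewrite (ltW h) xq.
Qed.

Lemma gt_count_whp eps : 0 < eps -> whp P (fun n w => forall x, 0 <= x <= 1 ->
  `|gt_count (x * len (path X w) n) n (path X w) / n%:R - (rate x - M) / M| <= eps).
Proof.
move=> eps0; have Mp := M0.
have e2 : 0 < eps / 2 by rewrite divr_gt0.
have om0 : 0 < eps / 2 * M by rewrite mulr_gt0.
have [eta eta0 Heta] := rate_cont om0.
have [e0 e00 Htail] := tail_count e2.
have eta2 : 0 < eta / 2 by rewrite divr_gt0.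
have [q Hq] := eventually_small 1 eta2.
have {Hq} qE : 1 / q.+1%:R <= eta / 2 by rewrite ler_pdivrMr// Hq.
(* The three bounds make [tp] admissible in [tail_count], keep [tm] positive, and give
   [1 - s < eta / 2]. *)
pose e := Num.min (e0 / 2) (Num.min (M / 2) (eta * M / 4 / 2)).
have ep : 0 < e by rewrite !lt_min !divr_gt0// mulr_gt0.
have ee0 : e < e0.
  by apply: (@le_lt_trans _ _ (e0 / 2)); [rewrite ge_min lexx|lra].
have eM : e <= M / 2 by rewrite !ge_min lexx /= orbT.
have eeta : e <= eta * M / 4 / 2 by rewrite !ge_min lexx /= !orbT.
clearbody e.
pose tp := M + e; pose tm := M - e.
have tp0 : 0 < tp by rewrite /tp; lra.
have tm0 : 0 < tm by rewrite /tm; lra.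
(* [tail_count] accepts only cut-offs above [M / n], so the lower estimate [tm / n] of the largest
   length is written as [s] times [tp / n], and [s] is absorbed into the threshold. *)
pose s := tm / tp.
have s0 : 0 < s by rewrite divr_gt0.
have s1 : s < 1 by rewrite ltr_pdivrMr// mul1r /tm /tp; lra.
have s_eta : 1 - s < eta / 2.
  have -> : 1 - s = 2 * e / tp by rewrite /s /tm /tp; field; rewrite gt_eqF//; lra.
  rewrite ltr_pdivrMr// /tp.
  have : eta / 2 * M < eta / 2 * (M + e) by rewrite ltr_pM2l// ltrDl.
  lra.
pose g i : R := i%:R / q.+1%:R.
have qR : 0 < q.+1%:R :> R by rewrite ltr0n.
have g01 i : (i <= q.+1)%N -> 0 <= g i <= 1.
  by move=> iq; rewrite divr_ge0//= ler_pdivrMr// mul1r ler_nat.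
have gs01 i : (i <= q.+1)%N -> 0 <= g i * s <= 1.
  move=> /g01 /andP[g0 g1]; rewrite mulr_ge0 ?(ltW s0)//=.
  by apply: le_trans g1; rewrite ler_piMr// ltW.
have Mtp : M < tp by rewrite /tp; lra.
have tpe : tp < M + e0 by rewrite /tp; lra.
have tmM : tm < M by rewrite /tm; lra.
have H1 i : (i < q.+2)%N -> whp P (fun n w => `|gt_count (g i * (tp / n%:R)) n (path X w) / n%:R - (rate (g i) - M) / M| <= eps / 2).
  by move=> iq; apply: Htail => //; exact: g01.
have H2 i : (i < q.+2)%N -> whp P (fun n w => `|gt_count (g i * s * (tp / n%:R)) n (path X w) / n%:R - (rate (g i * s) - M) / M| <= eps / 2).
  by move=> iq; apply: Htail => //; exact: gs01.
have h3 := len_upper Mtp.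
have h4 := len_lower tm0 tmM.
apply: (whp_imp (N := 1) _ (whp_and (whp_and h3 h4) (whp_and (whp_all H1) (whp_all H2)))) => n w n1.
clear H1 H2 h3 h4 Htail.
move=> [[L1 L2] [G1 G2]] x /andP[x0 x1].
have nR : 0 < n%:R :> R by rewrite ltr0n.
set v := path X w in L1 L2 G1 G2 *; set L := len v n in L1 L2 *.
have [i iq /andP[ix xi]] : exists2 i, (i < q.+1)%N & i%:R <= x * q.+1%:R <= i.+1%:R.
  by apply: grid_cell; [rewrite mulr_ge0// ltW|rewrite ler_piMl// ltW].
have gx : g i <= x by rewrite ler_pdivrMr.
have xg : x <= g i.+1 by rewrite ler_pdivlMr.
have gg : g i.+1 - g i <= eta / 2.
  by rewrite /g -mulrBl -(natrB _ (leqnSn i)) subSnn.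
have iq2 : (i < q.+2)%N by rewrite ltnS ltnW.
have := G1 i.+1 iq; have := G2 i iq2; rewrite !ler_norml => /andP[_ K2] /andP[K1 _].
have tpn : 0 < tp / n%:R by rewrite divr_gt0.
have L0 : 0 <= L by exact: max_len_ge0.
have /andP[gi0 gi1] := g01 i (ltnW iq).
(* The count at the random threshold is squeezed between counts at two deterministic ones, from the
   grid points on either side of [x] and the bounds on the largest length. *)
have C1 : gt_count (g i.+1 * (tp / n%:R)) n v / n%:R <= gt_count (x * L) n v / n%:R.
  rewrite ler_pM2r ?invr_gt0//; apply: gt_count_antitone.
  by apply: ler_pM => //; rewrite ltW.
have C2 : gt_count (x * L) n v / n%:R <= gt_count (g i * s * (tp / n%:R)) n v / n%:R.
  rewrite ler_pM2r ?invr_gt0//; apply: gt_count_antitone.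
  rewrite -mulrA (_ : s * (tp / n%:R) = tm / n%:R); last by rewrite /s mulrA divfK// gt_eqF.
  apply: ler_pM => //; first by rewrite divr_ge0// ltW.
  exact: ltW.
have R1 : rate x <= rate (g i.+1) + eps / 2 * M.
  apply: Heta => //; first by have /andP[] := g01 _ iq.
  lra.
have R2 : rate (g i * s) <= rate x + eps / 2 * M.
  apply: Heta => //.
  - by rewrite mulr_ge0// ltW.
  - by apply: le_trans gx; rewrite ler_piMr// ltW.
  - have : g i * (1 - s) <= 1 - s by rewrite ler_piMl// subr_ge0 ltW.
    by rewrite mulrBr mulr1; lra.
have R1' : (rate x - M) / M <= (rate (g i.+1) - M) / M + eps / 2.
  by rewrite -(ler_pM2r Mp) [leRHS]mulrDl !divfK ?gt_eqF//; lra.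
have R2' : (rate (g i * s) - M) / M <= (rate x - M) / M + eps / 2.
  by rewrite -(ler_pM2r Mp) [leRHS]mulrDl !divfK ?gt_eqF//; lra.
move: (gt_count (g i.+1 * _) n v / _) (gt_count (x * L) n v / _) (gt_count (g i * s * _) n v / _) C1 C2 K1 K2.
move: ((rate x - M) / M) ((rate (g i.+1) - M) / M) ((rate (g i * s) - M) / M) R1' R2' => p1 p2 p3 h1 h2 p4 p5 p6 *.
by apply/andP; split; lra.
Qed.

Theorem spacing_distr_whp eps : 0 < eps -> whp P (fun n w => forall x, 0 <= x <= 1 ->
  `|spacing_distr (path X w) n x - limit_distr x| <= eps).
Proof.
move=> eps0; have Mp := M0.
have e2 : 0 < eps / 2 by rewrite divr_gt0.
pose B1 : R := (b - 1)%:R; have B11 : 1 <= B1 by exact: pred_b_ge1.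
have B1p : 0 < B1 by exact: lt_le_trans ltr01 B11.
pose B := (rate 0 + M) / M.
have [N HN] := eventually_small B e2.
apply: (whp_imp (N := maxn 1 N) _ (gt_count_whp e2)) => n w.
rewrite geq_max => /andP[n1 nN] H x x01; have := H x x01.
have nR : 0 < n%:R :> R by rewrite ltr0n.
set v := path X w; set G := gt_count _ _ _; set qx := (rate x - M) / M => Hg.
pose N1 : R := (n * (b - 1)).+1%:R.
have N1E : N1 = n%:R * B1 + 1 by rewrite /N1 -addn1 natrD natrM.
have N1p : 0 < N1 by rewrite ltr0n.
have sE : spacing_distr v n x = 1 - G / N1.
  rewrite /spacing_distr -/N1 /gap_lengths count_map.
  have cE : (count (preim (fun p => p.2 - p.1) (fun l => l <= x * len v n)) (gaps (frag_state v n)))%:R =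
      \sum_(p <- gaps (frag_state v n)) (p.2 - p.1 <= x * len v n)%R%:R :> R.
    by rewrite -sum1_count natr_sum big_mkcond; apply: eq_bigr => p _ /=; case: ifP.
  have GE : G = \sum_(p <- gaps (frag_state v n)) (1 - (p.2 - p.1 <= x * len v n)%R%:R).
    by apply: eq_bigr => p _; rewrite ltNge; case: (_ <= _)%R; rewrite /= ?subr0 ?subrr.
  have NE : N1 = \sum_(p <- gaps (frag_state v n)) 1 by rewrite /N1 -(region_sum_size v n).
  rewrite cE (_ : \sum_(p <- _) _ = N1 - G); last by rewrite GE sumrB -NE subKr.
  by rewrite mulrBl divff ?gt_eqF.
have qB : `|qx| <= B.
  have /andP[x0 _] := x01; have h1 := rate_antitone x0.
  have [h2 _] := rateP x; have [h3 _] := rateP 0.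
  rewrite /qx /B normrM normfV (gtr0_norm Mp) ler_pM2r ?invr_gt0//.
  by rewrite ler_norml; apply/andP; split; lra.
have -> : spacing_distr v n x - limit_distr x = qx / B1 - G / N1.
  rewrite sE /limit_distr -/B1 /qx invfM mulrCA mulrC [(_ - _) * _ * _]mulrAC; ring.
(* The first term, due to the [+ 1] in the number of spacings, is bounded by [B] uniformly in [x];
   the second is the error of [G / n]. *)
clearbody qx; rewrite (_ : qx / B1 - G / N1 = (qx - (G / n%:R - qx) * (n%:R * B1)) / (N1 * B1)); last first.
  by rewrite N1E; field; rewrite !gt_eqF// -N1E.
have NB : 0 < N1 * B1 by rewrite mulr_gt0.
rewrite normrM normfV (gtr0_norm NB) ler_pdivrMr//.
apply: le_trans (ler_normB _ _) _; rewrite normrM (gtr0_norm (mulr_gt0 nR B1p)).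
have k0 := ler0n R n.
have k1 : `|G / n%:R - qx| * (n%:R * B1) <= eps / 2 * (n%:R * B1) by rewrite ler_pM2r// mulr_gt0.
have k2 : eps / 2 * n%:R <= eps / 2 * (n%:R * B1) by rewrite ler_pM2l// ler_peMr// ltW.
have k3 : B <= eps / 2 * n%:R by exact: HN.
have k4 : eps * (n%:R * B1) <= eps * (N1 * B1).
  rewrite ler_pM2l// ler_pM2r// N1E; apply: le_trans (_ : n%:R * B1 <= _); last by rewrite lerDl.
  by rewrite ler_peMr// ltW.
lra.
Qed.

End Fragmentation.

(** * Almost sure hypotheses and measurability of the events *)

Section NullSets.
Variable R : realType.
Context d (T : measurableType d) (P : probability T R).

Lemma measure_eq_off_null (A A' N : set T) : measurable A -> measurable A' -> measurable N -> P N = 0%E ->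
  (forall w, ~ N w -> A w <-> A' w) -> P A = P A'.
Proof.
move=> mA mA' mN N0 AA'; rewrite -(measureU0 mA mN N0) -(measureU0 mA' mN N0).
congr (P _); apply/seteqP; split => w /= [h|h]; try (by right);
  by have [|nw] := pselect (N w); [right|left; apply/(AA' w nw)].
Qed.

Lemma whp_off_null (N : set T) (Q Q' : nat -> T -> Prop) : measurable N -> P N = 0%E ->
  (forall n w, ~ N w -> Q n w -> Q' n w) -> whp P Q -> whp P Q'.
Proof.
move=> mN N0 QQ h p p0; have [n0 H] := h p p0; exists n0 => n nn.
have [B [mB PB HB]] := H n nn; exists (B `|` N); split.
- exact: measurableU.
- by rewrite (measureU0 mB mN N0).
- by move=> w /not_orP[nB nN]; apply: QQ => //; exact: HB.
Qed.

End NullSets.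

Section Clipping.
Variable R : realType.
Context d (T : measurableType d) (P : probability T R).
Variables (b : nat) (X : nat -> 'I_(b - 1) -> T -> R).
Hypothesis mX : forall k j, measurable_fun setT (X k j).
Hypothesis X01 : forall k j, P [set w | 0 < X k j w < 1] = 1%E.
Hypothesis indX : forall (n : nat) (A : nat -> 'I_(b - 1) -> set R),
  (forall k j, measurable (A k j)) ->
  P (\bigcap_(k in [set k | (k < n)%N]) \bigcap_(j in [set: 'I_(b - 1)]) (X k j @^-1` A k j))
  = (\prod_(k < n) P (\bigcap_(j in [set: 'I_(b - 1)]) (X 0%N j @^-1` A k j)))%E.

(** The split positions lie in (0,1) only almost surely; [clipped] modifies them on a null set so that
the pathwise arguments apply. *)
Definition clipped k j w : R := clip (X k j w).

Lemma measurable_clipped k j : measurable_fun setT (clipped k j).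
Proof. by apply: measurableT_comp (@measurable_clip R) _; exact: mX. Qed.

Lemma clipped_unit k j w : 0 < clipped k j w < 1.
Proof. exact: clip_unit. Qed.

(** The inner union runs over all naturals, with empty sets from [b - 1] on, so that countable
    unions of null sets apply. *)
Definition degenerate : set T := \bigcup_k \bigcup_i
  [set w | exists2 j : 'I_(b - 1), j = i :> nat & ~ (0 < X k j w < 1)].

Let degenerate_coord k i : measurable [set w | exists2 j : 'I_(b - 1), j = i :> nat & ~ (0 < X k j w < 1)] /\
  P [set w | exists2 j : 'I_(b - 1), j = i :> nat & ~ (0 < X k j w < 1)] = 0%E.
Proof.
have [ib|bi] := ltnP i (b - 1); last first.
  rewrite (_ : [set w | _] = set0); first by split; [exact: measurable0|exact: measure0].
  apply/seteqP; split => // w [j ji _].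
  by have := ltn_ord j; rewrite ji ltnNge bi.
have mA : measurable [set w | 0 < X k (Ordinal ib) w < 1].
  by apply: mset_bool; apply: measurable_and; exact: measurable_fun_ltr.
rewrite (_ : [set w | _] = ~` [set w | 0 < X k (Ordinal ib) w < 1]).
  by split; [exact: measurableC|rewrite probability_setC// X01 subee].
apply/seteqP; split => w /=; last by move=> h; exists (Ordinal ib).
by move=> [j ji]; rewrite (_ : j = Ordinal ib)//; exact: val_inj.
Qed.

Lemma measurable_degenerate : measurable degenerate.
Proof.
apply: bigcup_measurable => k _; apply: bigcup_measurable => i _.
exact: (degenerate_coord k i).1.
Qed.

Lemma degenerate_null : P degenerate = 0%E.
Proof.
apply: measure_negligible; first exact: measurable_degenerate.
apply: negligible_bigcup => k; apply: negligible_bigcup => i.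
by have [mA A0] := degenerate_coord k i; eexists; split; [exact: mA|exact: A0|].
Qed.

Lemma path_clipped w : ~ degenerate w -> path clipped w = path X w.
Proof.
move=> nw; apply/funext => k; apply/funext => j; apply: clip_id.
by apply: contrapT => h; apply: nw; exists k => //; exists (nat_of_ord j) => //; exists j.
Qed.

Lemma clipped_indep (n : nat) (A : nat -> 'I_(b - 1) -> set R) : (forall k j, measurable (A k j)) ->
  P (\bigcap_(k in [set k | (k < n)%N]) \bigcap_(j in [set: 'I_(b - 1)]) (clipped k j @^-1` A k j))
  = (\prod_(k < n) P (\bigcap_(j in [set: 'I_(b - 1)]) (clipped 0%N j @^-1` A k j)))%E.
Proof.
move=> mA.
have mpre (Y : nat -> 'I_(b - 1) -> T -> R) k i : (forall k j, measurable_fun setT (Y k j)) ->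
    measurable (\bigcap_(j in [set: 'I_(b - 1)]) (Y i j @^-1` A k j)).
  move=> mY; apply: fin_bigcap_measurable => // j _.
  by rewrite -[X in measurable X]setTI; exact: mY.
have mpre' (Y : nat -> 'I_(b - 1) -> T -> R) : (forall k j, measurable_fun setT (Y k j)) ->
    measurable (\bigcap_(k in [set k | (k < n)%N]) \bigcap_(j in [set: 'I_(b - 1)]) (Y k j @^-1` A k j)).
  by move=> mY; apply: fin_bigcap_measurable => [|k _]; [exact: finite_II|exact: mpre].
have cX w k j : ~ degenerate w -> clipped k j w = X k j w.
  by move=> /path_clipped /(congr1 (fun v => v k j)).
transitivity (P (\bigcap_(k in [set k | (k < n)%N]) \bigcap_(j in [set: 'I_(b - 1)]) (X k j @^-1` A k j))).
  apply: (measure_eq_off_null _ _ measurable_degenerate degenerate_null).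
  - exact: mpre' measurable_clipped.
  - exact: mpre'.
  - by move=> w nw; split=> H k kn j _; have := H k kn j I => /=; rewrite cX.
rewrite indX//; apply: eq_bigr => k _.
apply: (measure_eq_off_null _ _ measurable_degenerate degenerate_null).
- exact: mpre.
- exact: mpre measurable_clipped.
- by move=> w nw; split=> H j _; have := H j I => /=; rewrite cX.
Qed.

Hypothesis b2 : (2 <= b)%N.

Let F (x : R) : R := fine (\int[P]_w ((count (fun l => l < x) (one_split (fun j => X 0%N j w)))%:R)%:E).

Lemma count_lt_sum (x : R) (s : seq R) : (count (fun l => l < x) s)%:R = \sum_(l <- s) (l < x)%R%:R :> R.
Proof. by rewrite -sum1_count natr_sum big_mkcond; apply: eq_bigr => l _; case: ifP. Qed.

Let mS : mlist (first_split clipped). Proof. by apply: mlist_one_split => j; exact: measurable_clipped. Qed.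
Let sizeS w : size (first_split clipped w) = b. Proof. exact: size_one_split. Qed.
Let S01 w l : l \in first_split clipped w -> 0 <= l <= 1.
Proof. by move=> lS; rewrite (one_split_ge0 lS) (one_split_le1 (path_unit clipped_unit w 0) lS). Qed.

Lemma expected_countE x : F x = ES P (first_split clipped) (fun l => (l < x)%R%:R).
Proof.
rewrite /F /ES /Ex /Rintegral; congr fine.
have mY (Y : nat -> 'I_(b - 1) -> T -> R) : (forall k j, measurable_fun setT (Y k j)) ->
   measurable_fun setT (fun w => (\sum_(l <- first_split Y w) (l < x)%R%:R : R)%:E).
  move=> mY; apply/measurable_EFinP; apply: (mlist_sum (Phi := fun _ l => (l < x)%R%:R)).
    by apply: mlist_one_split => j; exact: mY.
  by move=> f mf; apply: mfun_natr_bool; exact: measurable_fun_ltr.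
transitivity (\int[P]_w (\sum_(l <- first_split X w) (l < x)%R%:R : R)%:E)%E.
  by apply: eq_integral => w _; rewrite count_lt_sum.
apply: (ge0_ae_eq_integral (f := fun w => (\sum_(l <- first_split X w) (l < x)%R%:R : R)%:E)) => //.
- exact: mY.
- exact: mY measurable_clipped.
- by move=> w _; rewrite lee_fin sumr_ge0.
- by move=> w _; rewrite lee_fin sumr_ge0.
exists degenerate; split; [exact: measurable_degenerate|exact: degenerate_null|].
move=> w /= H; apply: contrapT => nw; apply: H => _.
by rewrite /first_split (path_clipped nw).
Qed.

Lemma expected_countB x y : x < y ->
  ES P (first_split clipped) (fun l => (x <= l < y)%R%:R) = F y - F x.
Proof.
move=> xy; rewrite !expected_countE /ES.
have r z : regular (fun l => (l < z)%R%:R : R).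
  by apply: (regular_bool (f := fun l => l < z)); exact: measurable_fun_ltr.
rewrite -ExB; [|exact: (regular_bm mS sizeS S01)..].
congr Ex; apply/funext => w; rewrite -sumrB; apply: eq_bigr => l _.
have [lx|xl] := ltP l x; first by rewrite (lt_trans lx xy) subrr.
by rewrite subr0.
Qed.

(** The mean value theorem turns the bound on [F'] into a bound on the mean number of pieces in an
    interval. *)
Lemma clipped_density delta : (forall x, x \in `]0, 1[ -> derivable F x 1) ->
  (forall x, x \in `]0, 1[ -> delta <= derive1 F x) ->
  forall x y, 0 < x -> x < y -> y < 1 ->
  delta * (y - x) <= ES P (first_split clipped) (fun l => (x <= l < y)%R%:R).
Proof.
move=> dF Fd x y x0 xy y1; rewrite expected_countB//.
have I z : z \in `[x, y] -> z \in `]0, 1[.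
  rewrite !in_itv /= => /andP[xz zy].
  by rewrite (lt_le_trans x0 xz) (le_lt_trans zy y1).
have [c cI ->] : exists2 c, c \in `]x, y[ & F y - F x = derive1 F c * (y - x).
  apply: (MVT xy) => [z zI|].
    rewrite derive1E; apply: DeriveDef => //; apply: dF; apply: I.
    exact: subset_itv_oo_cc zI.
  by apply: derivable_within_continuous => z zI; apply: dF; exact: I.
rewrite ler_pM2r ?subr_gt0//; apply: Fd; apply: I; exact: subset_itv_oo_cc cI.
Qed.

Lemma clipped_cont : (forall eps : R, 0 < eps -> exists2 eta : R, 0 < eta &
     forall x y, x \in `]0, 1[ -> y \in `]0, 1[ -> `|x - y| < eta -> `|F x - F y| < eps) ->
  forall omega : R, 0 < omega -> exists2 eta : R, 0 < eta &
  forall x y : R, 0 < x -> x < y -> y < 1 -> y - x < eta ->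
    ES P (first_split clipped) (fun l => (x <= l < y)%R%:R) <= omega.
Proof.
move=> uc omega om0; have [eta eta0 H] := uc _ om0; exists eta => // x y x0 xy y1 yx.
rewrite expected_countB//; apply: le_trans (ler_norm _) (ltW _); apply: H.
- by rewrite in_itv /= y1 (lt_trans x0 xy).
- by rewrite in_itv /= x0 (lt_trans xy y1).
- by rewrite ger0_norm// subr_ge0 ltW.
Qed.

(** * Measurability of the events in the conclusion *)

Let mlist_path n : mlist (fun w => frag_state (path X w) n).
Proof. by apply: mlist_frag_state => k j _; exact: mX. Qed.

Lemma measurable_mean_event n (y c eps : R) :
  measurable [set w | eps < `|mean_spacing (path X w) n y - c|].
Proof.
pose z w : R := max_len (frag_state (path X w) n) *
  \sum_(p <- gaps (frag_state (path X w) n)) ((0 <= p.1) && (p.2 <= y))%R%:R.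
have mz : measurable_fun setT z.
  apply: measurable_funM; first exact: mlist_max_len.
  apply: (mlist2_sum (Phi := fun p => ((0 <= p.1) && (p.2 <= y))%R%:R)); first exact: mlist_gaps.
  by move=> f g mf mg; apply: mfun_natr_bool; apply: measurable_and; exact: measurable_fun_ler.
have z0 w : 0 <= z w by rewrite mulr_ge0 ?max_len_ge0// sumr_ge0.
have mE w : mean_spacing (path X w) n y = y / z w.
  rewrite /mean_spacing /z; congr (_ / (_ * _)).
  by rewrite -sum1_count natr_sum big_mkcond; apply: eq_bigr => p _; case: ifP.
(* The denominator is cleared by cases: a quotient by 0 is 0, which happens when no spacing lies in
   (0,y). *)
rewrite (_ : [set w | _] = [set w | ((z w == 0) && (eps < `|c|)) || ((0 < z w) && (eps * z w < `|y - c * z w|))]).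
  apply: mset_bool; apply: measurable_or; apply: measurable_and => //.
  - exact: measurable_fun_eqr.
  - exact: measurable_fun_ltr.
  - apply: measurable_fun_ltr; first exact: measurable_funM.
    by apply: measurableT_comp => //; apply: measurable_funB => //; exact: measurable_funM.
apply/funext => w; apply/propext => /=; rewrite mE; have := z0 w; rewrite le_eqVlt eq_sym => /orP[/eqP ->|zp].
  by rewrite eqxx ltxx orbF invr0 mulr0 sub0r normrN.
rewrite gt_eqF// zp /= (_ : y / z w - c = (y - c * z w) / z w); last by field; rewrite gt_eqF.
by rewrite normrM normfV (gtr0_norm zp) ltr_pdivlMr.
Qed.

Lemma count_scale_right_cont (s : seq R) (L x : R) : 0 <= L -> exists2 eta : R, 0 < eta &
  forall y, x <= y -> y - x < eta ->
    count (fun l => l <= y * L) s = count (fun l => l <= x * L) s.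
Proof.
move=> L0; elim: s => [|l s [eta eta0 IH]] /=; first by exists 1.
have [lx|xl] := leP l (x * L).
  exists eta => // y xy yx; rewrite IH//.
  by rewrite (le_trans lx)// ler_wpM2r.
have L1 : 0 < L + 1 by lra.
(* Dividing by [L + 1] keeps the witness meaningful when [L = 0]. *)
exists (Num.min eta ((l - x * L) / (L + 1))).
  by rewrite lt_min eta0 divr_gt0// subr_gt0.
move=> y xy; rewrite lt_min => /andP[ye yl]; rewrite IH// leNgt.
suff -> : y * L < l by [].
move: yl; rewrite ltr_pdivlMr// mulrDr mulr1 mulrBl.
lra.
Qed.

Lemma measurable_spacing_event n (x c eps : R) :
  measurable [set w | eps < `|spacing_distr (path X w) n x - c|].
Proof.
pose z w : R := \sum_(l <- gap_lengths (frag_state (path X w) n)) (l <= x * max_len (frag_state (path X w) n))%R%:R.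
have mz : measurable_fun setT z.
  apply: (mlist_sum (Phi := fun w l => (l <= x * max_len (frag_state (path X w) n))%R%:R)).
    by apply: mlist2_lengths; exact: mlist_gaps.
  move=> f mf; apply: mfun_natr_bool; apply: measurable_fun_ler => //.
  by apply: measurable_funM => //; exact: mlist_max_len.
rewrite (_ : [set w | _] = [set w | eps < `|z w / (n * (b - 1)).+1%:R - c|]).
  apply: mset_bool; apply: measurable_fun_ltr => //.
  apply: measurableT_comp => //; apply: measurable_funB => //.
  exact: measurable_funM.
apply/funext => w; congr (eps < `|_ / _ - c|); rewrite /z -sum1_count natr_sum big_mkcond.
by apply: eq_bigr => l _; case: ifP.
Qed.

(** Both the empirical distribution and [u] are right continuous, so a strict excess at [x < 1]
    persists at a rational just to the right. The point 1, which has no right neighbour in the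
    interval, is added by hand. *)
Lemma measurable_spacing_sup_event (u : R -> R) n (eps : R) :
  (forall x e : R, 0 <= x -> 0 < e -> exists2 eta : R, 0 < eta &
    forall y, x <= y -> y <= 1 -> y - x < eta -> `|u x - u y| <= e) ->
  measurable [set w | exists2 x, x \in `[0, 1] & eps < `|spacing_distr (path X w) n x - u x| ].
Proof.
move=> ucont.
pose A x := [set w | eps < `|spacing_distr (path X w) n x - u x|].
rewrite (_ : [set w | _] = A 1 `|` \bigcup_(q : rat) (if 0 <= (ratr q : R) <= 1 then A (ratr q) else set0)).
  apply: measurableU; first exact: measurable_spacing_event.
  apply: bigcupT_measurable_rat => q; case: ifP => _; last exact: measurable0.
  exact: measurable_spacing_event.
apply/seteqP; split => w /=; last first.
  move=> [h|[q _]]; first by exists 1 => //; rewrite in_itv /= ler01 lexx.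
  by case: ifP => // q01 h; exists (ratr q).
move=> [x]; rewrite in_itv /= => /andP[x0]; rewrite le_eqVlt => /predU1P[->|x1 h]; first by left.
right; set L := max_len (frag_state (path X w) n).
have L0 : 0 <= L by exact: max_len_ge0.
have [eta1 eta10 H1] := count_scale_right_cont (gap_lengths (frag_state (path X w) n)) x L0.
set D := spacing_distr _ _ _ in h.
have e0 : 0 < (`|D - u x| - eps) / 2 by rewrite divr_gt0// subr_gt0.
have [eta2 eta20 H2] := ucont _ _ x0 e0.
have m0 : x < Num.min 1 (x + Num.min eta1 eta2).
  by rewrite lt_min x1 ltrDl lt_min eta10.
have [q] := rat_in_itvoo m0; rewrite in_itv /= !lt_min => /andP[xq /andP[q1]].
rewrite -ltrBlDl lt_min => /andP[qe1 qe2]; exists q => //.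
rewrite (le_trans x0 (ltW xq)) (ltW q1) /= /A /=.
have -> : spacing_distr (path X w) n (ratr q) = D.
  by rewrite /D /spacing_distr -/L; congr (_%:R / _); apply: H1 => //; exact: ltW.
have := H2 _ (ltW xq) (ltW q1) qe2.
have : `|D - u x| <= `|D - u (ratr q)| + `|u x - u (ratr q)|.
  by rewrite -[in leRHS](normrN (u x - _)) (_ : D - u x = (D - u (ratr q)) + - (u x - u (ratr q))) ?ler_normD//; ring.
move: h; move: `|_| `|_| `|_| => *; lra.
Qed.

End Clipping.

Unset Implicit Arguments.

Theorem theorem3 (R : realType) (d : measure_display) (T : measurableType d)
  (P : probability T R) (b : nat) (X : nat -> 'I_(b - 1) -> {RV P >-> R}) :
  (2 <= b)%N ->
  (* division points lie in (0,1) almost surely *)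
  (forall k j, P [set w | 0 < X k j w < 1] = 1%E) ->
  (* the vectors (X k j)_j, k = 0,1,..., are i.i.d. (law of X 0) *)
  (forall (n : nat) (A : nat -> 'I_(b - 1) -> set R),
      (forall k j, measurable (A k j)) ->
      P (\bigcap_(k in [set k | (k < n)%N]) \bigcap_(j in [set: 'I_(b - 1)])
           (X k j @^-1` A k j))
      = (\prod_(k < n) P (\bigcap_(j in [set: 'I_(b - 1)]) (X 0%N j @^-1` A k j)))%E) ->
  let U := fun (w : T) k j => X k j w in
  (* F(x) = expected number of pieces of length < x in one split *)
  let F := fun x : R =>
    fine (\int[P]_w ((count (fun l => l < x) (one_split (fun j => X 0%N j w)))%:R)%:E) in
  (* F uniformly continuous on (0,1) *)
  (forall eps : R, 0 < eps -> exists2 eta : R, 0 < eta &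
     forall x y, x \in `]0, 1[ -> y \in `]0, 1[ -> `|x - y| < eta ->
       `|F x - F y| < eps) ->
  (* F differentiable on (0,1) *)
  (forall x, x \in `]0, 1[ -> derivable F x 1) ->
  (* F' uniformly positive on (0,1) *)
  (exists2 delta : R, 0 < delta & forall x, x \in `]0, 1[ -> delta <= derive1 F x) ->
  (* spacing distribution stationary  <->  mean spacing stationary *)
  ((exists u : R -> R, forall eps : R, 0 < eps ->
      (fun n => P [set w | exists2 x, x \in `[0, 1] &
                    eps < `|spacing_distr (U w) n x - u x| ]) @ \oo --> 0%E)
   <->
   (exists c : R, forall y : R, y \in `]0, 1] -> forall eps : R, 0 < eps ->
      (fun n => P [set w | eps < `|mean_spacing (U w) n y - c| ]) @ \oo --> 0%E)).
Proof.
move=> b2 X01 indX U F Fuc dF [delta delta0 Fdelta].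
pose Y : nat -> 'I_(b - 1) -> T -> R := fun k j => X k j.
have mY k j : measurable_fun setT (Y k j) by exact: measurable_funPT.
have mC := measurable_clipped mY; have C01 := @clipped_unit _ _ _ _ Y.
have indC := clipped_indep mY X01 indX.
have dens := clipped_density mY X01 b2 dF Fdelta.
have Fcont := clipped_cont mY X01 b2 Fuc.
have [M M0 rateM] : exists2 M, 0 <= M & renewal_rate P (first_split (clipped Y)) (fun=> b%:R^-1) M.
  apply: (renewal_limit (b := b) _ _ _ _ delta0 dens) => //.
  - by apply: mlist_one_split => j; exact: mC.
  - by move=> w; exact: size_one_split.
  - by move=> w; exact/one_split_sum/path_unit.
  - by move=> w l lS; rewrite (one_split_ge0 lS) (one_split_le1 (path_unit C01 w 0) lS).
  - by move=> x; rewrite invr_ge0 ler0n invf_le1// ?(ler_nat R 1)// ?ltr0n; lia.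
have offN := whp_off_null (measurable_degenerate mY X01) (degenerate_null mY X01).
split=> _; last first.
  exists (limit_distr b2 mC C01 delta0 dens M) => eps eps0.
  apply: whp_cvg => [n|].
    apply: (measurable_spacing_sup_event mY) => x e x0 e0.
    exact: (limit_distr_right_cont b2 mC C01 indC delta0 dens M0 rateM Fcont x0 e0).
  have h := spacing_distr_whp b2 mC C01 indC delta0 dens M0 rateM Fcont eps0.
  apply: offN h => n w nw; rewrite (path_clipped nw) => h [x x01].
  by apply/negP; rewrite -leNgt; apply: h; move: x01; rewrite in_itv.
exists ((b - 1)%:R * M)^-1 => y y01 eps eps0.
apply: whp_cvg => [n|]; first exact: (measurable_mean_event mY).
have h := mean_spacing_whp b2 mC C01 indC delta0 dens M0 rateM y01 eps0.
apply: offN h => n w nw; rewrite (path_clipped nw) => h.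
by apply/negP; rewrite -leNgt.
Qed.
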